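(* There exists a class $\mathbf{P}$ of pairwise non-embeddable, pathwise connected and locally connected continua such that, for every infinite cardinal $\kappa$, the class $\mathbf{P}$ contains $2^\kappa$ spaces of weight $\kappa$ and size $\max\{\kappa,2^{\aleph_0}\}$.
   Context: A continuum is a compact and connected Hausdorff space with more than one point. The size of a space $X$ is its cardinality $|X|$; the weight $w(X)$ is the least infinite cardinality of a basis of the topology. A space $X$ is embeddable in $Y$ if $X$ is homeomorphic to a subspace of $Y$. Spaces in a class are pairwise non-embeddable if for any two distinct members $X,Y$ of the class, $X$ is not embeddable in $Y$ (and $Y$ is not embeddable in $X$). The class may be a proper class. *)

(* Defs.v *)
From HB Require Import structures.
From mathcomp Require Import all_boot all_order all_algebra.
From mathcomp Require Import all_classical all_reals all_analysis.

Set Implicit Arguments.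
Unset Strict Implicit.
Unset Printing Implicit Defensive.

Import Order.TTheory GRing.Theory Num.Theory.
Import numFieldNormedType.Exports.

Local Open Scope classical_set_scope.
Local Open Scope card_scope.
Local Open Scope ring_scope.

(* A cardinal is represented by a type of that cardinality.  The universe is
   exactly that of the carriers of [topologicalType], so that "every cardinal"
   and "every topological space" range over the same sets. *)
Definition cardinal := Type@{Topological.axioms_.u0}.

Definition cardmax (K L : cardinal) : cardinal :=
  if [set: K] #<= [set: L] then L else K.

(* A class of spaces is a predicate on [topologicalType].  [set topologicalType]
   and [#=] are not available at that universe level, hence the explicit
   bijection from [K] onto the class. *)
Definition class_has_card (P : topologicalType -> Prop) (K : cardinal) : Prop :=
  exists F : K -> topologicalType,
    injective F /\ forall X : topologicalType, P X <-> exists k, F k = X.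

Definition space_has_size (X : topologicalType) (K : cardinal) : Prop :=
  [set: X] #= [set: K].

Definition has_weight (X : topologicalType) (K : cardinal) : Prop :=
  [/\ infinite_set [set: K],
      exists B : set (set X), basis B /\ B #= [set: K]
    & forall B : set (set X), basis B -> infinite_set B -> [set: K] #<= B].

Definition continuum (X : topologicalType) : Prop :=
  [/\ compact [set: X], connected [set: X], hausdorff_space X
    & exists x y : X, x <> y].

Definition pathwise_connected (R : realType) (X : topologicalType) : Prop :=
  forall x y : X, exists f : R -> X,
    [/\ {within `[0, 1], continuous f}, f 0 = x & f 1 = y].

Definition locally_connected (X : topologicalType) : Prop :=
  forall (x : X) (U : set X), open_nbhs x U ->
    exists V : set X, [/\ open_nbhs x V, connected V & V `<=` U].

Definition homeomorphic (X Y : topologicalType) : Prop :=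
  exists (f : X -> Y) (g : Y -> X),
    [/\ continuous f, continuous g, cancel f g & cancel g f].

(* [set_type A] carries the subspace topology of [A]; the library's [subspace A]
   would instead retopologize the whole of [Y]. *)
Definition embeddable (X Y : topologicalType) : Prop :=
  exists A : set Y, homeomorphic X (set_type A).

(* [X] and [Y] are quantified in both orders, so neither embeds in the other. *)
Definition pairwise_non_embeddable (P : topologicalType -> Prop) : Prop :=
  forall X Y : topologicalType, P X -> P Y -> X <> Y -> ~ embeddable X Y.

(* Main.v *)
Require Import Defs.
From HB Require Import structures.
From mathcomp Require Import all_boot all_order all_algebra.
From mathcomp Require Import all_classical all_reals all_analysis.
From mathcomp Require Import ring lra zify.
From mathcomp Require wochoice.
From Stdlib Require ClassicalEpsilon FunctionalExtensionality.

(** Every space of the class codes a family S of bits indexed by a type K, in a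
    way which each injective continuous map has to respect. The first tool is
    the notion of [branch_point], the centre of an embedded triod: injective
    continuous maps send branch points to branch points, and the spaces below
    have very few of them.

    If K is countable, the space is a chain of beads: each of the points
    1 - 1/(n+1) of [0, 1] is joined to the next one by three, four or five arcs.
    These knots are the only branch points ([branch_knotp]). An embedding sends
    neighbouring knots to neighbouring knots ([knot_image_adjacent]), never turns
    back ([knot_image_shift]) and does not decrease the number of arcs
    ([strand_count]); the bits are written in such a way that this determines
    them ([bead_code_inj]).

    If K is uncountable, an interval is too short to carry the bits. It is
    replaced by a long linear continuum Z which contains no arc, so that its
    order type is rigid, and paths are restored by one extra dimension: the space
    is Z x [0, 1] with its whole boundary collapsed to one point, the pole
    ([sphere]). Off the pole paths can only move along a fibre {z} x (0, 1)
    ([zco_path]). Hence the pole is the only branch point, an embedding sends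
    pole to pole and fibres into fibres, and it induces a monotone bijection
    between the two linear continua deprived of their end points
    ([sphere_embedding]).

    The continuum Z is the [ladder] over a linear order I. A point runs through
    one edge for each element of I; an edge is an interval in which the points
    of an everywhere uncountable set are replaced by intervals, in each of which
    the same points are again replaced, and so on. A nonconstant path would cross
    uncountably many disjoint open sets ([ladder_no_arc]), yet a point of an edge
    is described by a sequence of reals ([ladder_emb]), which keeps the size down
    to max(K, 2^aleph_0).

    For I one takes a sum of columns indexed by a well-order of K ([code]): the
    column of k is omega1, or a single element if the bit S k is off, followed by
    a reversed omega1; a last column is omega1. The inner points of Z to which no
    sequence converges from the right are then exactly the middles of the columns
    of the elements of K ([large_bit_point]), and the bit of k is off exactly when
    there is a countable approach from the left ([bit_point_left]). The left end
    of Z has countable character and the right end has not, so the bijection of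
    continua preserves the order. It therefore yields an isomorphism of
    well-orders which preserves the bits ([coded_sphere_embedding]): K is
    determined up to equipotency, and S is determined because a well-order has no
    automorphism but the identity ([wellorder_rigid]).

    Weights are computed from a separating family of K real functions, on a
    compact space, and from K disjoint open sets ([has_weight_disjoint]). Finally
    the index types are normalized by choosing one type [rep K] of each
    cardinality, so that each cardinal contributes exactly 2^K spaces. *)

Set Implicit Arguments.
Unset Strict Implicit.
Unset Printing Implicit Defensive.

Import Order.TTheory GRing.Theory Num.Theory.
Import numFieldNormedType.Exports.

Local Open Scope classical_set_scope.
Local Open Scope card_scope.
Local Open Scope ring_scope.

(** * Arithmetic of infinite cardinals *)

Definition emb (A B : Type) := exists f : A -> B, injective f.

Lemma embP (T U : Type) : [set: T] #<= [set: U] <-> emb T U.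
Proof.
split=> [/card_leP[f]|[f fI]].
  exists (fun x => set_val (f (SigSub (mem_set (I : [set: T] x))))) => x y.
  move/val_inj => /(@inj _ _ _ f) E.
  by have := E (mem_set I) (mem_set I); case.
apply: (card_le_trans (B := f @` [set: T])); last exact: card_leT.
by have /card_eqPle[] : f @` [set: T] #= [set: T]
  by apply: inj_card_eq => x y _ _ /fI.
Qed.

Lemma emb_trans A B C : emb A B -> emb B C -> emb A C.
Proof. by move=> [f fI] [g gI]; exists (g \o f); exact: inj_comp. Qed.

Lemma emb_refl A : emb A A.
Proof. by exists id. Qed.

Lemma emb_prod A B C D : emb A C -> emb B D -> emb (A * B) (C * D).
Proof.
move=> [f fI] [g gI]; exists (fun p => (f p.1, g p.2)) => -[a b] [a' b'] /= [].
by move=> /fI -> /gI ->.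
Qed.

Lemma emb_fun A B C : emb A B -> emb (C -> A) (C -> B).
Proof.
move=> [f fI]; exists (fun u c => f (u c)) => u v E.
by apply/funext => c; apply: fI; move: E => /(congr1 (@^~ c)).
Qed.

Lemma emb_curry A B C : emb (A -> B -> C) (A * B -> C).
Proof.
exists (fun u p => u p.1 p.2) => u v E; apply/funext => a; apply/funext => b.
by move: E => /(congr1 (@^~ (a, b))).
Qed.

Lemma emb_precomp A B C : emb A B -> (exists c : C, True) ->
  emb (A -> C) (B -> C).
Proof.
move=> [f fI] [c0 _].
exists (fun u b => if pselect (exists a, f a = b) is left e then u (sval (cid e))
                   else c0) => u v E.
apply/funext => a; move: E => /(congr1 (@^~ (f a))).
case: pselect => [e|ne _]; last by exfalso; apply: ne; exists a.
by have /fI -> := svalP (cid e).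
Qed.

Lemma emb_surj (A B : Type) (f : A -> B) : (forall b, exists a, f a = b) -> emb B A.
Proof.
move=> fS; exists (fun b => sval (cid (fS b))) => b c E.
by rewrite -(svalP (cid (fS b))) E (svalP (cid (fS c))).
Qed.

(** A maximal partial injection is total on one of the two sides. *)
Lemma emb_total (A B : Type) : emb A B \/ emb B A.
Proof.
pose P (G : set (A * B)) :=
  (forall a b b', G (a, b) -> G (a, b') -> b = b') /\
  (forall a a' b, G (a, b) -> G (a', b) -> a = a').
have [F FP Fc|G [[Gf Gi] Gm]] := @Zorn_bigcup _ P.
  have Fd X Y : F X -> F Y -> exists2 Z, F Z & X `<=` Z /\ Y `<=` Z.
    move=> FX FY; case: (Fc _ _ FX FY) => s; [exists Y|exists X] => //; by split=> // z; exact: s.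
  split=> [a b b'|a a' b] [X FX Xa] [Y FY Ya];
    have [Z /FP[Zf Zi] [XZ YZ]] := Fd _ _ FX FY.
  - by apply: Zf; [exact: XZ Xa|exact: YZ Ya].
  - by apply: Zi; [exact: XZ Xa|exact: YZ Ya].
have [tot|/existsNP[a0 na0]] := pselect (forall a, exists b, G (a, b)).
  left; exists (fun a => sval (cid (tot a))) => a a' E.
  apply: (Gi _ _ (sval (cid (tot a)))); first exact: (svalP (cid (tot a))).
  by rewrite E; exact: (svalP (cid (tot a'))).
right; have tot b : exists a, G (a, b).
  apply: contrapT => nb; apply: (Gm (G `|` [set (a0, b)])).
    split=> [x|/(_ (a0, b) (or_intror erefl)) Gab]; first by left.
    by apply: nb; exists a0.
  split=> [a c c'|a a' c] [Gac|[ea ec]] [Gac'|[ea' ec']]; subst => //.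
  - exact: Gf Gac Gac'.
  - by exfalso; apply: na0; exists c.
  - by exfalso; apply: na0; exists c'.
  - exact: Gi Gac Gac'.
  - by exfalso; apply: nb; exists a.
  - by exfalso; apply: nb; exists a'.
exists (fun b => sval (cid (tot b))) => b b' E.
apply: (Gf (sval (cid (tot b)))); first exact: (svalP (cid (tot b))).
by rewrite E; exact: (svalP (cid (tot b'))).
Qed.

Section Square.
Variable K : Type.
Hypothesis Kinf : emb nat K.

Let D (G : set ((K * K) * K)) : set K := [set k | exists c, G ((k, k), c)].
Let P0 (G : set ((K * K) * K)) :=
  [/\ forall p c c', G (p, c) -> G (p, c') -> c = c',
      forall p p' c, G (p, c) -> G (p', c) -> p = p',
      forall p c, G (p, c) -> [/\ D G p.1, D G p.2 & D G c]
    & forall a b, D G a -> D G b -> exists c, G ((a, b), c)].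

Lemma square_chain (F : set (set ((K * K) * K))) : F `<=` P0 -> total_on F subset ->
  P0 (\bigcup_(X in F) X).
Proof.
move=> FP Fc.
have Fd X Y : F X -> F Y -> exists2 Z, F Z & X `<=` Z /\ Y `<=` Z.
  move=> FX FY; case: (Fc _ _ FX FY) => s; [exists Y|exists X] => //; by split=> // z; exact: s.
have DF X : F X -> D X `<=` D (\bigcup_(X in F) X).
  by move=> FX k [c Xc]; exists c; exists X.
split=> [p c c'|p p' c|p c|a b].
- move=> [X FX Xa] [Y FY Ya]; have [Z /FP[Zf _ _ _] [XZ YZ]] := Fd _ _ FX FY.
  by apply: Zf; [exact: XZ Xa|exact: YZ Ya].
- move=> [X FX Xa] [Y FY Ya]; have [Z /FP[_ Zi _ _] [XZ YZ]] := Fd _ _ FX FY.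
  by apply: Zi; [exact: XZ Xa|exact: YZ Ya].
- move=> [X FX Xa]; have [_ _ /(_ _ _ Xa)[? ? ?] _] := FP _ FX.
  by split; apply: (DF X).
- move=> [c [X FX Xa]] [d [Y FY Ya]].
  have [Z FZ [XZ YZ]] := Fd _ _ FX FY.
  have [_ _ _ /(_ a b)[||e Ze]] := FP _ FZ.
  + by exists c; apply: XZ.
  + by exists d; apply: YZ.
  + by exists e; exists Z.
Qed.

(** Hessenberg's theorem, from a maximal injection of the form D * D -> D with
    D infinite: if D were not equipotent to K, a disjoint copy of D would allow
    to extend it. *)
Lemma emb_square : emb (K * K) K.
Proof.
have [e eI] := Kinf.
have [cd cdI] : emb (nat * nat) nat by apply/embP; have /card_eqPle[] := card_nat2.
pose G0 : set ((K * K) * K) :=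
  [set x | exists m n, x = ((e m, e n), e (cd (m, n)))].
have DG0 k : D G0 k <-> exists m, k = e m.
  split=> [[c [m [n [-> _ _]]]]|[m ->]]; first by exists m.
  by exists (e (cd (m, m))), m, m.
have G0P : P0 G0.
  split=> [p c c'|p p' c|p c|a b].
  - move=> [m [n [-> ->]]] [m' [n' [/eI <- /eI <- ->]]] //.
  - by move=> [m [n [-> ->]]] [m' [n' [-> /eI/cdI[-> ->]]]].
  - by move=> [m [n [-> ->]]] /=; split; apply/DG0; [exists m|exists n|
      exists (cd (m, n))].
  - by move=> /DG0[m ->] /DG0[n ->]; exists (e (cd (m, n))), m, n.
pose P G := G = set0 \/ (P0 G /\ G0 `<=` G).
have [F FP Fc|G [PG Gm]] := @Zorn_bigcup _ P.
  have [Fe|/existsNP[X0 /not_implyP[FX0 X0e]]] := pselect (forall X, F X -> X = set0).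
    by left; rewrite bigcup0.
  right; have -> : \bigcup_(X in F) X = \bigcup_(X in F `&` [set X | X <> set0]) X.
    apply/seteqP; split=> x [X]; last by move=> [FX _] Xx; exists X.
    by move=> FX Xx; exists X => //; split=> // Xe; rewrite Xe in Xx.
  split.
    apply: square_chain => [X [/FP[//|[]//]]|X Y [FX _] [FY _]].
    exact: Fc.
  by move=> x G0x; exists X0 => //; have [//|[_]] := FP _ FX0; apply.
have {}PG : P0 G /\ G0 `<=` G.
  case: PG => // Ge; exfalso; apply: (Gm G0); last by right; split=> //; exact: subset_refl.
  rewrite Ge; split=> [x []|/(_ ((e 0%N, e 0%N), e (cd (0%N, 0%N))))].
  by apply; exists 0%N, 0%N.
case: PG => -[Gf Gi GD Gt] G0G.
pose DT := {k | D G k}.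
have De m : D G (e m).
  by have /DG0[c /G0G ?] : exists m', e m = e m'; [exists m|exists c].
have [p pI] : emb (DT * DT) DT.
  have q (x : DT * DT) : {d : DT | G ((sval x.1, sval x.2), sval d)}.
    have /cid[c Gc] := Gt _ _ (svalP x.1) (svalP x.2).
    by have [_ _ Dc] := GD _ _ Gc; exists (exist _ c Dc).
  exists (fun x => sval (q x)) => -[[x Dx] [y Dy]] [[x' Dx'] [y' Dy']] E.
  have := svalP (q (exist _ x Dx, exist _ y Dy)); rewrite E.
  move=> /Gi /(_ (svalP (q (exist _ x' Dx', exist _ y' Dy')))) /= [Ex Ey].
  by congr (_, _); apply: eq_exist.
pose b01 (b : bool) : DT := exist _ (e b) (De b).
have bI : injective b01 by move=> [] [] // [] /eI.
have dbl : emb (bool * DT) DT.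
  apply: (emb_trans (B := (DT * DT)%type)); last by exists p.
  by apply: emb_prod; [exists b01|exact: emb_refl].
have DK : emb DT K by exists sval => -[x Dx] [y Dy] /= E; apply: eq_exist.
have [[h hI]|[h hI]] := emb_total {k | ~ D G k} DT.
  have KD : emb K DT.
    apply: emb_trans dbl.
    exists (fun k => match pselect (D G k) with
      | left d => (true, exist _ k d)
      | right n => (false, h (exist _ k n)) end) => x y.
    case: pselect => Dx; case: pselect => Dy //; first by case.
    by move=> [/hI[]].
  apply: (emb_trans (emb_prod KD KD)); apply: emb_trans DK; by exists p.
pose N k := D G k \/ exists d, k = sval (h d).
have Nd (d : DT) : ~ D G (sval (h d)) by exact: (svalP (h d)).
have [m mI] : exists m : K * K -> DT, forall a b a' b', N a -> N b -> N a' -> N b' ->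
    m (a, b) = m (a', b') -> (a, b) = (a', b').
  have [n nI] : exists n : K -> bool * DT, forall a b, N a -> N b -> n a = n b -> a = b.
    pose i (x : bool * DT) := if x.1 then sval (h x.2) else sval x.2.
    have iS a : N a -> exists x, i x = a.
      move=> [Da|[d ->]]; first by exists (false, exist _ a Da).
      by exists (true, d).
    exists (fun a => if pselect (N a) is left na then sval (cid (iS a na))
      else (true, exist _ (e 0%N) (De 0%N))) => a b Na Nb.
    case: pselect => // na; case: pselect => // nb E.
    by rewrite -(svalP (cid (iS a na))) E (svalP (cid (iS b nb))).
  have [r rI] := dbl; exists (fun x => p (r (n x.1), r (n x.2))).
  move=> a b a' b' Na Nb Na' Nb' /pI[/rI/nI Ea /rI/nI Eb].
  by rewrite Ea // Eb.
pose G' := G `|` [set x | [/\ N x.1.1, N x.1.2, ~ (D G x.1.1 /\ D G x.1.2)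
  & x.2 = sval (h (m x.1))]].
have d0 : DT := exist _ (e 0%N) (De 0%N).
have DG' : D G' = N.
  apply/seteqP; split=> k.
    by move=> [c [/GD[/= Dk _ _]|[/= Nk _ _ _]]] //; left.
  move=> Nk; have [[c Gc]|Dk] := pselect (D G k); first by exists c; left.
  by exists (sval (h (m (k, k)))); right; split=> //= -[].
exfalso; apply: (Gm G').
  split; first by move=> x; left.
  have [c G'c] : D G' (sval (h d0)) by rewrite DG'; right; exists d0.
  by move=> /(_ _ G'c)/GD[/= /Nd].
right; split; last by move=> x /G0G; left.
have nDD q c : G (q, c) -> D G q.1 /\ D G q.2 by move=> /GD[].
split=> [q c c'|q q' c|q c|a b].
- move=> [Gc|[/= _ _ nD ->]] [Gc'|[/= _ _ nD' ->]] //; first exact: Gf Gc Gc'.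
  + by case: nD'; exact: nDD Gc.
  + by case: nD; exact: nDD Gc'.
- move=> [Gc|[/= N1 N2 nD E]] [Gc'|[/= N1' N2' nD' E']].
  + exact: Gi Gc Gc'.
  + by have [_ _] := GD _ _ Gc; rewrite E' => /Nd.
  + by have [_ _] := GD _ _ Gc'; rewrite E => /Nd.
  + case: q q' N1 N2 nD E N1' N2' nD' E' => [x y] [x' y'] /= N1 N2 nD -> N1' N2' nD' E.
    apply: mI => //; apply: hI; move: E.
    by case: (h _) => ? ?; case: (h _) => ? ? /= ?; exact: eq_exist.
- rewrite DG' => -[/GD[? ? ?]|[/= ? ? _ ->]]; first by split; left.
  by split=> //; right; eexists.
- rewrite DG' => Na Nb; have [[Da Db]|nD] := pselect (D G a /\ D G b).
    by have [c Gc] := Gt _ _ Da Db; exists c; left.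
  by exists (sval (h (m (a, b)))); right.
Qed.
End Square.

(** The length of a list is recorded next to its folding under a pairing
    function, which alone would not determine it. *)
Lemma emb_seq (K : Type) : emb nat K -> emb (seq K) K.
Proof.
move=> nK; have [p pI] := emb_square nK; have [e eI] := nK.
pose f := fix f s := if s is x :: t then p (x, f t) else e 0%N.
exists (fun s => p (e (size s), f s)) => s t /pI[/eI].
elim: s t => [|x s IH] [|y t] //= [st] /pI[-> /IH ->] //.
Qed.

Lemma emb_sum (A B K : Type) : emb nat K -> emb A K -> emb B K -> emb (A + B) K.
Proof.
move=> nK [f fI] [g gI]; apply: (emb_trans (B := (K * K)%type)); last exact: emb_square.
have [e eI] := nK.
exists (fun x => match x with inl a => (e 0%N, f a) | inr b => (e 1%N, g b) end).
by move=> [a|b] [a'|b'] [] => [/fI ->|/eI|/eI|/gI ->].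
Qed.

Lemma emb_prod_in (A B K : Type) : emb nat K -> emb A K -> emb B K -> emb (A * B) K.
Proof.
move=> nK AK BK; exact: emb_trans (emb_prod AK BK) (emb_square nK).
Qed.

Lemma emb_option (A K : Type) : emb nat K -> emb A K -> emb (option A) K.
Proof.
move=> nK AK; apply: (emb_trans (B := (unit + A)%type)).
  by exists (fun x => if x is Some a then inr a else inl tt) => -[a|] [b|] // [->].
apply: emb_sum => //; have [e _] := nK.
by exists (fun=> e 0%N) => -[] [].
Qed.

(** * Cubes, subspaces and local connectedness *)

(** The product topology; all spaces below are subspaces of such products, so
    that continuity, separation and compactness are read on coordinates. *)
Notation cube J R := {ptws J -> R}.

Section Initial.
Variable R : realType.

Lemma cube_projC (J : Type) (j : J) : continuous (fun v : cube J R => v j).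
Proof.
move=> v U nU; have /cvg_sup/(_ j) H : nbhs v --> v by exact: cvg_id.
apply: H; exact: (@initial_continuous _ _ (fun f : cube J R => f j) v U nU).
Qed.

Lemma cube_contP (M : topologicalType) (J : Type) (f : M -> cube J R) (m : M) :
  (forall j, {for m, continuous (fun x => f x j)}) -> {for m, continuous f}.
Proof.
move=> fc; apply/cvg_sup => j.
move=> U /= [V [[W oW <-] Wm] VU].
have H := fc j W (open_nbhs_nbhs (conj oW Wm)).
by apply: (@filterS _ (nbhs m) _ _ _ _ H) => x Wx; exact: VU.
Qed.

End Initial.

Lemma val_cont (T : topologicalType) (A : set T) : continuous (set_val : set_type A -> T).
Proof. exact: initial_continuous. Qed.

Lemma sub_contP (M T : topologicalType) (A : set T) (f : M -> set_type A) (m : M) :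
  {for m, continuous (fun x => set_val (f x))} -> {for m, continuous f}.
Proof.
move=> fc U /= [V [[W oW <-] Wm] VU].
have H := fc W (open_nbhs_nbhs (conj oW Wm)).
by apply: (@filterS _ (nbhs m) _ _ _ _ H) => x Wx; exact: VU.
Qed.

Lemma sub_compact (T : topologicalType) (A : set T) :
  compact A -> compact [set: set_type A].
Proof.
move=> cA F PF _.
have [|a [Aa ca]] := cA (set_val @ F) (fmap_proper_filter _ PF).
  by apply: (@filterS _ F _ setT) => [x _|]; [exact: set_valP|exact: filterT].
exists (SigSub (mem_set Aa)); split=> // B C FB /= [V [[W oW <-] Wa] VC].
have [|x [Bx Wx]] := ca (set_val @` B) W _ (open_nbhs_nbhs (conj oW Wa)).
  by apply: (@filterS _ F _ B) FB => y By; exists y.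
by move: Bx Wx => [y By <-] Wy; exists y; split=> //; exact: VC.
Qed.

Lemma inj_hausdorff (S T : topologicalType) (f : S -> T) :
  continuous f -> injective f -> hausdorff_space T -> hausdorff_space S.
Proof.
move=> fc fI hT x y xy; apply: fI; apply: hT => A B fxA fyB.
have [z [Az Bz]] := xy _ _ (fc _ _ fxA) (fc _ _ fyB).
by exists (f z).
Qed.

Lemma sub_hausdorff (T : topologicalType) (A : set T) :
  hausdorff_space T -> hausdorff_space (set_type A).
Proof. by apply: inj_hausdorff; [exact: val_cont|exact: val_inj]. Qed.

Lemma cube_hausdorff (R : realType) (J : Type) : hausdorff_space (cube J R).
Proof.
move=> p q pq; apply/funext => j; apply: (@Rhausdorff R) => A B pA qB.
have [z [Az Bz]] := pq _ _ (@cube_projC R J j _ _ pA) (@cube_projC R J j _ _ qB).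
by exists (z j).
Qed.

Lemma cube_compact (R : realType) (J : Type) :
  compact [set v : cube J R | forall j, 0 <= v j <= 1].
Proof.
have := @tychonoff {classic J} (fun=> R) (fun=> `[0, 1]%classic)
  (fun=> @segment_compact R 0 1).
by congr (compact _).
Qed.

Section RealFacts.
Variable R : realType.

(** Truncation to [a, b]; it turns maps defined on a segment into maps of the
    whole line. *)
Definition clamp (a b x : R) := Num.min b (Num.max a x).

Lemma clamp_cont a b : continuous (clamp a b).
Proof.
apply: min_fun_continuous; first exact: cst_continuous.
by apply: max_fun_continuous; [exact: cst_continuous|move=> ?; exact: cvg_id].
Qed.

Lemma clamp_in a b x : a <= b -> a <= clamp a b x <= b.
Proof.
by move=> ab; rewrite /clamp le_min ge_min lexx ab le_max lexx.
Qed.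

Lemma clamp_id a b x : a <= x <= b -> clamp a b x = x.
Proof. by move=> /andP[ax xb]; rewrite /clamp max_r // min_r. Qed.

(** The maps to which this is applied are continuous off some point only, hence
    the hypothesis at the points of the segment. *)
Lemma ivt (f : R -> R) a b v : a <= b -> (forall x, a <= x <= b -> {for x, continuous f}) ->
  (f a <= v <= f b) || (f b <= v <= f a) -> exists2 c, a <= c <= b & f c = v.
Proof.
move=> ab fc fv; have [||c cab <-] := @IVT R f a b v ab.
- apply: continuous_in_subspaceT => x; rewrite inE /= in_itv /= => xab; exact: fc.
- by move: fv => /orP[] /andP[H1 H2]; rewrite ge_min le_max H1 H2 ?orbT.
by exists c => //; move: cab; rewrite in_itv.
Qed.

Section RealValued.
Variables (T : topologicalType) (f g : T -> R) (x : T).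
Hypotheses (fc : {for x, continuous f}) (gc : {for x, continuous g}).

Lemma contB : {for x, continuous (fun y => f y - g y)}.
Proof. exact: cvgB. Qed.

Lemma contM : {for x, continuous (fun y => f y * g y)}.
Proof. exact: cvgM. Qed.

Lemma contZ a : {for x, continuous (fun y => a * f y)}.
Proof. by apply: cvgM => //; exact: cvg_cst. Qed.

Lemma contV : f x != 0 -> {for x, continuous (fun y => (f y)^-1)}.
Proof. by move=> fx0; exact: cvgV. Qed.

End RealValued.

Lemma cont_comp (S T U : topologicalType) (f : S -> T) (g : T -> U) x :
  {for x, continuous f} -> {for f x, continuous g} -> {for x, continuous (fun y => g (f y))}.
Proof. exact: continuous_comp. Qed.

Lemma connectedR_lc : locally_connected R.
Proof.
move=> x U [oU Ux].
have /nbhs_ballP[e e0 eU] : nbhs x U by exact: open_nbhs_nbhs.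
exists (ball x e); split=> //.
- by split; [exact: ball_open|exact: ballxx].
- rewrite ball_itv; exact/connected_intervalP/interval_is_interval.
Qed.

End RealFacts.

Lemma connected_image (T U : topologicalType) (A : set T) (f : T -> U) :
  connected A -> continuous f -> connected (f @` A).
Proof.
by move=> Ac fc; apply: connected_continuous_connected => //; exact: continuous_subspaceT.
Qed.

Lemma compact_image (T U : topologicalType) (A : set T) (f : T -> U) :
  compact A -> continuous f -> compact (f @` A).
Proof.
by move=> Ac fc; apply: continuous_compact => //; exact: continuous_subspaceT.
Qed.

Lemma pair_contr (S T : topologicalType) (a : S) : continuous (fun t : T => (a, t)).
Proof. move=> x; apply: cvg_pair => //; exact: cvg_cst. Qed.

Lemma pair_contl (S T : topologicalType) (b : T) : continuous (fun s : S => (s, b)).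
Proof. move=> x; apply: cvg_pair => //; exact: cvg_cst. Qed.

(** A product box is the union of the crosses through one of its horizontal
    lines. *)
Lemma connected_box (S T : topologicalType) (A : set S) (B : set T) :
  connected A -> connected B -> connected (A `*` B).
Proof.
move=> cA cB; have [->|/set0P[[a0 b0] [/= Aa0 Bb0]]] := eqVneq (A `*` B) set0.
  exact: connected0.
have -> : A `*` B = \bigcup_(a in A) ((fun x => (x, b0)) @` A `|` pair a @` B).
  apply/seteqP; split=> [[a b] [/= Aa Bb]|[a b] [c Ac [[x Ax [<- <-]]|[y By [<- <-]]]]] //.
  by exists a => //; right; exists b.
apply: bigcup_connected.
  by exists (a0, b0) => a Aa; left; exists a0.
move=> a Aa; apply: connectedU.
- by exists (a, b0); split; [exists a|exists b0].
- by apply: connected_image => //; exact: pair_contl.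
- by apply: connected_image => //; exact: pair_contr.
Qed.

Lemma locally_connected_prod (S T : topologicalType) :
  locally_connected S -> locally_connected T -> locally_connected (S * T)%type.
Proof.
move=> lS lT [x y] U [oU Uxy].
have [[A B] /= [xA yB] AB] : nbhs (x, y) U by exact: open_nbhs_nbhs.
move: xA yB; rewrite !nbhsE => -[A' xA' A'A] [B' yB' B'B].
have [V [xV cV VA]] := lS _ _ xA'; have [W [yW cW WB]] := lT _ _ yB'.
exists (V `*` W); split; last 1 first.
- by move=> [a b] [/= /VA/A'A Aa /WB/B'B Bb]; exact: AB.
- split; last by split; [case: xV|case: yW].
  have -> : V `*` W = (fst @^-1` V) `&` (snd @^-1` W) by [].
  by apply: openI; apply: open_comp; [move=> ? _; exact: cvg_fst|case: xV|
    move=> ? _; exact: cvg_snd|case: yW].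
- exact: connected_box.
Qed.

(** Components of open sets of X are open because their preimages are: the
    finitely many maps together form a closed surjection, hence a quotient
    map, and local connectedness passes to quotients. *)
Lemma locally_connected_quotient (I : finType) (M X : topologicalType)
    (A : set M) (q : I -> M -> X) :
  locally_connected M -> compact A -> hausdorff_space X ->
  (forall i, continuous (q i)) -> (forall x, exists i, exists2 a, A a & q i a = x) ->
  locally_connected X.
Proof.
move=> lM cA hX qc qS x U [oU Ux].
pose C := connected_component U x.
have Cx : C x by exact: connected_component_refl.
exists C; split; [|exact: component_connected|exact: connected_component_sub].
split => //.
have oqC i : open (q i @^-1` C).
  rewrite openE => a /= Ca; rewrite /interior /=.
  have Ua : open_nbhs a (q i @^-1` U).
    split; first by apply: open_comp => // ? _; exact: qc.
    exact: connected_component_sub Ca.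
  have [V [[oV Va] cV VU]] := lM _ _ Ua.
  apply: (filterS (P := V)); last exact: open_nbhs_nbhs.
  move=> b Vb; apply: (connected_component_trans Ca).
  exists (q i @` V); last by exists b.
  split; [by exists a|by move=> _ [c Vc <-]; exact: VU|exact: connected_image].
have -> : C = ~` (\bigcup_(i in [set: I]) (q i @` (A `&` ~` (q i @^-1` C)))).
  apply/seteqP; split=> [y Cy [i _ [a [_ /= nCa] E]]|y ny].
    by apply: nCa; rewrite E.
  apply: contrapT => nCy; apply: ny; have [i [a Aa E]] := qS y.
  by exists i => //; exists a => //; split=> //=; rewrite E.
apply: closed_openC.
have -> : [set: I] = [set` enum I] by apply/seteqP; split=> i //= _; rewrite mem_enum.
rewrite bigcup_seq; apply: closed_bigsetU => i _; apply: compact_closed => //.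
apply: compact_image => //.
by apply: compact_closedI => //; exact: open_closedC.
Qed.

(** * Weight and branch points *)

Section Weight.
Variables (R : realType) (X : topologicalType) (J K : Type) (f : J -> X -> R).
Hypotheses (cX : compact [set: X]) (fc : forall j, continuous (f j)).
Hypothesis fsep : forall x y, x <> y -> exists j, f j x <> f j y.
Hypotheses (nK : emb nat K) (JK : emb J K).

Let slab (p : J * (rat * rat)) : set X :=
  [set x | ratr p.2.1 < f p.1 x /\ f p.1 x < ratr p.2.2].

Let slabs := fix slabs (s : seq (J * (rat * rat))) : set X :=
  if s is p :: t then slab p `&` slabs t else setT.

Let slabs_cat s t : slabs (s ++ t) = slabs s `&` slabs t.
Proof. by elim: s => [|p s IH] /=; rewrite ?setTI // IH setIA. Qed.

Let slabs_open s : open (slabs s).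
Proof.
elim: s => [|p s IH] /=; first exact: openT.
apply: openI => //.
have -> : slab p = (f p.1 @^-1` [set y | ratr p.2.1 < y]) `&`
  (f p.1 @^-1` [set y | y < ratr p.2.2]) by [].
apply: openI; apply: open_comp.
- by move=> ? _; exact: fc.
- exact: open_gt.
- by move=> ? _; exact: fc.
- exact: open_lt.
Qed.

(** On a compact space, the topology induced by a separating family of
    continuous functions is the whole topology. *)
Lemma separating_basis : exists B : set (set X), basis B /\ B #<= [set: K].
Proof.
exists [set slabs s | s in setT]; split; last first.
  apply: card_le_trans (card_image_le _ _) _; apply/embP.
  apply: (emb_trans (B := seq K)); last exact: emb_seq.
  have [g gI] : emb (J * (rat * rat)) K.
    have rK : emb rat K.
      by apply: emb_trans nK; apply/embP; have /card_eqPle[] := card_rat.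
    by apply: emb_prod_in => //; exact: emb_prod_in.
  by exists (map g); exact: inj_map.
split; first by move=> _ [s _ <-]; exact: slabs_open.
move=> x W; rewrite nbhsE => -[W' [oW' W'x] W'W].
apply: contrapT => nW.
have bad s : slabs s x -> exists2 y, slabs s y & ~ W' y.
  move=> sx; apply: contrapT => H; apply: nW; exists (slabs s).
    by split => //; exists s.
  move=> y sy; apply: W'W; apply: contrapT => nW'y; apply: H; by exists y.
(* If no basic neighbourhood of x lay in W, the basic neighbourhoods would
   cluster outside W at some y, which a member of the family separates from x. *)
pose F := filter_from [set s | slabs s x] (fun s => slabs s `&` ~` W').
have PF : ProperFilter F.
  apply: filter_from_proper.
    apply: filter_from_filter; first by exists [::].
    move=> s t sx tx; exists (s ++ t); first by rewrite /= slabs_cat.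
    by rewrite slabs_cat => y [[? ?] ?].
  by move=> s /bad[y sy nW'y]; exists y.
have [|y [_ Fy]] := cX PF; first exact: filterT.
have nW'y : ~ W' y.
  move=> W'y; have [|z [[_ /= nWz] Wz]] := Fy (slabs [::] `&` ~` W') W' _
    (open_nbhs_nbhs (conj oW' W'y)); last exact: nWz.
  by exists [::].
have xy : x <> y by move=> xy; apply: nW'y; rewrite -xy.
have [j fj] := fsep xy.
have sepr a b (V : set R) : ratr a < f j x -> f j x < ratr b ->
    open V -> V (f j y) -> (forall r, V r -> ~ (ratr a < r /\ r < ratr b)) -> False.
  move=> ax xb oV Vy nV.
  have [||z [[[sz _] _] Vz]] := Fy (slabs [:: (j, (a, b))] `&` ~` W') (f j @^-1` V).
  - by exists [:: (j, (a, b))] => //=; split.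
  - by apply: fc; exact: open_nbhs_nbhs.
  - exact: nV Vz sz.
have [xy'|yx|//] := ltgtP (f j x) (f j y).
- have [b] := rat_in_itvoo xy'; rewrite in_itv /= => /andP[xb yb].
  have /rat_in_itvoo[a] : f j x - 1 < f j x by lra.
  rewrite in_itv /= => /andP[_ ax].
  apply: (sepr a b [set r | ratr b < r]) => //.
  by move=> r /= br [_ rb]; have := lt_trans br rb; rewrite ltxx.
- have [a] := rat_in_itvoo yx; rewrite in_itv /= => /andP[ya ax].
  have /rat_in_itvoo[b] : f j x < f j x + 1 by lra.
  rewrite in_itv /= => /andP[xb _].
  apply: (sepr a b [set r | r < ratr a]) => //.
  by move=> r /= ra [ar _]; have := lt_trans ra ar; rewrite ltxx.
Qed.

Lemma disjoint_open_le_basis (O : K -> set X) (B : set (set X)) :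
  (forall k, open (O k)) -> (forall k, O k !=set0) ->
  (forall k l x, O k x -> O l x -> k = l) -> basis B -> [set: K] #<= B.
Proof.
move=> oO nO dO [_ bB].
have ch k : exists2 V, B V & (V !=set0 /\ V `<=` O k).
  have [x Ox] := nO k.
  have [V [BV Vx] VO] := bB x _ (open_nbhs_nbhs (conj (oO k) Ox)).
  by exists V => //; split => //; exists x.
pose V k := s2val (cid2 (ch k)).
have VB k : B (V k) by exact: s2valP (cid2 (ch k)).
have VO k : V k !=set0 /\ V k `<=` O k by exact: s2valP' (cid2 (ch k)).
have Vi : injective V.
  move=> k l kl; have [[x Vx] VOk] := VO k; have [_ VOl] := VO l.
  by apply: (dO k l x); [exact: VOk|apply: VOl; rewrite -kl].
apply: (card_le_trans (B := V @` [set: K])).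
  by have /card_eqPle[] : V @` [set: K] #= [set: K]
    by apply: inj_card_eq => k l _ _ /Vi.
by apply: subset_card_le => _ [k _ <-].
Qed.

Lemma has_weight_disjoint (O : K -> set X) :
  (forall k, open (O k)) -> (forall k, O k !=set0) ->
  (forall k l x, O k x -> O l x -> k = l) -> has_weight X K.
Proof.
move=> oO nO dO; split.
- by apply/infiniteP/embP.
- have [B [bB BK]] := separating_basis; exists B; split=> //.
  by apply/card_eqPle; split => //; exact: disjoint_open_le_basis bB.
- by move=> B bB _; exact: disjoint_open_le_basis bB.
Qed.

End Weight.

Section Branch.
Variable R : realType.

(** The centre of an embedded triod: three arcs which meet only at x. *)
Definition branch_point (X : topologicalType) (x : X) :=
  exists g : 'I_3 -> R -> X, [/\ forall i, continuous (g i), forall i, g i 0 = x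
    & forall i i' s s', 0 <= s <= 1 -> 0 <= s' <= 1 -> g i s = g i' s' ->
        s = s' /\ (0 < s -> i = i')].

Lemma branch_point_inj (X Y : topologicalType) (f : X -> Y) (x : X) :
  continuous f -> injective f -> branch_point x -> branch_point (f x).
Proof.
move=> fc fI [g [gc g0 gI]]; exists (fun i s => f (g i s)); split=> [i s|i|].
- by apply: continuous_comp; [exact: gc|exact: fc].
- by rewrite g0.
- by move=> i i' s s' s1 s'1 /fI; exact: gI.
Qed.

(** If all short paths issued from x stay in a set A that a function h maps
    injectively to the line, two of the three arcs of a triod leave on the same
    side of h x and overlap by the intermediate value theorem. *)
Lemma not_branch_point (X : topologicalType) (x : X) (U A : set X) (h : X -> R) :
  nbhs x U -> (forall y, U y -> {for y, continuous h}) ->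
  (forall (g : R -> X) e, continuous g -> g 0 = x -> 0 < e ->
     (forall s, 0 <= s <= e -> U (g s)) -> forall s, 0 <= s <= e -> A (g s)) ->
  (forall y z, A y -> A z -> h y = h z -> y = z) -> ~ branch_point x.
Proof.
move=> Ux hc UA hI [g [gc g0 gI]].
have : \forall s \near (0 : R), forall i, U (g i s).
  by apply: (@filter_forall _ _ (fun i s => U (g i s)) (nbhs (0 : R))) => i; have := gc i 0 U; rewrite g0 => /(_ Ux).
move=> /nbhs_ballP[d /= d0 dU].
(* Up to time e all three arcs stay near x. *)
pose e := Num.min 1 (d / 2).
have e0 : 0 < e by rewrite lt_min ltr01 divr_gt0.
have e1 : e <= 1 by rewrite ge_min lexx.
have eU s : 0 <= s <= e -> forall i, U (g i s).
  move=> /andP[s0 se] i; have /dU : ball (0 : R) d s; last by apply.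
  rewrite /ball /= sub0r normrN ger0_norm //.
  by apply: le_lt_trans se _; rewrite gt_min; apply/orP; right; lra.
have eA s i : 0 <= s <= e -> A (g i s) by move: s; apply: (UA (g i)) => // t te; exact: eU.
have ee : 0 <= e <= e by rewrite lexx ltW.
have e01 : 0 <= e <= 1 by rewrite e1 ltW.
pose v i := h (g i e).
have vx i : v i != h x.
  apply/eqP => E; have /gI[//||E0 _] : g i e = g i 0.
  - by apply: hI; [exact: eA|apply: eA; rewrite lexx ltW|rewrite g0].
  - by rewrite lexx ler01.
  - by move: e0; rewrite E0 ltxx.
(* If v i lies between h x and v i', the arc i' reaches the level v i, that is,
   the point g i e. *)
have key i i' : i != i' -> (h x <= v i <= v i') || (v i' <= v i <= h x) -> False.
  move=> ii' vv; have [||c /andP[c0 ce] hcE] := @ivt R (fun s => h (g i' s)) 0 e (v i) (ltW e0).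
  - move=> s s01; apply: continuous_comp; [exact: gc|apply: hc; exact: eU].
  - by rewrite g0.
  have /gI[||->] : g i' c = g i e by apply: hI => //; apply: eA; rewrite ?c0.
  - by rewrite c0 (le_trans ce).
  - by [].
  - by move=> /(_ e0) E; rewrite E eqxx in ii'.
have key2 i i' : i != i' -> (h x < v i) = (h x < v i') -> False.
  move=> ii'; have [xi|ix|E] := ltgtP (h x) (v i); last by have := vx i; rewrite E eqxx.
  - move=> /esym xi'; have [le|le] := leP (v i) (v i').
      by apply: (key i i') => //; rewrite (ltW xi) le.
    by apply: (key i' i); [rewrite eq_sym|rewrite (ltW xi') (ltW le)].
  - move=> /esym/negbT; rewrite -leNgt => xi'; have [le|le] := leP (v i') (v i).
      by apply: (key i i') => //; rewrite (ltW ix) le orbT.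
    by apply: (key i' i); [rewrite eq_sym|rewrite (ltW le) xi' orbT].
have [i0 [i1 [i2 [n01 n02 n12]]]] : exists i0 i1 i2 : 'I_3, [/\ i0 != i1, i0 != i2 & i1 != i2].
  by exists (inord 0), (inord 1), (inord 2); split; apply/eqP => /(congr1 val) /=;
    rewrite !inordK.
case E0 : (h x < v i0); case E1 : (h x < v i1); case E2 : (h x < v i2);
  do ?[by apply: (key2 _ _ n01); rewrite E0 E1|by apply: (key2 _ _ n02); rewrite E0 E2
      |by apply: (key2 _ _ n12); rewrite E1 E2].
Qed.

End Branch.

(** * Spaces covered by paths from one point *)

Lemma within_eq_continuous (T U : topologicalType) (A : set T) (f g : T -> U) :
  {in A, f =1 g} -> continuous f -> {within A, continuous g}.
Proof.
move=> fg fc; have /continuous_subspaceT : continuous f by [].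
by move=> /(_ A); exact: subspace_eq_continuous.
Qed.

Section Star.
Variables (R : realType) (X : topologicalType) (b : X).
Hypothesis star : forall x, exists g : R -> X, [/\ continuous g, g 0 = b & g 1 = x].

Lemma star_pathwise_connected : pathwise_connected R X.
Proof.
have h1 : 2^-1 <= 1 :> R by lra.
have h0 : 0 <= 2^-1 :> R by lra.
move=> x y; have [g [gc g0 g1]] := star x; have [h [hc hb hy]] := star y.
exists (fun u => if u <= 2^-1 then g (1 - 2 * u) else h (2 * u - 1)); split; last 2 first.
- by rewrite invr_ge0 ler0n mulr0 subr0.
- have -> : (1 <= 2^-1 :> R) = false by apply/negbTE; rewrite -ltNge; lra.
  by have -> : 2 * 1 - 1 = 1 :> R by lra.
have -> : `[0 : R, 1]%classic = `[0, 2^-1] `|` `[2^-1, 1].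
  apply/seteqP; split=> u /=; rewrite !in_itv /=.
    by move=> /andP[-> ->]; case: (leP u 2^-1) => uh; [left|right; rewrite ltW].
  by move=> [] /andP[u0 u1]; [rewrite u0 (le_trans u1)|rewrite u1 andbT (le_trans _ u0)].
apply: withinU_continuous; [exact: itv_closed|exact: itv_closed| |].
- refine (@within_eq_continuous R X _ (fun u : R => g (1 - 2 * u)) _ _ _).
    by move=> u; rewrite inE /= in_itv /= => /andP[_ ->].
  move=> u; apply: continuous_comp; last exact: gc.
  by apply: cvgB; [exact: cvg_cst|apply: cvgM; [exact: cvg_cst|exact: cvg_id]].
- apply: (@within_eq_continuous R X _ (fun u : R => h (2 * u - 1))).
    move=> u; rewrite inE /= in_itv /= => /andP[u0 _].
    case: ifP => // u1; have -> : u = 2^-1 by apply/le_anti; rewrite u1 u0.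
    by rewrite mulfV ?pnatr_eq0 // subrr hb g0.
  move=> u; apply: continuous_comp; last exact: hc.
  by apply: cvgB; [apply: cvgM; [exact: cvg_cst|exact: cvg_id]|exact: cvg_cst].
Qed.

Lemma star_connected : connected [set: X].
Proof.
pose g x := sval (cid (star x)).
have gP x : [/\ continuous (g x), g x 0 = b & g x 1 = x] by exact: (svalP (cid (star x))).
have -> : [set: X] = \bigcup_(x in [set: X]) (g x @` `[0, 1]).
  apply/seteqP; split=> // x _; exists x => //; exists 1; last by case: (gP x).
  by rewrite /= in_itv /= lexx ler01.
apply: bigcup_connected.
  exists b => x _; exists 0; last by case: (gP x).
  by rewrite /= in_itv /= lexx ler01.
by move=> x _; apply: connected_image; [exact: segment_connected|case: (gP x)].
Qed.
End Star.

(** * Chains of beads *)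

Section Bead.
Variable R : realType.

Definition knot (n : nat) : R := 1 - n.+1%:R^-1.

Lemma knot_lt n : knot n < knot n.+1.
Proof. by rewrite ltrD2l ltrN2 ltf_pV2 ?posrE ?ltr0n // ltr_nat. Qed.

Lemma knot_mono m n : (m < n)%N -> knot m < knot n.
Proof.
move=> mn; rewrite ltrD2l ltrN2 ltf_pV2 ?posrE ?ltr0n // ltr_nat; lia.
Qed.

Lemma knot0 : knot 0 = 0.
Proof. by rewrite /knot invr1 subrr. Qed.

Lemma knot_ge0 n : 0 <= knot n.
Proof. by rewrite subr_ge0 invf_le1 ?ltr0n // ler1n. Qed.

Lemma knot_lt1 n : knot n < 1.
Proof. by rewrite ltrBlDr ltrDl invr_gt0 ltr0n. Qed.

Lemma knot_inj : injective knot.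
Proof.
move=> m n E; have [/knot_mono|/knot_mono|//] := ltngtP m n; by rewrite E ltxx.
Qed.

Lemma knot_cofinal x : x < 1 -> exists n, x < knot n.
Proof.
move=> x1; exists (Num.truncn (1 - x)^-1).
have y0 : 0 < (1 - x)^-1 by rewrite invr_gt0 subr_gt0.
have := truncnS_gt (1 - x)^-1; set n := Num.truncn _ => nlt.
rewrite /knot ltrBrDr addrC -ltrBrDr -[1 - x]invrK ltf_pV2 ?posrE ?ltr0n //.
Qed.

Lemma knot_locate x : 0 <= x < 1 -> exists n, knot n <= x < knot n.+1.
Proof.
move=> /andP[x0 x1]; have [n] := knot_cofinal x1.
elim: n => [|n IH] xn; first by move: xn; rewrite knot0 ltNge x0.
by have [le|/IH//] := leP (knot n) x; exists n; rewrite le xn.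
Qed.

(** A function supported by the interval between two neighbouring knots; its
    multiples separate the arcs joining them. *)
Definition bump n (x : R) := Num.max 0 ((x - knot n) * (knot n.+1 - x)).

Lemma bump_cont n : continuous (bump n).
Proof.
apply: max_fun_continuous; first exact: cst_continuous.
move=> x; apply: cvgM; [apply: cvgB|apply: cvgB]; do ?[exact: cvg_cst|exact: cvg_id].
Qed.

Lemma bump_gt0 n x : knot n < x < knot n.+1 -> 0 < bump n x.
Proof. by move=> /andP[nx xn]; rewrite lt_max mulr_gt0 ?subr_gt0 ?orbT. Qed.

Lemma bump_eq0 n x : ~~ (knot n < x < knot n.+1) -> bump n x = 0.
Proof.
rewrite negb_and -!leNgt => nx; apply/max_idPl; have := knot_lt n.
by move: nx => /orP[] H1 H2; [apply: mulr_le0_ge0|apply: mulr_ge0_le0]; lra.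
Qed.

Lemma bump_knot n m : bump n (knot m) = 0.
Proof.
apply: bump_eq0; apply/negP => /andP[H1 H2].
have [le|le] := leqP m n.
  have : knot m <= knot n by move: le; rewrite leq_eqVlt => /orP[/eqP->//|/knot_mono/ltW].
  by rewrite leNgt H1.
have : knot n.+1 <= knot m by move: le; rewrite leq_eqVlt => /orP[/eqP->//|/knot_mono/ltW].
by rewrite leNgt H2.
Qed.

Lemma bump_other n m x : knot n < x < knot n.+1 -> m <> n -> bump m x = 0.
Proof.
move=> /andP[H1 H2] mn; apply: bump_eq0; apply/negP => /andP[H3 H4].
have [mn'|nm|//] := ltngtP m n.
- have : knot m.+1 <= knot n by move: mn'; rewrite leq_eqVlt => /orP[/eqP->//|/knot_mono/ltW].
  by rewrite leNgt (lt_trans H1).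
- have : knot n.+1 <= knot m by move: nm; rewrite leq_eqVlt => /orP[/eqP->//|/knot_mono/ltW].
  by rewrite leNgt (lt_trans H3).
Qed.

Section Chain.
Variable k : nat -> nat.
Hypothesis k_bounds : forall n, (3 <= k n <= 5)%N.

(** The j-th of five paths from the first knot to the end of the chain. Between
    the knots n and n.+1 the paths j with k n <= j.+1 coincide, so that k n arcs
    remain. *)
Definition sheet (j : 'I_5) (x : R) : cube (option nat) R := fun o =>
  if o is Some n then (minn j.+1 (k n))%:R * bump n (clamp 0 1 x) else clamp 0 1 x.

Definition beads : topologicalType :=
  set_type [set v : cube (option nat) R | exists j x, v = sheet j x].

Definition strand (j : 'I_5) (x : R) : beads :=
  SigSub (mem_set (ex_intro _ j (ex_intro _ x erefl)) :
    sheet j x \in [set v : cube (option nat) R | exists j x, v = sheet j x]).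

Definition coord (o : option nat) (v : beads) : R := set_val v o.

Lemma coord_cont o : continuous (coord o).
Proof.
move=> v; apply: (@continuous_comp _ _ _ _ (fun w : cube (option nat) R => w o)).
  exact: val_cont.
exact: cube_projC.
Qed.

Lemma strand_cont j : continuous (strand j).
Proof.
move=> x; apply: sub_contP; apply: cube_contP => -[n|] /=.
  apply: cvgM; first exact: cvg_cst.
  by apply: continuous_comp; [exact: clamp_cont|exact: bump_cont].
exact: clamp_cont.
Qed.

Lemma coord_strandN j x : 0 <= x <= 1 -> coord None (strand j x) = x.
Proof. exact: clamp_id. Qed.

Lemma coord_strandS n j x : 0 <= x <= 1 ->
  coord (Some n) (strand j x) = (minn j.+1 (k n))%:R * bump n x.
Proof.
move=> x01; have -> : coord (Some n) (strand j x) =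
  (minn j.+1 (k n))%:R * bump n (clamp 0 1 x) by [].
by rewrite clamp_id.
Qed.

Lemma beads_eq (v w : beads) : (forall o, coord o v = coord o w) -> v = w.
Proof. by move=> E; apply: val_inj; apply/funext => o; exact: E. Qed.

Lemma strandP v : exists j x, 0 <= x <= 1 /\ v = strand j x.
Proof.
case: v => v vP; have [j [x E]] := set_mem vP; exists j, (clamp 0 1 x).
have c01 : 0 <= clamp 0 1 x <= 1 by apply: clamp_in; rewrite ler01.
split=> //; apply: beads_eq => o; rewrite /coord.
have -> : set_val (SigSub vP) = sheet j x by [].
have -> : set_val (strand j (clamp 0 1 x)) = sheet j (clamp 0 1 x) by [].
rewrite /sheet; by case: o => [n|]; rewrite (clamp_id c01).
Qed.

Lemma coordN_itv v : 0 <= coord None v <= 1.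
Proof. by have [j [x [x01 ->]]] := strandP v; rewrite coord_strandN. Qed.

Lemma strand_eq i j x y : 0 <= x <= 1 -> 0 <= y <= 1 -> strand i x = strand j y ->
  x = y /\ forall n, knot n < x < knot n.+1 -> minn i.+1 (k n) = minn j.+1 (k n).
Proof.
move=> x01 y01 E; have xy : x = y.
  by rewrite -(coord_strandN i x01) E coord_strandN.
split=> // n nx; have := congr1 (coord (Some n)) E.
rewrite !coord_strandS // -xy => /mulIf => /(_ _)/eqP.
by rewrite eqr_nat => H; apply/eqP/H; rewrite gt_eqF // bump_gt0.
Qed.

Lemma beads_eq_at n v w : coord None v = coord None w -> knot n < coord None v < knot n.+1 ->
  coord (Some n) v = coord (Some n) w -> v = w.
Proof.
have [i [x [x01 ->]]] := strandP v; have [j [y [y01 ->]]] := strandP w.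
rewrite !coord_strandN // => <- nx E; apply: beads_eq => -[m|].
  have [->//|/eqP mn] := eqVneq m n.
  by rewrite !coord_strandS // (bump_other nx mn) !mulr0.
by rewrite !coord_strandN.
Qed.

Lemma strand_knot i j x : 0 <= x <= 1 -> (forall n, bump n x = 0) -> strand i x = strand j x.
Proof.
move=> x01 b0; apply: beads_eq => -[n|]; last by rewrite !coord_strandN.
by rewrite !coord_strandS // b0 !mulr0.
Qed.

Definition knotp n : beads := strand ord0 (knot n).

Lemma knot01 n : 0 <= knot n <= 1.
Proof. by rewrite knot_ge0 ltW // knot_lt1. Qed.

Lemma strand_knotp j n : strand j (knot n) = knotp n.
Proof. by apply: strand_knot => [|m]; [exact: knot01|exact: bump_knot]. Qed.

Lemma knotpP v n : coord None v = knot n -> v = knotp n.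
Proof.
have [j [x [x01 ->]]] := strandP v; rewrite coord_strandN // => ->.
exact: strand_knotp.
Qed.

Lemma knotp_coord n : coord None (knotp n) = knot n.
Proof. by rewrite coord_strandN // knot01. Qed.

Lemma bump1 n : bump n 1 = 0.
Proof. by apply: bump_eq0; rewrite negb_and -!leNgt (ltW (knot_lt1 _)) orbT. Qed.

Lemma beads_star x : exists g : R -> beads, [/\ continuous g, g 0 = knotp 0 & g 1 = x].
Proof.
have [j [t [t01 ->]]] := strandP x; exists (fun s => strand j (t * s)); split.
- move=> s; apply: continuous_comp; last exact: strand_cont.
  by apply: cvgM; [exact: cvg_cst|exact: cvg_id].
- by rewrite mulr0 -knot0 strand_knotp.
- by rewrite mulr1.
Qed.

Lemma beads_hausdorff : hausdorff_space beads.
Proof. exact/sub_hausdorff/cube_hausdorff. Qed.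

Lemma beads_compact : compact [set: beads].
Proof.
have -> : [set: beads] = \big[setU/set0]_(i <- enum 'I_5) (strand i @` `[0, 1]).
  rewrite -bigcup_seq; apply/seteqP; split=> // x _.
  have [j [t [t01 ->]]] := strandP x; exists j; first by rewrite /= mem_enum.
  by exists t.
apply: bigsetU_compact => i _; apply: compact_image; last exact: strand_cont.
exact: segment_compact.
Qed.

Lemma beads_continuum : continuum beads.
Proof.
split; [exact: beads_compact|exact: star_connected beads_star|exact: beads_hausdorff|].
exists (knotp 0), (knotp 1) => /(congr1 (coord None)).
by rewrite !knotp_coord => /knot_inj.
Qed.

Lemma beads_pathwise : pathwise_connected R beads.
Proof. exact: star_pathwise_connected beads_star. Qed.

Lemma beads_locally_connected : locally_connected beads.
Proof.
apply: (@locally_connected_quotient 'I_5 R beads `[0, 1]%classic strand).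
- exact: connectedR_lc.
- exact: segment_compact.
- exact: beads_hausdorff.
- exact: strand_cont.
- move=> x; have [j [t [t01 ->]]] := strandP x; by exists j, t.
Qed.

(** The stretches between neighbouring knots are disjoint open sets. *)
Lemma beads_has_weight (K : Type) : emb nat K -> emb K nat -> has_weight beads K.
Proof.
move=> nK [c cI].
apply: (@has_weight_disjoint R beads (option nat) K coord _ _ _ nK _
  (fun i => coord None @^-1` [set x | knot (c i) < x < knot (c i).+1])).
- exact: beads_compact.
- exact: coord_cont.
- move=> x y xy; apply: contrapT => H; apply: xy; apply: beads_eq => o.
  by apply: contrapT => oE; apply: H; exists o.
- by apply: emb_option => //; exact: emb_refl.
- move=> i; apply: open_comp => [? _|]; first exact: coord_cont.
  have -> : [set x | knot (c i) < x < knot (c i).+1] = `]knot (c i), knot (c i).+1[%classic.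
    by apply/seteqP; split=> x /=; rewrite in_itv.
  exact: itv_open.
- move=> i; exists (strand ord0 ((knot (c i) + knot (c i).+1) / 2)) => /=.
  have := knot_lt (c i); have /andP[] := knot01 (c i); have /andP[] := knot01 (c i).+1.
  by move=> *; rewrite coord_strandN; lra.
- move=> i l x /= /andP[H1 H2] /andP[H3 H4]; apply: cI.
  have [lt|lt|//] := ltngtP (c i) (c l).
  + have : knot (c i).+1 <= knot (c l).
      by move: lt; rewrite leq_eqVlt => /orP[/eqP->//|/knot_mono/ltW].
    by rewrite leNgt (lt_trans H3).
  + have : knot (c l).+1 <= knot (c i).
      by move: lt; rewrite leq_eqVlt => /orP[/eqP->//|/knot_mono/ltW].
    by rewrite leNgt (lt_trans H1).
Qed.

(** At least three arcs leave each knot towards the next one. *)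
Lemma knotp_branch n : branch_point R (knotp n).
Proof.
pose x (s : R) := knot n + s * ((knot n.+1 - knot n) / 2).
have lt := knot_lt n; have n0 := knot_ge0 n; have n1 := knot_lt1 n.+1.
have xe s : 0 <= s <= 1 -> 0 <= x s <= 1 /\ (0 < s -> knot n < x s < knot n.+1).
  move=> /andP[s0 s1]; have d0 : 0 < (knot n.+1 - knot n) / 2 by lra.
  have : 0 <= s * ((knot n.+1 - knot n) / 2) by apply: mulr_ge0 => //; exact: ltW.
  have : s * ((knot n.+1 - knot n) / 2) <= (knot n.+1 - knot n) / 2.
    by rewrite ler_piMl // ltW.
  rewrite /x; split; first by lra.
  move=> s0'; have : 0 < s * ((knot n.+1 - knot n) / 2) by apply: mulr_gt0.
  by lra.
exists (fun i : 'I_3 => fun s => strand (widen_ord (isT : (3 <= 5)%N) i) (x s)); split.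
- move=> i s; apply: continuous_comp; last exact: strand_cont.
  apply: cvgD; first exact: cvg_cst.
  by apply: cvgM; [exact: cvg_id|exact: cvg_cst].
- by move=> i; rewrite /x mul0r addr0 strand_knotp.
move=> i i' s s' s01 s'01; have [x01 xs] := xe _ s01; have [x01' _] := xe _ s'01.
move=> /strand_eq[//|//|xE mE]; split.
  by move/addrI/mulIf : xE; apply; lra.
move=> /xs /mE; have := k_bounds n; case: i i' {xs mE xE} => [i i3] [i' i3'] /= kn mE.
by apply: val_inj => /=; lia.
Qed.

(** Near a point inside an arc the chain is a line. At the end point 1, any arc
    issued from it runs back through a whole tail of the knots, so that two of
    them have a common point. *)
Lemma branch_knotp v : branch_point R v -> exists n, v = knotp n.
Proof.
have [j [x [x01 ->]]] := strandP v; have [x1|x1] := ltP x 1; last first.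
  have -> : x = 1 by move: x01; lra.
  move=> [g [gc g0 gI]].
  have g1 i : coord None (g i 1) < 1.
    have /andP[_ le1] := coordN_itv (g i 1); rewrite lt_neqAle le1 andbT; apply/eqP => E.
    have E1 : g i 1 = g i 0.
      rewrite g0; have [i' [y [y01 E']]] := strandP (g i 1).
      move: E; rewrite E' coord_strandN // => ->; apply: strand_knot; last exact: bump1.
      by rewrite ler01 lexx.
    have [||/eqP] := gI _ _ _ _ _ _ E1; rewrite ?lexx ?ler01 //.
    by rewrite oner_eq0.
  have [n] : exists n, Num.max (coord None (g 0 1)) (coord None (g 1 1)) < knot n.
    by apply: knot_cofinal; rewrite gt_max !g1.
  rewrite gt_max => /andP[n0 n1].
  have hit i : coord None (g i 1) < knot n -> exists2 s, 0 <= s <= 1 & g i s = knotp n.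
    move=> gin; have [||s s01 sE] := @ivt R (fun s => coord None (g i s)) 0 1 (knot n) ler01.
    - by move=> s _; apply: continuous_comp; [exact: gc|exact: coord_cont].
    - by rewrite /= g0 coord_strandN ?lexx ?ler01 // (ltW gin) (ltW (knot_lt1 n)) orbT.
    by exists s => //; exact: knotpP.
  have [s s01 sE] := hit _ n0; have [s' s'01 sE'] := hit _ n1.
  have /gI[//|//|_ H] : g 0 s = g 1 s' by rewrite sE sE'.
  have s0 : 0 < s.
    rewrite lt_neqAle; case/andP: s01 => -> _; rewrite andbT; apply/eqP => s0.
    move: sE; rewrite -s0 g0 => /(congr1 (coord None)).
    by rewrite knotp_coord coord_strandN ?lexx ?ler01 // => E; have := knot_lt1 n; rewrite -E ltxx.
  by have := H s0.
have [n /andP[nx xn]] : exists n, knot n <= x < knot n.+1.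
  by apply: knot_locate; move: x01 x1 => /andP[-> _] ->.
have [<-|nxE] := eqVneq (knot n) x; first by exists n; rewrite strand_knotp.
have {nxE}nx : knot n < x by rewrite lt_neqAle nxE.
(* U is the arc through the given point: the coordinate n, divided by the bump,
   is an integer, and it is less than 1/2 away from c. *)
set c := (minn j.+1 (k n))%:R : R.
pose F (v : beads) := bump n (coord None v).
have Fc : continuous F.
  by move=> v'; apply: (@cont_comp _ _ _ (coord None) (bump n)); [exact: coord_cont|exact: bump_cont].
pose U := (coord None @^-1` `]knot n, knot n.+1[%classic) `&`
  ((fun v => coord (Some n) v - (c - 2^-1) * F v) @^-1` [set r | 0 < r]) `&`
  ((fun v => (c + 2^-1) * F v - coord (Some n) v) @^-1` [set r | 0 < r]).
have G1c : continuous (fun v => coord (Some n) v - (c - 2^-1) * F v).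
  move=> v'; apply: (@contB R beads (coord (Some n)) (fun v => (c - 2^-1) * F v)).
    exact: coord_cont.
  by apply: (@contZ R beads F); exact: Fc.
have G2c : continuous (fun v => (c + 2^-1) * F v - coord (Some n) v).
  move=> v'; apply: (@contB R beads (fun v => (c + 2^-1) * F v) (coord (Some n))).
    by apply: (@contZ R beads F); exact: Fc.
  exact: coord_cont.
have oU : open U.
  apply: openI; first apply: openI; apply: open_comp.
  - by move=> ? _; exact: coord_cont.
  - exact: itv_open.
  - move=> v' _; exact: G1c.
  - exact: open_gt.
  - move=> v' _; exact: G2c.
  - exact: open_gt.
have Ux : U (strand j x).
  have b0 := bump_gt0 (introT andP (conj nx xn)).
  rewrite /U /F /=; split; first split; rewrite ?coord_strandN ?coord_strandS //= ?in_itv /= ?nx //.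
    by rewrite -mulrBl mulr_gt0 // -/c; lra.
  by rewrite -mulrBl mulr_gt0 // -/c; lra.
move=> bp; exfalso; move: bp.
apply: (@not_branch_point R beads _ U U (coord None)).
- exact: open_nbhs_nbhs.
- by move=> y _; exact: coord_cont.
- by move=> g e gc _ _.
- move=> y z [[/= yn y1] y2] [[/= zn z1] z2] yz.
  move: yn; rewrite in_itv /= => yn.
  apply: (beads_eq_at yz yn); move: y1 y2 z1 z2; rewrite /F -yz.
  have [i [y' [y'01 Ey]]] := strandP y; have [i' [z' [z'01 Ez]]] := strandP z.
  have b0 := bump_gt0 yn.
  have uniq m : 0 < m%:R * bump n (coord None y) - (c - 2^-1) * bump n (coord None y) ->
      0 < (c + 2^-1) * bump n (coord None y) - m%:R * bump n (coord None y) -> m%:R = c.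
    rewrite -!mulrBl !pmulr_lgt0 // => H1 H2.
    have : m%:R < (minn j.+1 (k n))%:R + 1 :> R by rewrite -/c; lra.
    have : (minn j.+1 (k n))%:R < m%:R + 1 :> R by rewrite -/c; lra.
    rewrite !natr1 !ltr_nat !ltnS => L1 L2; rewrite /c; congr (_%:R).
    by apply/anti_leq; rewrite L1 L2.
  have yE : coord None y = y' by rewrite Ey coord_strandN.
  have zE : coord None y = z' by rewrite yz Ez coord_strandN.
  rewrite Ey Ez !coord_strandS // -Ey -yE -zE => y1 y2 z1 z2.
  by rewrite (uniq _ y1 y2) (uniq _ z1 z2).
Qed.

End Chain.
End Bead.

(** * Embeddings of chains of beads *)

Section BeadEmbedding.
Variables (R : realType) (k l : nat -> nat).
Hypotheses (k3 : forall n, (3 <= k n <= 5)%N) (l3 : forall n, (3 <= l n <= 5)%N).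
Variable f : beads R k -> beads R l.
Hypotheses (fc : continuous f) (fI : injective f).

Lemma knot_image n : exists m, f (knotp R k n) = knotp R l m.
Proof. exact: (branch_knotp (branch_point_inj fc fI (knotp_branch R k3 n))). Qed.

Let g n := sval (cid (knot_image n)).
Let gP n : f (knotp R k n) = knotp R l (g n).
Proof. exact: (svalP (cid (knot_image n))). Qed.

Lemma knot_image_inj : injective g.
Proof.
move=> m n E; have : f (knotp R k m) = f (knotp R k n) by rewrite !gP E.
by move=> /fI/(congr1 (coord None)); rewrite !knotp_coord => /knot_inj.
Qed.

(** Intermediate values: the image of the strand starts and ends over the two
    image knots. *)
Lemma strand_crosses n (j : 'I_5) y :
  knot R (g n) < y < knot R (g n.+1) \/ knot R (g n.+1) < y < knot R (g n) ->
  exists x, knot R n < x < knot R n.+1 /\ coord None (f (strand k j x)) = y.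
Proof.
move=> yb; have lt := knot_lt R n.
have [||x x01 E] := @ivt R (fun x => coord None (f (strand k j x)))
    (knot R n) (knot R n.+1) y (ltW lt).
- move=> x _; apply: (@cont_comp _ _ _ (fun x => f (strand k j x)) (coord None)).
    by apply: (@cont_comp _ _ _ (strand k j) f); [exact: strand_cont|exact: fc].
  exact: coord_cont.
- rewrite /= !strand_knotp !gP !knotp_coord.
  by case: yb => /andP[H1 H2]; rewrite (ltW H1) (ltW H2) ?orbT.
exists x; split=> //; case/andP: x01 => nx xn; apply/andP; split.
- rewrite lt_neqAle nx andbT; apply/eqP => xE; move: E; rewrite -xE strand_knotp gP knotp_coord.
  by move=> Ey; move: yb; rewrite Ey ltxx andbF /= => -[].
- rewrite lt_neqAle xn andbT; apply/eqP => xE; move: E; rewrite xE strand_knotp gP knotp_coord.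
  by move=> Ey; move: yb; rewrite Ey ltxx andbF /= => -[].
Qed.

Lemma strands_disjoint n (i j : 'I_5) x y : (i < k n)%N -> (j < k n)%N ->
  knot R n < x < knot R n.+1 -> knot R n < y < knot R n.+1 ->
  f (strand k i x) = f (strand k j y) -> i = j.
Proof.
move=> ik jk nx ny /fI E.
have in01 z : knot R n < z < knot R n.+1 -> 0 <= z <= 1.
  have := knot_ge0 R n; have := knot_lt1 R n.+1; move=> H1 H2 /andP[H3 H4].
  by apply/andP; split; lra.
have [_ /(_ _ nx)] := strand_eq (in01 _ nx) (in01 _ ny) E.
by move=> mE; apply: val_inj => /=; lia.
Qed.

(** Two different strands cannot both pass through a knot which is not the
    image of one of their endpoints. *)
Lemma knot_image_adjacent n : g n.+1 = (g n).+1 \/ g n = (g n.+1).+1.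
Proof.
have nN : g n <> g n.+1 by move=> /knot_image_inj; lia.
have /andP[kn _] := k3 n.
have no m : ((g n < m < g n.+1) || (g n.+1 < m < g n))%N -> False.
  move=> mb; have yb : knot R (g n) < knot R m < knot R (g n.+1) \/
      knot R (g n.+1) < knot R m < knot R (g n).
    by case/orP: mb => /andP[H1 H2]; [left|right]; rewrite !knot_mono.
  have [x [nx Ex]] := strand_crosses ord0 yb.
  have [x' [nx' Ex']] := strand_crosses (Ordinal (isT : (1 < 5)%N)) yb.
  have : f (strand k ord0 x) = f (strand k (Ordinal (isT : (1 < 5)%N)) x').
    by rewrite (knotpP Ex) (knotpP Ex').
  move=> E; have : ord0 = Ordinal (isT : (1 < 5)%N).
    by apply: (strands_disjoint _ _ nx nx' E) => //=; lia.
  by move/(congr1 val).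
have [lt|lt|//] := ltngtP (g n) (g n.+1).
- left; apply/eqP; rewrite eqn_leq lt andbT leqNgt; apply/negP => H.
  by apply: (no (g n).+1); rewrite ltnSn H.
- right; apply/eqP; rewrite eqn_leq lt andbT leqNgt; apply/negP => H.
  by apply: (no (g n.+1).+1); rewrite ltnSn H orbT.
Qed.

(** The k n arcs issued from a knot are mapped to disjoint paths joining two
    neighbouring knots, and cross the middle level between them at different
    points, of which there are only l m. *)
Lemma strand_count n : (k n <= l (minn (g n) (g n.+1)))%N.
Proof.
set m := minn _ _; have lt := knot_lt R m.
pose y := (knot R m + knot R m.+1) / 2.
have my : knot R m < y < knot R m.+1 by rewrite /y; apply/andP; split; lra.
have yb : knot R (g n) < y < knot R (g n.+1) \/ knot R (g n.+1) < y < knot R (g n).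
  case: (knot_image_adjacent n) => E; move: my; rewrite /m E.
    by have -> : minn (g n) (g n).+1 = g n by [lia]; left.
  by have -> : minn (g n.+1).+1 (g n.+1) = g n.+1 by [lia]; right.
have wd (j : 'I_(k n)) : (j < 5)%N.
  by apply: leq_trans (ltn_ord j) _; case/andP: (k3 n).
have ch (j : 'I_(k n)) := cid (strand_crosses (Ordinal (wd j)) yb).
have im (j : 'I_(k n)) : {i : 'I_5 |
    f (strand k (Ordinal (wd j)) (sval (ch j))) = strand l i y}.
  apply: cid; have [_ E] := svalP (ch j).
  have [i [z [z01 Ez]]] := strandP (f (strand k (Ordinal (wd j)) (sval (ch j)))).
  by exists i; rewrite Ez; congr strand; move: E; rewrite Ez coord_strandN.
have lm0 : (0 < l m)%N by have := l3 m; lia.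
have bd (i : 'I_5) : ((minn i.+1 (l m)).-1 < l m)%N by lia.
pose h (j : 'I_(k n)) : 'I_(l m) := Ordinal (bd (sval (im j))).
suff hI : injective h by have := leq_card h hI; rewrite !card_ord.
move=> i j /(congr1 val) /= hE.
have y01 : 0 <= y <= 1.
  have := knot_ge0 R m; have := knot_lt1 R m.+1; move: my => /andP[H1 H2] H3 H4.
  by apply/andP; split; lra.
have E : strand l (sval (im i)) y = strand l (sval (im j)) y.
  apply: (@beads_eq_at R l m); rewrite ?coord_strandN // !coord_strandS //.
  have pos a : (0 < minn a.+1 (l m))%N by rewrite leq_min lm0.
  by congr (_%:R * _); rewrite -(prednK (pos _)) hE prednK ?pos.
have [nx _] := svalP (ch i); have [ny _] := svalP (ch j).
have /(congr1 val) /= ij : Ordinal (wd i) = Ordinal (wd j).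
  apply: (strands_disjoint _ _ nx ny); [exact: (ltn_ord i)|exact: (ltn_ord j)|].
  exact: etrans (svalP (im i)) (etrans E (esym (svalP (im j)))).
exact: val_inj.
Qed.

(** Moving by one step at a time without repetition, g keeps its direction, and
    it cannot decrease for ever. *)
Lemma knot_image_shift n : g n = (g 0 + n)%N.
Proof.
have up m : g m.+1 = (g m).+1.
  have [//|dn] := knot_image_adjacent m; exfalso.
  have all_dn i : g (m + i)%N = (g (m + i).+1).+1.
    elim: i => [|i IH]; first by rewrite addn0.
    rewrite addnS; have [E|//] := knot_image_adjacent (m + i).+1.
    have : (m + i).+2 = (m + i)%N by apply: knot_image_inj; rewrite E IH.
    by lia.
  have dec i : (g (m + i) + i = g m)%N.
    elim: i => [|i IH]; first by rewrite !addn0.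
    by have := all_dn i; move: IH; rewrite (addnS m i); lia.
  by have := dec (g m).+1; lia.
elim: n => [|n IH]; first by rewrite addn0.
by rewrite up IH addnS.
Qed.

(** The only fivefold stretch of the target is the first one, which prevents the
    indices of the knots from being shifted. *)
Lemma multiplicities_le : (forall m, l m = 5%N -> m = 0%N) -> k 0 = 5%N ->
  forall n, (k n <= l n)%N.
Proof.
move=> l5 k0 n.
have mE n' : minn (g n') (g n'.+1) = (g 0 + n')%N.
  by rewrite knot_image_shift (knot_image_shift n'.+1); lia.
have g0 : g 0 = 0%N.
  apply: l5; have := strand_count 0; rewrite mE addn0 k0.
  by have := l3 (g 0); lia.
by have := strand_count n; rewrite mE g0.
Qed.

End BeadEmbedding.

Section BeadCode.
Variable R : realType.

(** Each bit is written twice, once complemented, so that comparable codes are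
    equal; the multiplicity 5 marks the beginning. *)
Definition bead_code (s : nat -> bool) (n : nat) : nat :=
  if n is m.+1 then if odd m then (3 + ~~ s m./2)%N else (3 + s m./2)%N else 5%N.

Lemma bead_code_bounds s n : (3 <= bead_code s n <= 5)%N.
Proof. by case: n => [|n] //=; case: odd; case: (s _). Qed.

Lemma bead_code_inj s t (f : beads R (bead_code s) -> beads R (bead_code t)) :
  continuous f -> injective f -> s = t.
Proof.
move=> fc fI.
have le n := multiplicities_le (bead_code_bounds s) (bead_code_bounds t) fc fI.
have {}le n : (bead_code s n <= bead_code t n)%N.
  by apply: le => // -[|m] //=; case: odd; case: (t _).
apply/funext => n; have := le n.*2.+1; have := le n.*2.+2.
rewrite /= odd_double /= uphalf_double doubleK.
by case: (s n); case: (t n).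
Qed.
End BeadCode.

(** * Linear continua *)

(** Linear continua: compact connected ordered spaces, with the order given as
    a bare relation whose rays are closed, so that the dual order is at hand. *)
Record lincont (T : topologicalType) (le : T -> T -> Prop) : Prop := Lincont {
  lc_refl : forall x, le x x;
  lc_trans : forall y x z, le x y -> le y z -> le x z;
  lc_anti : forall x y, le x y -> le y x -> x = y;
  lc_total : forall x y, le x y \/ le y x;
  lc_closed : forall x, closed [set y | le x y];
  lc_closed' : forall x, closed [set y | le y x];
  lc_compact : compact [set: T];
  lc_dense : forall x y, le x y -> x <> y ->
    exists z, [/\ le x z, le z y, z <> x & z <> y] }.

Definition flip_rel (T : Type) (le : T -> T -> Prop) x y := le y x.

Definition slt (T : Type) (le : T -> T -> Prop) x y := le x y /\ x <> y.

Definition convex_in (T : Type) (le : T -> T -> Prop) (C : set T) :=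
  forall a b w, C a -> C b -> le a w -> le w b -> C w.

Lemma lincont_flip (T : topologicalType) (le : T -> T -> Prop) :
  lincont le -> lincont (flip_rel le).
Proof.
move=> H; split.
- exact: lc_refl H.
- by move=> y x z xy yz; exact: (lc_trans H yz xy).
- by move=> x y xy yx; exact: (lc_anti H yx xy).
- by move=> x y; exact: (lc_total H y x).
- exact: (lc_closed' H).
- exact: (lc_closed H).
- exact: (lc_compact H).
- move=> x y yx xy; have [|z [? ? ? ?]] := lc_dense H yx; first by move=> E; apply: xy.
  by exists z.
Qed.

Lemma convex_flip (T : Type) (le : T -> T -> Prop) (C : set T) :
  convex_in le C -> convex_in (flip_rel le) C.
Proof. by move=> H a b w Ca Cb aw wb; exact: (H b a). Qed.

Section Lincont.
Variables (T : topologicalType) (le : T -> T -> Prop).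
Hypothesis H : lincont le.
Local Notation lt := (slt le).

Lemma not_le_lt x y : ~ le x y -> lt y x.
Proof.
move=> nxy; have [//|yx] := lc_total H x y; split=> // E.
by apply: nxy; rewrite E; exact: lc_refl.
Qed.

Lemma lt_not_le x y : lt x y -> ~ le y x.
Proof. by move=> [xy nE] yx; apply: nE; exact: (lc_anti H). Qed.

Lemma lt_le_trans_lc x y z : lt x y -> le y z -> lt x z.
Proof.
move=> [xy nE] yz; split; first exact: (lc_trans H xy yz).
by move=> E; apply: nE; apply: (lc_anti H) => //; rewrite E.
Qed.

Lemma le_lt_trans_lc x y z : le x y -> lt y z -> lt x z.
Proof.
move=> xy [yz nE]; split; first exact: (lc_trans H xy yz).
by move=> E; apply: nE; apply: (lc_anti H) => //; rewrite -E.
Qed.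

Lemma lc_open x : open [set y | lt x y].
Proof.
have -> : [set y | lt x y] = ~` [set y | le y x].
  by apply/seteqP; split=> y /=; [exact: lt_not_le|exact: not_le_lt].
by apply: closed_openC; exact: lc_closed'.
Qed.

(** A cluster point of the final segments of A is its least upper bound. *)
Lemma lc_lub (A : set T) : A !=set0 ->
  exists s, (forall a, A a -> le a s) /\ (forall b, (forall a, A a -> le a b) -> le s b).
Proof.
move=> [a0 Aa0].
pose F := filter_from A (fun a => A `&` [set x | le a x]).
have PF : ProperFilter F.
  apply: filter_from_proper.
    apply: filter_from_filter; first by exists a0.
    move=> a b Aa Ab; case: (lc_total H a b) => ab; [exists b|exists a] => // x [Ax lx];
      split; split=> //=; exact: (lc_trans H ab lx).
  by move=> a Aa; exists a; split=> //; exact: lc_refl.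
have [|s [_ Fs]] := lc_compact H PF; first exact: filterT.
exists s; split.
- move=> a Aa; suff : closure [set y | le a y] s by exact: lc_closed.
  move=> B sB.
  have [|x [[Ax lx] Bx]] := Fs (A `&` [set x | le a x]) B _ sB; first by exists a.
  by exists x.
- move=> b Ab; suff : closure [set y | le y b] s by exact: lc_closed'.
  move=> B sB.
  have [|x [[Ax lx] Bx]] := Fs (A `&` [set x | le a0 x]) B _ sB; first by exists a0.
  by exists x; split=> //; exact: Ab.
Qed.

(** Open sets contain intervals although the topology is not assumed to be the
    order topology: otherwise points outside U would cluster, in the compact
    space, at a point squeezed onto x. *)
Lemma lc_right (U : set T) x b : open U -> U x -> lt x b ->
  exists c, [/\ lt x c, le c b & forall z, le x z -> le z c -> U z].
Proof.
move=> oU Ux xb; apply: contrapT => no.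
have bad c : lt x c -> le c b -> exists z, [/\ le x z, le z c & ~ U z].
  move=> xc cb; apply: contrapT => nz; apply: no; exists c; split=> // z xz zc.
  by apply: contrapT => nUz; apply: nz; exists z.
pose F := filter_from [set c | lt x c /\ le c b]
  (fun c => [set z | [/\ le x z, le z c & ~ U z]]).
have PF : ProperFilter F.
  apply: filter_from_proper.
    apply: filter_from_filter; first by exists b; split=> //; exact: lc_refl.
    move=> c d [xc cb] [xd db]; case: (lc_total H c d) => cd; [exists c|exists d] => //;
      move=> z [xz zc nUz]; split; split=> //; exact: (lc_trans H zc cd).
  by move=> c [xc cb]; have [z ?] := bad c xc cb; exists z.
have [|s [_ Fs]] := lc_compact H PF; first exact: filterT.
have sE : s = x.
  have xs : le x s.
    suff : closure [set y | le x y] s by exact: lc_closed.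
    move=> B sB.
    have [|z [[xz _ _] Bz]] := Fs [set z | [/\ le x z, le z b & ~ U z]] B _ sB; last by exists z.
    by exists b; first (split=> //; exact: lc_refl).
  apply: contrapT => nE; have [|c [xc cs cx csE]] := lc_dense H xs.
    by move=> E; apply: nE.
  have xc' : lt x c by split=> // E; apply: cx.
  have [d [xd db dc]] : exists d, [/\ lt x d, le d b & le d c].
    by case: (lc_total H c b) => cb; [exists c|exists b]; split=> //; exact: lc_refl.
  have : le s d.
    suff : closure [set y | le y d] s by exact: lc_closed'.
    move=> B sB.
    have [|z [[_ zd _] Bz]] := Fs [set z | [/\ le x z, le z d & ~ U z]] B _ sB; last by exists z.
    by exists d.
  move=> sd; apply: csE; apply: (lc_anti H) => //; exact: (lc_trans H sd dc).
have sU : nbhs s U by rewrite sE; exact: open_nbhs_nbhs.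
have [|z [[_ _ nUz] /= Uz]] := Fs [set z | [/\ le x z, le z b & ~ U z]] U _ sU.
  by exists b => //; split=> //; exact: lc_refl.
exact: nUz.
Qed.

End Lincont.

Section LincontConnected.
Variables (T : topologicalType) (le : T -> T -> Prop).
Hypothesis H : lincont le.
Local Notation lt := (slt le).
Let H' := lincont_flip H.

(** The classical supremum argument, run upwards or downwards from b0 according
    to the side on which B is not everything. *)
Lemma lc_convex_connected (C : set T) : convex_in le C -> connected C.
Proof.
move=> Cc B [b0 Bb0] [ O oO BO] [D cD BD].
have BC x : B x -> C x by rewrite BO => -[].
apply: contrapT => nBC; have [c [Cc0 nBc]] : exists c, C c /\ ~ B c.
  apply: contrapT => no; apply: nBC; apply/seteqP; split=> // x Cx.
  by apply: contrapT => nBx; apply: no; exists x.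
have key (le' : T -> T -> Prop) : lincont le' -> convex_in le' C -> le' b0 c -> False.
  move=> L Cv bc.
  pose A := [set x | [/\ B x, le' b0 x & le' x c]].
  have [|s [ub lub]] := lc_lub L (A := A).
    by exists b0; split=> //; exact: lc_refl.
  have b0s : le' b0 s by apply: ub; split=> //; exact: lc_refl.
  have sc : le' s c by apply: lub => a [].
  have Cs : C s by apply: Cv b0s sc => //; exact: BC.
  have Bs : B s.
    rewrite BD; split=> //; apply: contrapT => nDs.
    have b0s' : slt le' b0 s.
      by split=> // E; apply: nDs; rewrite -E; move: Bb0; rewrite BD => -[].
    have /lincont_flip L' := L.
    have oD : open (~` D) by exact: closed_openC.
    have [|d [ds b0d dU]] := @lc_right _ _ L' (~` D) s b0 oD nDs.
      by case: b0s' => ? nE; split=> // E; apply: nE.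
    have : le' s d.
      apply: lub => a [Ba b0a ac]; apply: contrapT => nad.
      have [da _] := not_le_lt L nad.
      have := dU a (ub a (And3 Ba b0a ac)) da; apply.
      by move: Ba; rewrite BD => -[].
    by case: ds => ds nE sd; apply: nE; apply: (lc_anti L).
  have sc' : slt le' s c by split=> // E; apply: nBc; rewrite -E.
  have Os : O s by move: Bs; rewrite BO => -[].
  have [d [sd dc dU]] := lc_right L oO Os sc'.
  have : le' d s.
    apply: ub; split=> //; last by case: sd => sd _; exact: (lc_trans L b0s sd).
    rewrite BO; split; last by apply: dU; [case: sd|exact: lc_refl].
    by case: sd => sd _; exact: (Cv s c).
  exact: (lt_not_le L sd).
case: (lc_total H b0 c) => bc; first exact: (key le).
by apply: (key (flip_rel le)) => //; exact: convex_flip.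
Qed.

Lemma lc_connected_convex (C : set T) : connected C -> convex_in le C.
Proof.
move=> cC a b w Ca Cb aw wb; apply: contrapT => nCw.
have aw' : lt a w by split=> // E; apply: nCw; rewrite -E.
have wb' : lt w b by split=> // E; apply: nCw; rewrite E.
have : C `&` [set x | le x w] = C; first apply: cC.
- by exists a; split.
- exists [set x | lt x w]; first by have := lc_open H' w; congr open;
    apply/seteqP; split=> x [? nE]; split=> // E; apply: nE.
  apply/seteqP; split=> x [Cx xw]; split=> //; last by case: xw.
  by split=> // E; apply: nCw; rewrite -E.
- by exists [set x | le x w] => //; exact: lc_closed'.
- move=> /seteqP[_ /(_ b Cb)[_ /=]]; exact: (lt_not_le H).
Qed.

Lemma lc_interval (U : set T) x : open U -> U x ->
  exists O, [/\ open O, O x, convex_in le O & O `<=` U].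
Proof.
move=> oU Ux.
have side (le' : T -> T -> Prop) : lincont le' -> exists O, [/\ open O, O x,
    (forall a w, O a -> le' w a -> O w) & forall z, le' x z -> O z -> U z].
  move=> L; have [[b xb]|no] := pselect (exists b, slt le' x b).
    have [c [xc cb cU]] := lc_right L oU Ux xb.
    have L' := lincont_flip L.
    exists [set z | slt le' z c]; split=> //.
    + by have := lc_open L' c; congr open; apply/seteqP; split=> z [? nE]; split=> // E; apply: nE.
    + by move=> a w /= ac wa; exact: (le_lt_trans_lc L wa).
    + by move=> z xz [zc _]; exact: cU.
  exists setT; split=> //; first exact: openT.
  move=> z xz _; have [<-//|nE] := pselect (x = z).
  by exfalso; apply: no; exists z; split.
have [ O [oO Ox Od OU]] := side _ H; have [ O' [oO' Ox' Od' OU']] := side _ H'.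
exists (O `&` O'); split=> //; first exact: openI.
- by move=> a b w [Oa Oa'] [Ob Ob'] aw wb; split; [exact: Od wb|exact: Od' aw].
- by move=> z [Oz Oz']; case: (lc_total H x z) => xz; [exact: OU|exact: OU'].
Qed.

Lemma lc_locally_connected : locally_connected T.
Proof.
move=> x U [oU Ux]; have [ O [oO Ox Oc OU]] := lc_interval oU Ux.
by exists O; split=> //; exact: lc_convex_connected.
Qed.

End LincontConnected.

Section Monotone.
Variables (T T' : topologicalType) (le : T -> T -> Prop) (le' : T' -> T' -> Prop).
Hypotheses (H : lincont le) (H' : lincont le').
Local Notation lt := (slt le).
Local Notation lt' := (slt le').
Variables (P : set T) (phi : T -> T').
Hypotheses (Pc : convex_in le P) (phic : forall x, P x -> {for x, continuous phi}).
Hypothesis phiI : forall x y, P x -> P y -> phi x = phi y -> x = y.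

Lemma image_convex (C : set T) : C `<=` P -> convex_in le C -> convex_in le' (phi @` C).
Proof.
move=> CP Cc; apply: (lc_connected_convex H').
apply: connected_continuous_connected; first exact: (lc_convex_connected H).
by apply: continuous_in_subspaceT => x; rewrite inE => /CP; exact: phic.
Qed.

(** The image of an interval is an interval, and by injectivity it does not
    contain the image of a point outside. *)
Lemma phi_between a b c : P a -> P c -> lt a b -> lt b c ->
  (le' (phi a) (phi b) /\ le' (phi b) (phi c)) \/
  (le' (phi c) (phi b) /\ le' (phi b) (phi a)).
Proof.
move=> Pa Pc0 [ab nab] [bc nbc].
have Pb : P b by exact: (Pc Pa Pc0).
have seg x y z : P x -> P y -> P z -> le x y ->
   (le' (phi x) (phi z) /\ le' (phi z) (phi y)) \/
   (le' (phi y) (phi z) /\ le' (phi z) (phi x)) -> le x z /\ le z y.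
  move=> Px Py Pz xy zb.
  have ic : convex_in le' (phi @` [set w | le x w /\ le w y]).
    apply: image_convex => [w [? ?]|u v w [xu uy] [xv vy] uw wv].
      exact: (Pc Px Py).
    by split; [exact: (lc_trans H xu uw)|exact: (lc_trans H wv vy)].
  have ix : (phi @` [set w | le x w /\ le w y]) (phi x) by exists x; split=> //; exact: lc_refl.
  have iy : (phi @` [set w | le x w /\ le w y]) (phi y) by exists y; split=> //; exact: lc_refl.
  have [w [xw wy] E] : (phi @` [set w | le x w /\ le w y]) (phi z).
    by case: zb => -[h1 h2]; [exact: (ic _ _ _ ix iy)|exact: (ic _ _ _ iy ix)].
  by have <- : w = z by apply: phiI => //; exact: (Pc Px Py).
have c_ab : ~ (le a c /\ le c b).
  by move=> [_ cb]; apply: nbc; exact: (lc_anti H).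
have a_bc : ~ (le b a /\ le a c).
  by move=> [ba _]; apply: nab; exact: (lc_anti H).
have [ab'|ba'] := lc_total H' (phi a) (phi b); have [bc'|cb'] := lc_total H' (phi b) (phi c).
- by left.
- exfalso; have [ac'|ca'] := lc_total H' (phi a) (phi c).
  + by apply: c_ab; apply: seg => //; left.
  + by apply: a_bc; apply: seg => //; right.
- exfalso; have [ac'|ca'] := lc_total H' (phi a) (phi c).
  + by apply: a_bc; apply: seg => //; left.
  + by apply: c_ab; apply: seg => //; right.
- by right.
Qed.

Lemma phi_neq x y : P x -> P y -> lt x y -> phi x <> phi y.
Proof. by move=> Px Py [_ nE] E; apply: nE; exact: phiI. Qed.

(** The direction in which phi moves the ends of an interval is shared by all
    pairs of points inside; any two pairs lie in a common interval. *)
Lemma phi_sign m x y M : P m -> P M -> le m x -> lt x y -> le y M ->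
  lt' (phi m) (phi M) <-> lt' (phi x) (phi y).
Proof.
move=> Pm PM mx xy yM.
have Px : P x by apply: (Pc Pm PM) => //; case: (lt_le_trans_lc H xy yM).
have Py : P y by apply: (Pc Pm PM) => //; case: (le_lt_trans_lc H mx xy).
have step1 : lt' (phi x) (phi M) <-> lt' (phi x) (phi y).
  have [->//|nyM] := pselect (y = M).
  have [[xy' yM']|[My' yx']] := phi_between Px PM xy (conj yM nyM).
    split=> _; split; [exact: xy'|exact: phi_neq|exact: (lc_trans H' xy' yM')|].
    by apply: phi_neq => //; exact: (lt_le_trans_lc H xy yM).
  split=> -[l _]; exfalso.
    apply: (@phi_neq x M) => //; first exact: (lt_le_trans_lc H xy yM).
    by apply: (lc_anti H') => //; exact: (lc_trans H' My' yx').
  by apply: (@phi_neq x y) => //; exact: (lc_anti H').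
rewrite -step1; have [->//|nmx] := pselect (m = x).
have xM : lt x M by exact: (lt_le_trans_lc H xy yM).
have [[mx' xM']|[Mx' xm']] := phi_between Pm PM (conj mx nmx) xM.
  split=> _; split; [exact: xM'|exact: phi_neq|exact: (lc_trans H' mx' xM')|].
  by apply: phi_neq => //; exact: (le_lt_trans_lc H mx xM).
split=> -[l _]; exfalso.
  apply: (@phi_neq m M) => //; first exact: (le_lt_trans_lc H mx xM).
  by apply: (lc_anti H') => //; exact: (lc_trans H' Mx' xm').
by apply: (@phi_neq x M) => //; exact: (lc_anti H').
Qed.

Lemma phi_monotone :
  (forall x y, P x -> P y -> lt x y -> lt' (phi x) (phi y)) \/
  (forall x y, P x -> P y -> lt x y -> lt' (phi y) (phi x)).
Proof.
have [[x0 [y0 [Px0 Py0 xy0 lt0]]]|no] := pselect (exists x y, [/\ P x, P y, lt x y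
  & lt' (phi x) (phi y)]); last first.
  right=> x y Px Py xy; split.
    have [l|//] := lc_total H' (phi x) (phi y); exfalso; apply: no.
    by exists x, y; split=> //; split=> //; exact: phi_neq.
  by move=> E; apply: (phi_neq Px Py xy).
left=> x y Px Py xy.
have [m [Pm mx mx0]] : exists m, [/\ P m, le m x & le m x0].
  by case: (lc_total H x x0) => l; [exists x|exists x0]; split=> //; exact: lc_refl.
have [M [PM yM y0M]] : exists M, [/\ P M, le y M & le y0 M].
  by case: (lc_total H y y0) => l; [exists y0|exists y]; split=> //; exact: lc_refl.
by apply/(phi_sign Pm PM mx xy yM)/(phi_sign Pm PM mx0 xy0 y0M).
Qed.

Variable P' : set T'.
Hypothesis P'c : convex_in le' P'.
Hypothesis phiP : forall x, P x -> P' (phi x).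
Hypothesis Pnoend : forall x, P x -> exists y z, [/\ P y, P z, lt y x & lt x z].
Hypothesis P0 : P !=set0.
Hypothesis imclosed : forall w, P' w -> closure (phi @` P) w -> (phi @` P) w.

(** The image is relatively closed, and open by monotonicity. *)
Lemma phi_onto : forall w, P' w -> exists2 x, P x & phi x = w.
Proof.
move=> w P'w; apply: contrapT => nw.
have imc : convex_in le' (phi @` P) by exact: image_convex.
have noext x : P x -> exists y z, [/\ P y, P z, lt' (phi y) (phi x) & lt' (phi x) (phi z)].
  move=> Px; have [y [z [Py Pz yx xz]]] := Pnoend Px.
  by case: phi_monotone => mono; [exists y, z|exists z, y]; split=> //; exact: mono.
have key (l : T' -> T' -> Prop) : lincont l -> convex_in l P' ->
    (forall x, P x -> exists2 z, P z & slt l (phi x) (phi z)) ->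
    (forall x, P x -> l (phi x) w) -> False.
  move=> L Lc up bd; have [x0 Px0] := P0.
  have [|m [ub lub]] := lc_lub L (A := phi @` P); first by exists (phi x0), x0.
  have mw : l m w by apply: lub => _ [x Px <-]; exact: bd.
  have P'm : P' m by apply: (Lc (phi x0) w) => //; [exact: phiP|apply: ub; exists x0].
  have [x Px mE] : (phi @` P) m.
    have [//|nm] := pselect ((phi @` P) m); apply: imclosed => // B /= mB.
    move: mB; rewrite nbhsE => -[ O [oO Om] OB].
    have L' := lincont_flip L.
    have [|c [mc _ cO]] := lc_right L' oO Om (b := phi x0).
      split; first by apply: ub; exists x0.
      by move=> E; apply: nm; rewrite E; exists x0.
    have [y Py nyc] : exists2 y, P y & ~ l (phi y) c.
      apply: contrapT => no; have : l m c.
        by apply: lub => _ [y Py <-]; apply: contrapT => nyc; apply: no; exists y.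
      by move=> mc'; case: mc => cm nE; apply: nE; apply: (lc_anti L).
    exists (phi y); split; first by exists y.
    apply: OB; apply: cO; first by apply: ub; exists y.
    by case: (not_le_lt L nyc).
  have [z Pz xz] := up x Px.
  apply: (lt_not_le L xz); rewrite mE; apply: ub; by exists z.
have side : (forall x, P x -> le' (phi x) w) \/ (forall x, P x -> le' w (phi x)).
  have [[x [Px nx]]|no] := pselect (exists x, P x /\ ~ le' (phi x) w); last first.
    by left=> x Px; apply: contrapT => nx; apply: no; exists x.
  right=> y Py; apply: contrapT => ny; apply: nw.
  have [wx _] := not_le_lt H' nx; have [yw _] := not_le_lt H' ny.
  have [||z Pz E] := imc _ _ _ _ _ yw wx; [by exists y|by exists x|by exists z].
case: side => bd.
- apply: (key le') => // x Px; have [_ [z [_ Pz _ xz]]] := noext x Px; by exists z.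
- apply: (key (flip_rel le')) => //; [exact: lincont_flip|exact: convex_flip|].
  move=> x Px; have [y [_ [Py _ [yx nE] _]]] := noext x Px; exists y => //.
  by split=> // E; apply: nE.
Qed.

End Monotone.

(** * The square over an arcless continuum with its boundary collapsed *)

Section Sphere.
Variable R : realType.

Definition ptle (J : Type) (Z : set (cube J R)) (x y : set_type Z) : Prop :=
  forall j, set_val x j <= set_val y j.

Record arcless (J : Type) (Z : set (cube J R)) : Prop := Arcless {
  al_cube : forall v j, Z v -> 0 <= v j <= 1;
  al_lin : lincont (@ptle J Z);
  al_bot : Z (fun=> 0);
  al_top : Z (fun=> 1);
  al_inh : exists j : J, True;
  al_arc : forall (g : R -> set_type Z) s t, continuous g -> g s = g t }.

Lemma cont_near_eq (T U : topologicalType) (f g : T -> U) (x : T) (V : set T) :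
  {for x, continuous g} -> open V -> V x -> (forall y, V y -> f y = g y) ->
  {for x, continuous f}.
Proof.
move=> gc oV Vx fg W; rewrite (fg x Vx) => /gc gW.
have : nbhs x (V `&` (g @^-1` W)) by apply: filterI => //; exact: open_nbhs_nbhs.
by apply: (@filterS _ (nbhs x)) => y [Vy]; rewrite /= fg.
Qed.

Lemma half_bounds (u : R) : 0 <= u <= 1 -> 0 <= u / 2 <= 1 /\ (0 < u -> 0 < u / 2 < 1).
Proof. by move=> /andP[u0 u1]; split=> [|u0']; lra. Qed.

Lemma half_inj (u v : R) : u / 2 = v / 2 -> u = v.
Proof. by move=> E; lra. Qed.

Section OneSphere.
Variables (J : Type) (Z : set (cube J R)).
Hypothesis HZ : arcless Z.
Local Notation ZT := (set_type Z).
Local Notation Idx := (J * J * option (option J))%type.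

Definition factor (o : option (option J)) (z : cube J R) (t : R) : R :=
  match o with None => 1 | Some None => t | Some (Some m) => z m end.

(** The products vanish exactly on the boundary of the square Z x [0, 1], and
    the quotients of the coordinates recover z and t off the boundary: the
    image of the square is the square with its boundary collapsed. *)
Definition collapse (z : cube J R) (t : R) : cube Idx R := fun p =>
  z p.1.1 * (1 - z p.1.2) * (t * (1 - t)) * factor p.2 z t.

Definition sphere : topologicalType :=
  set_type [set v : cube Idx R | exists (z : ZT) t, v = collapse (set_val z) (clamp 0 1 t)].

Definition sph (z : ZT) (t : R) : sphere :=
  SigSub (mem_set (ex_intro _ z (ex_intro _ t erefl)) :
    collapse (set_val z) (clamp 0 1 t) \in
      [set v : cube Idx R | exists (z : ZT) t, v = collapse (set_val z) (clamp 0 1 t)]).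

Definition zbot : ZT := SigSub (mem_set (al_bot HZ)).
Definition ztop : ZT := SigSub (mem_set (al_top HZ)).
Definition pole : sphere := sph zbot 0.
Definition inner (z : ZT) := z <> zbot /\ z <> ztop.

Definition sco (p : Idx) (x : sphere) : R := set_val x p.

Lemma sco_sph p z t : 0 <= t <= 1 -> sco p (sph z t) =
  set_val z p.1.1 * (1 - set_val z p.1.2) * (t * (1 - t)) * factor p.2 (set_val z) t.
Proof.
move=> t01; have -> : sco p (sph z t) = collapse (set_val z) (clamp 0 1 t) p by [].
by rewrite clamp_id.
Qed.

Lemma sphere_eq (x y : sphere) : (forall p, sco p x = sco p y) -> x = y.
Proof. by move=> E; apply: val_inj; apply/funext => p; exact: E. Qed.

Lemma sphere_sph x : exists z t, 0 <= t <= 1 /\ x = sph z t.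
Proof.
case: x => x xP; have [z [t E]] := set_mem xP; exists z, (clamp 0 1 t).
have c01 : 0 <= clamp 0 1 t <= 1 by apply: clamp_in; rewrite ler01.
split=> //; apply: sphere_eq => p; rewrite sco_sph //.
by have -> : sco p (SigSub xP) = collapse (set_val z) (clamp 0 1 t) p by rewrite -E.
Qed.

Lemma zval01 (z : ZT) j : 0 <= set_val z j <= 1.
Proof. by apply: (al_cube HZ); exact: set_valP. Qed.

Lemma zT_eq (z z' : ZT) : (forall j, set_val z j = set_val z' j) -> z = z'.
Proof. by move=> E; apply: val_inj; apply/funext. Qed.

Lemma inner_pos z : inner z -> exists j k, 0 < set_val z j /\ set_val z k < 1.
Proof.
move=> [nb nt].
have [j zj] : exists j, 0 < set_val z j.
  apply: contrapT => no; apply: nb; apply: zT_eq => j.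
  have /andP[z0 _] := zval01 z j; apply/eqP; move: z0; rewrite le_eqVlt => /orP[/eqP<-//|zj].
  by exfalso; apply: no; exists j.
have [k zk] : exists k, set_val z k < 1.
  apply: contrapT => no; apply: nt; apply: zT_eq => k.
  have /andP[_ z1] := zval01 z k; apply/eqP; move: z1; rewrite le_eqVlt => /orP[//|zk].
  by exfalso; apply: no; exists k.
by exists j, k.
Qed.

Lemma pole_sco p : sco p pole = 0.
Proof. by rewrite sco_sph ?lexx ?ler01 // !mul0r. Qed.

Lemma pos_neq_pole p x : 0 < sco p x -> x <> pole.
Proof. by move=> px E; move: px; rewrite E pole_sco ltxx. Qed.

Lemma sph_pole z t : 0 <= t <= 1 -> (~ inner z) \/ t = 0 \/ t = 1 -> sph z t = pole.
Proof.
move=> t01 bd; apply: sphere_eq => p; rewrite pole_sco sco_sph //.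
case: bd => [/not_andP[/contrapT->|/contrapT->]|[->|->]].
- by rewrite !mul0r.
- have -> : set_val ztop p.1.2 = 1 by [].
  by rewrite subrr mulr0 !mul0r.
- by rewrite mul0r mulr0 mul0r.
- by rewrite subrr !mulr0 mul0r.
Qed.

Lemma sph_pos z t j k : 0 < set_val z j -> set_val z k < 1 -> 0 < t < 1 ->
  0 < sco (j, k, None) (sph z t).
Proof.
move=> zj zk /andP[t0 t1]; rewrite sco_sph ?(ltW t0) ?(ltW t1) //= mulr1.
by rewrite !mulr_gt0 // subr_gt0.
Qed.

Lemma sph_neq_pole z t : inner z -> 0 < t < 1 -> sph z t <> pole.
Proof.
move=> iz t01; have [j [k [zj zk]]] := inner_pos iz.
exact: (pos_neq_pole (sph_pos zj zk t01)).
Qed.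

Lemma sphereP x : x <> pole -> exists z t, [/\ inner z, 0 < t < 1 & x = sph z t].
Proof.
have [z [t [t01 ->]]] := sphere_sph x => np.
have iz : inner z by apply: contrapT => niz; apply: np; apply: sph_pole => //; left.
exists z, t; split=> //; move: (t01) => /andP[t0 t1]; rewrite !lt_neqAle t0 t1 !andbT.
by apply/andP; split; apply/eqP => E; apply: np; apply: sph_pole => //; right; [left|right].
Qed.

Lemma sph_inj z z' t t' : inner z -> 0 < t < 1 -> 0 <= t' <= 1 ->
  sph z t = sph z' t' -> z = z' /\ t = t'.
Proof.
move=> iz t01 t'01 E; have [j [k [zj zk]]] := inner_pos iz.
have D0 := sph_pos zj zk t01.
have t01' : 0 <= t <= 1 by move: t01 => /andP[/ltW -> /ltW ->].
have rat o : factor o (set_val z) t = factor o (set_val z') t'.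
  have E0 := congr1 (sco (j, k, None)) E; have Eo := congr1 (sco (j, k, o)) E.
  move: D0 E0 Eo; rewrite !sco_sph //= !mulr1 => D0 <- /mulfI; apply.
  by rewrite gt_eqF.
split; last exact: (rat (Some None)).
by apply: zT_eq => m; exact: (rat (Some (Some m))).
Qed.

Lemma sco_cont p : continuous (sco p).
Proof.
move=> x; apply: (@cont_comp _ _ _ set_val (fun w : cube Idx R => w p)).
  exact: val_cont.
exact: cube_projC.
Qed.

Lemma zval_cont j : continuous (fun z : ZT => set_val z j).
Proof.
move=> x; apply: (@cont_comp _ _ _ set_val (fun w : cube J R => w j)).
  exact: val_cont.
exact: cube_projC.
Qed.

Lemma sph_cont : continuous (fun zt : ZT * R => sph zt.1 zt.2).
Proof.
move=> x; apply: sub_contP; apply: cube_contP => -[[j k] o].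
have zc m : {for x, continuous (fun zt : ZT * R => set_val zt.1 m)}.
  apply: (@cont_comp _ _ _ fst (fun z : ZT => set_val z m)); first exact: cvg_fst.
  exact: zval_cont.
have tc : {for x, continuous (fun zt : ZT * R => clamp 0 1 zt.2)}.
  by apply: (@cont_comp _ _ _ snd (clamp 0 1)); [exact: cvg_snd|exact: clamp_cont].
have cc : {for x, continuous (fun=> 1 : R)} by exact: cvg_cst.
rewrite /= /collapse /=.
apply: (@contM R (ZT * R)%type (fun zt => set_val zt.1 j * (1 - set_val zt.1 k) *
  (clamp 0 1 zt.2 * (1 - clamp 0 1 zt.2))) (fun zt => factor o (set_val zt.1) (clamp 0 1 zt.2))).
  apply: (@contM R (ZT * R)%type (fun zt => set_val zt.1 j * (1 - set_val zt.1 k))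
    (fun zt => clamp 0 1 zt.2 * (1 - clamp 0 1 zt.2))).
    apply: (@contM R (ZT * R)%type (fun zt => set_val zt.1 j) (fun zt => 1 - set_val zt.1 k)) => //.
    exact: (@contB R (ZT * R)%type (fun=> 1) (fun zt => set_val zt.1 k)).
  apply: (@contM R (ZT * R)%type (fun zt => clamp 0 1 zt.2) (fun zt => 1 - clamp 0 1 zt.2)) => //.
  exact: (@contB R (ZT * R)%type (fun=> 1) (fun zt => clamp 0 1 zt.2)).
case: o => [[m|]|]; [exact: zc|exact: tc|exact: cc].
Qed.

Lemma sph_contt z : continuous (sph z).
Proof.
move=> t; apply: (@cont_comp _ _ _ (fun t => (z, t)) (fun zt : ZT * R => sph zt.1 zt.2)).
  exact: pair_contr.
exact: sph_cont.
Qed.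

Lemma sph_contz t : continuous (sph ^~ t).
Proof.
move=> z; apply: (@cont_comp _ _ _ (fun z => (z, t)) (fun zt : ZT * R => sph zt.1 zt.2)).
  exact: pair_contl.
exact: sph_cont.
Qed.

Lemma sphere_hausdorff : hausdorff_space sphere.
Proof. exact/sub_hausdorff/cube_hausdorff. Qed.

Lemma sphere_compact : compact [set: sphere].
Proof.
have -> : [set: sphere] = (fun zt : ZT * R => sph zt.1 zt.2) @` ([set: ZT] `*` `[0, 1]).
  apply/seteqP; split=> // x _; have [z [t [t01 ->]]] := sphere_sph x.
  by exists (z, t) => //; split.
apply: compact_image; last exact: sph_cont.
apply: compact_setX; [exact: lc_compact (al_lin HZ)|exact: segment_compact].
Qed.

Lemma sphere_star x : exists g : R -> sphere, [/\ continuous g, g 0 = pole & g 1 = x].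
Proof.
have [z [t [t01 ->]]] := sphere_sph x; exists (fun s => sph z (t * s)); split.
- move=> s; apply: (@cont_comp _ _ _ (fun s => t * s) (sph z)).
    by apply: (@contZ R R id); exact: cvg_id.
  exact: sph_contt.
- by rewrite mulr0; apply: sph_pole; rewrite ?lexx ?ler01 //; right; left.
- by rewrite mulr1.
Qed.

Lemma sphere_locally_connected : locally_connected sphere.
Proof.
apply: (@locally_connected_quotient unit (ZT * R)%type sphere ([set: ZT] `*` `[0, 1])
  (fun _ zt => sph zt.1 zt.2)).
- apply: locally_connected_prod; last exact: connectedR_lc.
  exact: (lc_locally_connected (al_lin HZ)).
- apply: compact_setX; [exact: lc_compact (al_lin HZ)|exact: segment_compact].
- exact: sphere_hausdorff.
- by move=> _; exact: sph_cont.
- move=> x; have [z [t [t01 ->]]] := sphere_sph x; by exists tt, (z, t).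
Qed.

Lemma bot_lt_top : slt (@ptle J Z) zbot ztop.
Proof.
split; first by move=> j; exact: ler01.
have [j _] := al_inh HZ => /(congr1 (fun z : ZT => set_val z j)) E.
have : (0 : R) = 1 by exact: E.
by move/eqP; rewrite eq_sym oner_eq0.
Qed.

Lemma zbot_le z : ptle zbot z.
Proof. by move=> j; have /andP[] := zval01 z j. Qed.

Lemma ztop_ge z : ptle z ztop.
Proof. by move=> j; have /andP[] := zval01 z j. Qed.

Lemma innerP z : inner z <-> slt (@ptle J Z) zbot z /\ slt (@ptle J Z) z ztop.
Proof.
split=> [[nb nt]|[[_ nb] [_ nt]]]; last by split=> // E; apply: nb; rewrite E.
by split; split=> //; [exact: zbot_le|move=> E; apply: nb|exact: ztop_ge].
Qed.

Lemma inner_convex : convex_in (@ptle J Z) inner.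
Proof.
have H := al_lin HZ; move=> a b w /innerP[ba _] /innerP[_ bt] aw wb; apply/innerP; split.
  exact: (lt_le_trans_lc H ba).
exact: (le_lt_trans_lc H wb).
Qed.

Lemma inner_noend z : inner z ->
  exists y w, [/\ inner y, inner w, slt (@ptle J Z) y z & slt (@ptle J Z) z w].
Proof.
have H := al_lin HZ; move=> /innerP[[bz nb] [zt nt]].
have [y [by_ yz ny1 ny2]] := lc_dense H bz nb.
have [w [zw wt nw1 nw2]] := lc_dense H zt nt.
exists y, w; split; [| |by split|by split=> // E; apply: nw1].
  apply/innerP; split; first by split=> // E; apply: ny1.
  by apply: (lt_le_trans_lc H (y := z)) => //; split.
apply/innerP; split; last by split.
by apply: (le_lt_trans_lc H bz); split=> // E; apply: nw1.
Qed.

Lemma inner_exists : exists z, inner z.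
Proof.
have [l nE] := bot_lt_top; have [z [? ? ? ?]] := lc_dense (al_lin HZ) l nE.
by exists z.
Qed.

Lemma sphere_continuum : continuum sphere.
Proof.
split; [exact: sphere_compact|exact: star_connected sphere_star|exact: sphere_hausdorff|].
have [z iz] := inner_exists; exists (sph z 2^-1), pole; apply: sph_neq_pole => //.
by lra.
Qed.

Lemma sphere_pathwise : pathwise_connected R sphere.
Proof. exact: star_pathwise_connected sphere_star. Qed.

(** Distinct d k are coordinates which never lie in (0, 1) at the same point, so
    the open sets where they do are disjoint. *)
Lemma sphere_has_weight (K : Type) (d : K -> J) : emb nat K -> emb J K ->
  (forall k, exists z : ZT, 0 < set_val z (d k) < 1) ->
  (forall (z : ZT) k l, 0 < set_val z (d k) < 1 -> 0 < set_val z (d l) < 1 -> k = l) ->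
  has_weight sphere K.
Proof.
move=> nK JK dex ddis.
have pos x k : 0 < sco (d k, d k, None) x ->
    exists z t, [/\ 0 < set_val z (d k) < 1, inner z, 0 < t < 1 & x = sph z t].
  move=> xk; have [z [t [iz t01 E]]] := sphereP (pos_neq_pole xk).
  exists z, t; split=> //; move: xk; rewrite E sco_sph; last first.
    by move: t01 => /andP[/ltW -> /ltW ->].
  have /andP[z0 z1] := zval01 z (d k); rewrite /= mulr1 !lt_neqAle z0 z1 !andbT => xk.
  apply/andP; split; apply/eqP => Ez; move: xk; first by rewrite -Ez !mul0r eqxx.
  by rewrite Ez subrr mulr0 mul0r eqxx.
apply: (@has_weight_disjoint R sphere Idx K sco _ _ _ nK _
  (fun k => sco (d k, d k, None) @^-1` [set r | 0 < r])).
- exact: sphere_compact.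
- exact: sco_cont.
- move=> x y xy; apply: contrapT => no; apply: xy; apply: sphere_eq => o.
  by apply: contrapT => oE; apply: no; exists o.
- apply: emb_prod_in => //; first exact: emb_prod_in.
  by apply: emb_option => //; exact: emb_option.
- move=> k; apply: open_comp => [? _|]; [exact: sco_cont|exact: open_gt].
- move=> k; have [z /andP[z0 z1]] := dex k; exists (sph z 2^-1) => /=.
  by apply: sph_pos => //; lra.
- move=> k l x /= /pos[z [t [zk iz t01 E]]] /pos[z' [t' [zl iz' t'01 E']]].
  apply: (ddis z) => //; have [|-> _] // := sph_inj iz t01 _ (etrans (esym E) E').
  by move: t'01 => /andP[/ltW -> /ltW ->].
Qed.

(** Coordinates of a point, which are meaningful off the pole only. *)
Definition zco (x : sphere) : ZT := sval (cid (sphere_sph x)).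
Definition tco (x : sphere) : R := sval (cid (svalP (cid (sphere_sph x)))).

Lemma zt_co x : 0 <= tco x <= 1 /\ x = sph (zco x) (tco x).
Proof. exact: (svalP (cid (svalP (cid (sphere_sph x))))). Qed.

Lemma zt_co_sph z t : inner z -> 0 < t < 1 -> zco (sph z t) = z /\ tco (sph z t) = t.
Proof.
move=> iz t01; have [c01 E] := zt_co (sph z t).
by have [zE tE] := sph_inj iz t01 c01 E; split; exact: esym.
Qed.

Lemma zco_inner x : x <> pole -> inner (zco x) /\ 0 < tco x < 1.
Proof. by move=> /sphereP[z [t [iz t01 ->]]]; have [-> ->] := zt_co_sph iz t01. Qed.

Lemma sco_co j k o x :
  sco (j, k, o) x = sco (j, k, None) x * factor o (set_val (zco x)) (tco x).
Proof.
have [c01 E] := zt_co x; rewrite [in LHS]E [in X in _ = X * _]E !sco_sph //=.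
by rewrite mulr1.
Qed.

(** Off the pole this is a quotient of two coordinates, as in [sph_inj]. *)
Lemma factor_cont o x : x <> pole ->
  {for x, continuous (fun y => factor o (set_val (zco y)) (tco y))}.
Proof.
move=> xp; have [ix tx] := zco_inner xp; have [j [k [zj zk]]] := inner_pos ix.
have [_ E] := zt_co x.
have px : 0 < sco (j, k, None) x by rewrite E; exact: sph_pos.
apply: (@cont_near_eq _ _ _ (fun y => sco (j, k, o) y * (sco (j, k, None) y)^-1) _
  (sco (j, k, None) @^-1` [set r | 0 < r])).
- apply: (@contM R sphere (sco (j, k, o)) (fun y => (sco (j, k, None) y)^-1)).
    exact: sco_cont.
  apply: (@contV R sphere (sco (j, k, None))); first exact: sco_cont.
  by rewrite gt_eqF.
- by apply: open_comp => [? _|]; [exact: sco_cont|exact: open_gt].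
- exact: px.
- move=> y /= py; rewrite sco_co mulrAC mulfV ?mul1r //.
  by rewrite gt_eqF.
Qed.

Lemma tco_cont x : x <> pole -> {for x, continuous tco}.
Proof. by move=> xp; exact: (@factor_cont (Some None) x xp). Qed.

Lemma zco_cont x : x <> pole -> {for x, continuous zco}.
Proof.
move=> xp; apply: sub_contP; apply: cube_contP => m.
exact: (@factor_cont (Some (Some m)) x xp).
Qed.

(** Paths off the pole cannot change fibre, Z being arcless. *)
Lemma zco_path (g : R -> sphere) a b : continuous g ->
  (forall s, a <= s <= b -> g s <> pole) -> forall s, a <= s <= b -> zco (g s) = zco (g a).
Proof.
move=> gc gp s /andP[as_ sb]; have ab := le_trans as_ sb.
have : zco (g (clamp a b s)) = zco (g (clamp a b a)).
  apply: (al_arc HZ (g := fun s => zco (g (clamp a b s)))) => u.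
  apply: (@cont_comp _ _ _ (fun s => g (clamp a b s)) zco).
    by apply: (@cont_comp _ _ _ (clamp a b) g); [exact: clamp_cont|exact: gc].
  by apply: zco_cont; apply: gp; exact: clamp_in.
by rewrite !clamp_id ?lexx ?as_ ?ab.
Qed.

(** Near any other point, paths stay in one fibre, on which the second
    coordinate is injective. *)
Lemma branch_pole x : branch_point R x -> x = pole.
Proof.
move=> bp; apply: contrapT => xp; move: bp.
apply: (@not_branch_point R sphere x [set y | y <> pole]
  [set y | y <> pole /\ zco y = zco x] tco).
- apply: open_nbhs_nbhs; split=> //.
  have -> : [set y | y <> pole] = ~` [set pole] by [].
  apply: closed_openC; apply: accessible_closed_set1; apply: hausdorff_accessible.
  exact: sphere_hausdorff.
- by move=> y /= yp; exact: tco_cont.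
- move=> g e gc g0 e0 gU s se; split; first exact: gU.
  by rewrite (zco_path gc gU se) g0.
- move=> y z [yp yz] [zp zz] E; have [_ ->] := zt_co y; have [_ ->] := zt_co z.
  by rewrite yz zz E.
Qed.

(** Three fibres, traversed up to their middles. *)
Lemma pole_branch : branch_point R pole.
Proof.
have [z0 i0] := inner_exists; have [z1 [z2 [i1 i2 l1 l2]]] := inner_noend i0.
pose z (i : 'I_3) := if i == 0 then z0 else if i == 1 then z1 else z2.
have iz i : inner (z i) by rewrite /z; case: ifP => // _; case: ifP.
have n12 : z1 <> z2.
  move=> E; case: l1 => l1 n1; case: l2 => l2 n2; apply: n1.
  by apply: (lc_anti (al_lin HZ)) => //; rewrite E.
have zI : injective z.
  have n01 : z0 <> z1 by case: l1 => _ n E; apply: n.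
  have n02 : z0 <> z2 by case: l2.
  move=> [[|[|[|//]]] h] [[|[|[|//]]] h'] E; apply: val_inj => //=; exfalso;
    move: E; rewrite /z /=; by [|move/esym].
exists (fun i s => sph (z i) (s / 2)); split.
- move=> i s; apply: (@cont_comp R R sphere (fun s => s / 2) (sph (z i))).
    by apply: (@contM R R id (fun=> 2^-1)); [exact: cvg_id|exact: cvg_cst].
  exact: sph_contt.
- by move=> i; rewrite mul0r; apply: sph_pole; rewrite ?lexx ?ler01 //; right; left.
move=> i i' s s' s01 s'01 E.
have [s2 s2'] := half_bounds s01; have [r2 r2'] := half_bounds s'01.
have le0 (u : R) : u <= 0 -> 0 <= u <= 1 -> u = 0.
  by move=> u0 /andP[u0' _]; apply/eqP; rewrite eq_le u0 u0'.
have [s0|s0] := ltP 0 s.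
  by have [/zI -> /half_inj] := sph_inj (iz i) (s2' s0) r2 E.
have s0E := le0 _ s0 s01.
split=> //.
have [s'0|s'0] := ltP 0 s'; last by rewrite s0E (le0 _ s'0 s'01).
by have [_ /half_inj] := sph_inj (iz i') (r2' s'0) s2 (esym E).
Qed.

End OneSphere.
End Sphere.

(** * Embeddings of collapsed squares *)

Section SphereEmbedding.
Variables (R : realType) (J J' : Type) (Z : set (cube J R)) (Z' : set (cube J' R)).
Hypotheses (HZ : arcless Z) (HZ' : arcless Z').
Variable f : sphere Z -> sphere Z'.
Hypotheses (fc : continuous f) (fI : injective f).

Lemma embed_pole : f (pole HZ) = pole HZ'.
Proof. exact: (branch_pole HZ' (branch_point_inj fc fI (pole_branch HZ))). Qed.

Lemma embed_neq_pole x : x <> pole HZ -> f x <> pole HZ'.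
Proof. by move=> xp; rewrite -embed_pole => /fI. Qed.

Definition fibre_map (z : set_type Z) : set_type Z' := zco (f (sph z 2^-1)).

Let half01 : (0 : R) < (2^-1 : R) < (1 : R).
Proof. by apply/andP; split; lra. Qed.

Lemma embed_fibre_cont z : continuous (fun t => f (sph z t)).
Proof.
move=> t; apply: (@cont_comp _ _ _ (sph z) f); [exact: sph_contt|exact: fc].
Qed.

(** A fibre without its ends is a path off the pole, and so is its image. *)
Lemma embed_fibre z t : inner HZ z -> 0 < t < 1 -> zco (f (sph z t)) = fibre_map z.
Proof.
move=> iz t01; pose a := Num.min t 2^-1; pose b := Num.max t 2^-1.
have gp s : a <= s <= b -> f (sph z s) <> pole HZ'.
  move=> /andP[as_ sb]; apply: embed_neq_pole; apply: sph_neq_pole => //.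
  move: t01 half01 => /andP[t0 t1] /andP[h0 h1]; apply/andP; split.
    by apply: lt_le_trans as_; rewrite lt_min t0.
  by apply: (le_lt_trans sb); rewrite gt_max t1.
have P := zco_path (@embed_fibre_cont z) gp.
rewrite /fibre_map (P t) ?(P 2^-1) //.
- by rewrite ge_min lexx orbT le_max lexx orbT.
- by rewrite ge_min lexx le_max lexx.
Qed.

Lemma embed_co z t : inner HZ z -> 0 < t < 1 ->
  f (sph z t) = sph (fibre_map z) (tco (f (sph z t))) /\ 0 < tco (f (sph z t)) < 1.
Proof.
move=> iz t01; have [_ E] := zt_co (f (sph z t)).
rewrite -(embed_fibre iz t01); split=> //.
by have [] := zco_inner (HZ := HZ') (embed_neq_pole (sph_neq_pole iz t01)).
Qed.

Lemma fibre_map_inner z : inner HZ z -> inner HZ' (fibre_map z).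
Proof.
move=> iz.
by have [] := zco_inner (HZ := HZ') (embed_neq_pole (sph_neq_pole iz half01)).
Qed.

(** The image of a fibre starts and ends at the pole without leaving its
    fibre; were it to avoid the middle of that fibre, it would have to turn
    back. *)
Lemma embed_middle z : inner HZ z ->
  exists t, 0 < t < 1 /\ f (sph z t) = sph (fibre_map z) 2^-1.
Proof.
move=> iz; have ip := fibre_map_inner iz.
have [j [k [pj pk]]] := inner_pos ip.
pose tau t := tco (f (sph z t)).
apply: contrapT => no.
have tauN t : 0 < t < 1 -> tau t <> 2^-1.
  move=> t01 E; apply: no; exists t; split=> //.
  by have [-> _] := embed_co iz t01; rewrite -/(tau t) E.
have tauc t : 0 < t < 1 -> {for t, continuous tau}.
  move=> t01; apply: (@cont_comp _ _ _ (fun t => f (sph z t)) (@tco R J' Z')).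
    exact: embed_fibre_cont.
  apply: (tco_cont (HZ := HZ')); apply: embed_neq_pole; exact: sph_neq_pole.
have side a b : 0 < a < 1 -> 0 < b < 1 -> a <= b ->
    (tau a < 2^-1) = (tau b < 2^-1).
  move=> /andP[a0 a1] /andP[b0 b1] ab; apply: contrapT => nE.
  have [||c /andP[ac cb] E] := @ivt R tau a b 2^-1 ab.
  - move=> x /andP[ax xb]; apply: tauc.
    by rewrite (lt_le_trans a0 ax) (le_lt_trans xb b1).
  - case: (ltP (tau a) 2^-1) nE; case: (ltP (tau b) 2^-1) => //= h1 h2 _.
      by rewrite (ltW h2).
    by rewrite (ltW h1) orbT.
  by apply: (tauN c) => //; rewrite (lt_le_trans a0 ac) (le_lt_trans cb b1).
have side2 a b : 0 < a < 1 -> 0 < b < 1 -> (tau a < 2^-1) = (tau b < 2^-1).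
  move=> ha hb; have [ab|/ltW ba] := leP a b; first exact: side.
  by apply/esym; exact: side.
(* w is a positive multiple of tau (1 - tau), hence injective as long as tau
   stays on one side of 1/2; but it vanishes at both ends of the fibre. *)
pose w t := sco (j, k, None) (f (sph z t)).
have wE t : 0 < t < 1 -> w t = set_val (fibre_map z) j * (1 - set_val (fibre_map z) k) *
    (tau t * (1 - tau t)).
  move=> t01; have [E /andP[/ltW t0 /ltW t1]] := embed_co iz t01.
  by rewrite /w E sco_sph ?t0 ?t1 //= mulr1.
have W0 : 0 < set_val (fibre_map z) j * (1 - set_val (fibre_map z) k).
  by rewrite mulr_gt0 // subr_gt0.
have wI a b : 0 < a < 1 -> 0 < b < 1 -> w a = w b -> a = b.
  move=> ha hb; rewrite (wE _ ha) (wE _ hb) => /mulfI.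
  rewrite gt_eqF // => /(_ isT) tE.
  have tab : tau a = tau b.
    have : (tau a - tau b) * (1 - tau a - tau b) = 0.
      have -> : (tau a - tau b) * (1 - tau a - tau b) =
        tau a * (1 - tau a) - tau b * (1 - tau b) by ring.
      by rewrite tE subrr.
    move=> /eqP; rewrite mulf_eq0 subr_eq0 => /orP[/eqP//|/eqP E]; exfalso.
    have := side2 a b ha hb; have := tauN a ha; have := tauN b hb; move: E.
    move: (tau a) (tau b) => u v E /eqP nu /eqP nv.
    move: nu nv; rewrite !neq_lt => /orP[] h1 /orP[] h2;
      rewrite ?h1 ?h2 ?[_ < 2^-1]ltNge ?(ltW h1) ?(ltW h2) //=; by move=> *; lra.
  have [Ea _] := embed_co iz ha; have [Eb _] := embed_co iz hb.
  have /fI : f (sph z a) = f (sph z b) by rewrite Ea Eb -/(tau a) -/(tau b) tab.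
  have b01 : 0 <= b <= 1 by move: hb => /andP[/ltW -> /ltW ->].
  by move=> /(sph_inj iz ha b01)[].
have wc t : {for t, continuous w}.
  apply: (@cont_comp _ _ _ (fun t => f (sph z t)) (sco (j, k, None))).
    exact: embed_fibre_cont.
  exact: sco_cont.
have w0 : w 0 = 0.
  by rewrite /w (sph_pole (HZ := HZ)) ?embed_pole ?pole_sco ?lexx ?ler01 //; right; left.
have w1 : w 1 = 0.
  by rewrite /w (sph_pole (HZ := HZ)) ?embed_pole ?pole_sco ?lexx ?ler01 //; right; right.
have wh : 0 < w 2^-1.
  rewrite wE // mulr_gt0 //; have [_ /andP[t0 t1]] := embed_co iz half01.
  by rewrite mulr_gt0 // subr_gt0.
move: half01 => /andP[h0 h1].
have hv : 0 < w 2^-1 / 2 < w 2^-1.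
  by move: (w 2^-1) wh => u u0; apply/andP; split; lra.
move: hv => /andP[v0 v1].
have [||a /andP[a0 ah] Ea] := @ivt R w 0 2^-1 (w 2^-1 / 2) (ltW h0).
- by move=> x _; exact: wc.
- by rewrite w0 (ltW v0) (ltW v1).
have [||b /andP[bh b1] Eb] := @ivt R w 2^-1 1 (w 2^-1 / 2) (ltW h1).
- by move=> x _; exact: wc.
- by rewrite w1 (ltW v0) (ltW v1) orbT.
have a0' : 0 < a.
  rewrite lt_neqAle a0 andbT; apply/eqP => E.
  by move: v0; rewrite -Ea -E w0 ltxx.
have b1' : b < 1.
  rewrite lt_neqAle b1 andbT; apply/eqP => E.
  by move: v0; rewrite -Eb E w1 ltxx.
have ah' : a < 2^-1.
  rewrite lt_neqAle ah andbT; apply/eqP => E.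
  by move: v1; rewrite -Ea E ltxx.
have ab : a = b.
  apply: wI; last by rewrite Ea Eb.
    by rewrite a0' (le_lt_trans ah).
  by rewrite b1' (lt_le_trans h0).
by move: (lt_le_trans ah' bh); rewrite ab ltxx.
Qed.

Lemma fibre_map_inj z z' : inner HZ z -> inner HZ z' -> fibre_map z = fibre_map z' -> z = z'.
Proof.
move=> iz iz' E; have [t [t01 Et]] := embed_middle iz.
have [t' [t'01 Et']] := embed_middle iz'.
have /fI : f (sph z t) = f (sph z' t') by rewrite Et Et' E.
have t'01' : 0 <= t' <= 1 by move: t'01 => /andP[/ltW -> /ltW ->].
by move=> /(sph_inj iz t01 t'01')[].
Qed.

Lemma fibre_map_cont z : inner HZ z -> {for z, continuous fibre_map}.
Proof.
move=> iz; apply: (@cont_comp _ _ _ (fun z => f (sph z 2^-1)) (@zco R J' Z')).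
  apply: (@cont_comp (set_type Z) (sphere Z) (sphere Z') (fun z => sph z 2^-1) f); [exact: sph_contz|exact: fc].
by apply: (zco_cont (HZ := HZ')); apply: embed_neq_pole; exact: sph_neq_pole.
Qed.

(** By [embed_middle] the image of the embedding contains the middle of the
    fibre of each [fibre_map z], and it is closed. *)
Lemma fibre_map_closed w : inner HZ' w -> closure (fibre_map @` inner HZ) w ->
  (fibre_map @` inner HZ) w.
Proof.
move=> iw cw.
have [x _ xE] : (f @` setT) (sph w 2^-1).
  have cl : closed (f @` setT).
    apply: compact_closed; first exact: sphere_hausdorff.
    by apply: compact_image => //; exact: sphere_compact HZ.
  apply: cl => V wV.
  have [_ [[z iz <-] Vz]] := cw _ (@sph_contz R J' Z' 2^-1 w V wV).
  have [t [t01 Et]] := embed_middle iz.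
  exists (sph (fibre_map z) 2^-1); split; last exact: Vz.
  by exists (sph z t).
have xp : x <> pole HZ.
  move=> E; apply: (sph_neq_pole iw half01); by rewrite -xE E embed_pole.
have [z [t [iz t01 xzt]]] := sphereP xp.
exists z => //; rewrite -(embed_fibre iz t01) -xzt xE.
by have [] := zt_co_sph iw half01.
Qed.

(** Injectivity and relative closedness of the map of fibres come from the
    middles of the fibres; the rest is the theory of monotone maps. *)
Lemma sphere_embedding :
  exists phi : set_type Z -> set_type Z',
  [/\ forall z, inner HZ z -> inner HZ' (phi z),
      forall w, inner HZ' w -> exists2 z, inner HZ z & phi z = w
    & (forall x y, inner HZ x -> inner HZ y -> slt (@ptle R J Z) x y ->
         slt (@ptle R J' Z') (phi x) (phi y)) \/
      (forall x y, inner HZ x -> inner HZ y -> slt (@ptle R J Z) x y ->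
         slt (@ptle R J' Z') (phi y) (phi x))].
Proof.
exists fibre_map; split.
- exact: fibre_map_inner.
- apply: (phi_onto (al_lin HZ) (al_lin HZ') (P := inner HZ)).
  + exact: inner_convex.
  + exact: fibre_map_cont.
  + exact: fibre_map_inj.
  + exact: inner_convex.
  + exact: fibre_map_inner.
  + exact: inner_noend.
  + exact: inner_exists.
  + exact: fibre_map_closed.
- apply: (phi_monotone (al_lin HZ) (al_lin HZ')).
  + exact: inner_convex.
  + exact: fibre_map_cont.
  + exact: fibre_map_inj.
Qed.

End SphereEmbedding.

(** * An arcless continuum over a linear order *)

Record sorder (I : Type) (lt : I -> I -> Prop) : Prop := Sorder {
  so_irr : forall i, ~ lt i i;
  so_trans : forall j i k, lt i j -> lt j k -> lt i k;
  so_total : forall i j, [\/ lt i j, i = j | lt j i] }.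

Section Ladder.
Variables (R : realType) (I L : Type) (lt : I -> I -> Prop) (ev : L -> R).
Hypothesis Hlt : sorder lt.
Hypothesis evI : injective ev.
Hypothesis ev01 : forall e, 0 < ev e < 1.
Local Notation J := (I * seq L)%type.

(** v (i, [::]) runs from 0 to 1 along the i-th edge, after all earlier edges
    are completed. When v (i, s) reaches the value ev e it pauses until
    v (i, e :: s) has run from 0 to 1: the point ev e of each interval is
    replaced by an interval, and so on forever. *)
Definition ladder : set (cube J R) := [set v |
  [/\ forall j, 0 <= v j <= 1,
      forall i i', lt i i' -> v (i, [::]) = 1 \/ v (i', [::]) = 0
    & forall i s e, (ev e <= v (i, s) \/ v (i, e :: s) = 0) /\
                    (v (i, s) <= ev e \/ v (i, e :: s) = 1)]].

Local Notation ZT := (set_type ladder).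

Lemma closed_forall (T : topologicalType) (A : Type) (P : A -> set T) :
  (forall a, closed (P a)) -> closed [set v | forall a, P a v].
Proof.
move=> cP; have -> : [set v | forall a, P a v] = \bigcap_(a in setT) P a.
  by apply/seteqP; split=> v Pv a; [move=> _|]; exact: Pv.
exact: closed_bigI.
Qed.

Lemma closed_coord_eq (j : J) (a : R) : closed [set v : cube J R | v j = a].
Proof.
apply: (@preimage_closed _ _ (fun v : cube J R => v j) [set a]).
  by move=> v _; exact: cube_projC.
exact: closed_eq.
Qed.

Lemma closed_coord_le (j : J) (a : R) : closed [set v : cube J R | v j <= a].
Proof.
apply: (@preimage_closed _ _ (fun v : cube J R => v j) [set r | r <= a]).
  by move=> v _; exact: cube_projC.
exact: closed_le.
Qed.

Lemma closed_coord_ge (j : J) (a : R) : closed [set v : cube J R | a <= v j].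
Proof.
apply: (@preimage_closed _ _ (fun v : cube J R => v j) [set r | a <= r]).
  by move=> v _; exact: cube_projC.
exact: closed_ge.
Qed.

Lemma ladder_compact : compact ladder.
Proof.
apply: (@subclosed_compact _ _ [set v : cube J R | forall j, 0 <= v j <= 1]); last first.
- by move=> v [].
- exact: cube_compact.
have -> : ladder = [set v : cube J R | forall j, 0 <= v j <= 1] `&`
   ([set v | forall i i', lt i i' -> v (i, [::]) = 1 \/ v (i', [::]) = 0] `&`
    [set v | forall i s e, (ev e <= v (i, s) \/ v (i, e :: s) = 0) /\
                    (v (i, s) <= ev e \/ v (i, e :: s) = 1)]).
  by apply/seteqP; split=> v; [move=> []|move=> [? []]].
apply: closedI; last apply: closedI.
- apply: closed_forall => j.
  have -> : (fun v : cube J R => is_true (0 <= v j <= 1)) =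
      [set v | 0 <= v j] `&` [set v | v j <= 1].
    by apply/seteqP; split=> v /=; [move=> /andP[]|move=> [-> ->]].
  by apply: closedI; [exact: closed_coord_ge|exact: closed_coord_le].
- apply: closed_forall => i; apply: closed_forall => i'; apply: closed_forall => ii'.
  by apply: closedU; exact: closed_coord_eq.
- apply: closed_forall => i; apply: closed_forall => s; apply: closed_forall => e.
  apply: closedI; apply: closedU; try exact: closed_coord_eq.
    exact: closed_coord_ge.
  exact: closed_coord_le.
Qed.

Section Points.
Implicit Types v x y : cube J R.

Lemma ladder01 v j : ladder v -> 0 <= v j <= 1.
Proof. by case. Qed.

Lemma child0 v i s e : ladder v -> v (i, s) < ev e -> v (i, e :: s) = 0.
Proof. by move=> [_ _ /(_ i s e)[[le|//] _]]; rewrite ltNge le. Qed.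

Lemma child1 v i s e : ladder v -> ev e < v (i, s) -> v (i, e :: s) = 1.
Proof. by move=> [_ _ /(_ i s e)[_ [le|//]]]; rewrite ltNge le. Qed.

Lemma child_mid v i s e : ladder v -> 0 < v (i, e :: s) < 1 -> v (i, s) = ev e.
Proof.
move=> Zv /andP[c0 c1]; have [l|l|//] := ltgtP (v (i, s)) (ev e).
  by move: c0; rewrite (child0 Zv l) ltxx.
by move: c1; rewrite (child1 Zv l) ltxx.
Qed.

Lemma node_full v i s : ladder v -> v (i, [::]) = 1 -> v (i, s) = 1.
Proof.
move=> Zv v1; elim: s => [//|e s IH]; apply: child1 => //; rewrite IH.
by case/andP: (ev01 e).
Qed.

Lemma node_empty v i s : ladder v -> v (i, [::]) = 0 -> v (i, s) = 0.
Proof.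
move=> Zv v0; elim: s => [//|e s IH]; apply: child0 => //; rewrite IH.
by case/andP: (ev01 e).
Qed.

(** The node s is reached by pauses, along x as well as along y. *)
Fixpoint spine2 x y i (s : seq L) : Prop :=
  if s is e :: u then [/\ x (i, u) = ev e, y (i, u) = ev e & spine2 x y i u] else True.

Lemma spine2_mid x y i s : ladder x -> ladder y ->
  0 < x (i, s) < 1 -> 0 < y (i, s) < 1 -> spine2 x y i s.
Proof.
move=> Zx Zy; elim: s => [//|e s IH] /= xs ys.
have xE := child_mid Zx xs; have yE := child_mid Zy ys.
by split=> //; apply: IH; rewrite ?xE ?yE.
Qed.

Lemma spine2_uniq x y i s s' : spine2 x y i s -> spine2 x y i s' ->
  size s = size s' -> s = s'.
Proof.
elim: s s' => [|e s IH] [|e' s'] //= [xe _ sp] [xe' _ sp'] [sz].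
have E' := IH _ sp sp' sz; rewrite E' in xe *.
by congr (_ :: _); apply: evI; rewrite -xe -xe'.
Qed.

Lemma spine2_prefix x y i s s' : spine2 x y i s -> spine2 x y i s' ->
  (size s < size s')%N -> exists e, x (i, s) = ev e /\ y (i, s) = ev e.
Proof.
elim: s' => [//|e s' IH] sp /= [xe ye sp'].
rewrite ltnS leq_eqVlt => /orP[/eqP sz|]; last exact: IH.
by exists e; rewrite (spine2_uniq sp sp' sz).
Qed.

(** Descending from a node at which x < y: as long as the parent does not
    separate x and y, both pause there. *)
Lemma first_difference x y i s : ladder x -> ladder y -> x (i, s) < y (i, s) ->
  exists2 u, spine2 x y i u & x (i, u) < y (i, u).
Proof.
move=> Zx Zy; elim: s => [|e s IH] xy; first by exists [::].
have /andP[x0 _] := ladder01 (i, e :: s) Zx; have /andP[_ y1] := ladder01 (i, e :: s) Zy.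
have [/IH//|le] := ltP (x (i, s)) (y (i, s)).
have xs : x (i, s) <= ev e.
  by rewrite leNgt; apply/negP => /(child1 Zx) E; move: (lt_le_trans xy y1); rewrite E ltxx.
have ys : ev e <= y (i, s).
  by rewrite leNgt; apply/negP => /(child0 Zy) E; move: (le_lt_trans x0 xy); rewrite E ltxx.
have xE : x (i, s) = ev e by apply/le_anti; rewrite xs (le_trans ys).
have yE : y (i, s) = ev e by apply/le_anti; rewrite ys (le_trans le).
exists (e :: s) => //=; split=> //; apply: spine2_mid => //; first by rewrite xE.
by rewrite yE.
Qed.

Lemma root_difference x y i s : ladder x -> ladder y -> x (i, s) < y (i, s) ->
  x (i, [::]) < 1 /\ 0 < y (i, [::]).
Proof.
move=> Zx Zy xy; split; rewrite lt_neqAle.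
- have /andP[_ ->] := ladder01 (i, [::]) Zx; rewrite andbT; apply/eqP => x1.
  have /andP[_ y1] := ladder01 (i, s) Zy.
  by move: (lt_le_trans xy y1); rewrite (node_full s Zx x1) ltxx.
- have /andP[-> _] := ladder01 (i, [::]) Zy; rewrite andbT; apply/eqP => y0.
  have /andP[x0 _] := ladder01 (i, s) Zx.
  by move: (le_lt_trans x0 xy); rewrite (node_empty s Zy (esym y0)) ltxx.
Qed.

Lemma later_empty v i i' s : ladder v -> lt i i' -> v (i, [::]) < 1 -> v (i', s) = 0.
Proof.
move=> Zv ii' v1; apply: node_empty => //; have [_ /(_ i i' ii')[E|//] _] := Zv.
by move: v1; rewrite E ltxx.
Qed.

(** Comparability for the pointwise order: on one edge, the places where x and y
    differ first, in both directions, lie on the chain of common pauses and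
    would have to be the same node. *)
Lemma no_crossing x y j j' : ladder x -> ladder y -> x j < y j -> y j' < x j' -> False.
Proof.
case: j j' => [i s] [i' s'] Zx Zy xy yx.
have [xi yi] := root_difference Zx Zy xy; have [yi' xi'] := root_difference Zy Zx yx.
have [ii'|ii'|ii'] := so_total Hlt i i'.
- have /andP[y0 _] := ladder01 (i', s') Zy.
  by move: (le_lt_trans y0 yx); rewrite (later_empty s' Zx ii' xi) ltxx.
- rewrite -ii' in yx; have [u su xyu] := first_difference Zx Zy xy.
  have [u' su' yxu'] := first_difference Zy Zx yx.
  have {}su' : spine2 x y i u'.
    by elim: u' su' {yxu'} => //= e u' IH [? ? ?]; split=> //; exact: IH.
  have [l|l|sz] := ltngtP (size u) (size u').
  + by have [e [xe ye]] := spine2_prefix su su' l; move: xyu; rewrite xe ye ltxx.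
  + by have [e [xe ye]] := spine2_prefix su' su l; move: yxu'; rewrite xe ye ltxx.
  + by move: yxu'; rewrite -(spine2_uniq su su' sz) ltNge (ltW xyu).
- have /andP[x0 _] := ladder01 (i, s) Zx.
  by move: (le_lt_trans x0 xy); rewrite (later_empty s Zy ii' yi') ltxx.
Qed.

Section Node.
Variables (s : seq L) (r : R).

(** On the nodes from the root to s the value is dictated by the next node on
    the way to s, and it is r at s; at the other nodes the parent decides, and 0 is
    the value when it does not. *)
Definition node_base (u : seq L) : R :=
  if pselect (u = s) then r
  else if pselect (exists e w, s = w ++ e :: u) is left h then ev (sval (cid h)) else 0.

Fixpoint node (u : seq L) : R :=
  if u is e :: u' then
    if node u' < ev e then 0 else if ev e < node u' then 1 else node_base u
  else node_base u.

Lemma node_base01 u : 0 <= r <= 1 -> 0 <= node_base u <= 1.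
Proof.
move=> r01; rewrite /node_base; case: pselect => [n|n] //=; case: pselect => [h|nh] /=.
  by have /andP[/ltW -> /ltW ->] := ev01 (sval (cid h)).
by rewrite lexx ler01.
Qed.

Lemma node01 u : 0 <= r <= 1 -> 0 <= node u <= 1.
Proof.
move=> r01; case: u => [|e u]; first exact: node_base01.
rewrite /=; case: ifP => _; first by rewrite lexx ler01.
by case: ifP => _; [rewrite lexx ler01|exact: node_base01].
Qed.

Lemma node_spine w u : s = w ++ u -> node u = node_base u.
Proof.
elim: u w => [//|e u IH] w sE /=.
have -> : node u = ev e.
  rewrite (IH (rcons w e)) ?cat_rcons // /node_base.
  case: pselect => [uE|nu] /=.
    by have := congr1 size sE; rewrite size_cat /= -uE; lia.
  case: pselect => [h|nh] /=; last by case: nh; exists e, w.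
  have [w' sE'] := svalP (cid h); congr ev; move: sE'; rewrite {1}sE => E'.
  have sz : size w = size w' by have := congr1 size E'; rewrite !size_cat /=; lia.
  have := congr1 (drop (size w)) E'.
  by rewrite drop_size_cat // sz drop_size_cat // => -[].
by rewrite ltxx.
Qed.

Lemma node_val : node s = r.
Proof. by rewrite (@node_spine [::]) // /node_base; case: pselect. Qed.

End Node.

Definition point_at (j : J) (r : R) : cube J R := fun k =>
  if pselect (lt k.1 j.1) then 1 else if pselect (lt j.1 k.1) then 0 else node j.2 r k.2.

Lemma point_at_lt j r i s : lt i j.1 -> point_at j r (i, s) = 1.
Proof. by rewrite /point_at /=; case: pselect. Qed.

Lemma point_at_gt j r i s : lt j.1 i -> point_at j r (i, s) = 0.
Proof.
move=> ji; rewrite /point_at /=; case: pselect => [ij|nij] /=; last by case: pselect.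
by case: (so_irr Hlt (so_trans Hlt ij ji)).
Qed.

Lemma point_at_node j r s : point_at j r (j.1, s) = node j.2 r s.
Proof.
by rewrite /point_at /=; case: pselect => [h|n] //=; case: (so_irr Hlt h).
Qed.

Lemma point_at_ladder j r : 0 <= r <= 1 -> ladder (point_at j r).
Proof.
move=> r01; split.
- move=> [i s]; have [ij|->|ji] := so_total Hlt i j.1.
  + by rewrite point_at_lt // lexx ler01.
  + by rewrite point_at_node; apply: (node01 _ _ r01).
  + by rewrite point_at_gt // lexx ler01.
- move=> i i' ii'; have [ij|iE|ji] := so_total Hlt i j.1.
  + by left; rewrite point_at_lt.
  + by right; rewrite point_at_gt // -iE.
  + by right; rewrite point_at_gt //; exact: (so_trans Hlt ji).
- move=> i s e; have /andP[e0 e1] := ev01 e; have [ij|->|ji] := so_total Hlt i j.1.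
  + by rewrite !point_at_lt //; split; [left; exact: ltW|right].
  + rewrite !point_at_node /=; split.
      by case: (ltP (node j.2 r s) (ev e)) => l; [right|left].
    case: (ltP (ev e) (node j.2 r s)) => l; [right|by left].
    by rewrite ltNge (ltW l).
  + by rewrite !point_at_gt //; split; [right|left; exact: ltW].
Qed.

Lemma point_at_val j r : point_at j r j = r.
Proof. by case: j => i s; rewrite point_at_node node_val. Qed.

End Points.

Definition zpoint (j : J) (r : R) : ZT :=
  SigSub (mem_set (point_at_ladder j (clamp_in r (ler01 : (0 : R) <= (1 : R))))).

Lemma zpoint_val j r : 0 <= r <= 1 -> set_val (zpoint j r) j = r.
Proof.
move=> r01; have -> : set_val (zpoint j r) j = point_at j (clamp 0 1 r) j by [].
by rewrite point_at_val clamp_id.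
Qed.

Lemma zladder (z : ZT) : ladder (set_val z).
Proof. exact: set_valP. Qed.

Lemma z01 (z : ZT) j : 0 <= set_val z j <= 1.
Proof. exact/ladder01/zladder. Qed.

Lemma not_ptle (x y : ZT) : ~ ptle x y -> exists j, set_val y j < set_val x j.
Proof.
move=> nxy; apply: contrapT => no; apply: nxy => j; rewrite leNgt; apply/negP => l.
by apply: no; exists j.
Qed.

Lemma coord_slt (x y : ZT) j : set_val x j < set_val y j -> slt (@ptle R J ladder) x y.
Proof.
move=> xy; split.
  apply: contrapT => /not_ptle[j' yx]; exact: (no_crossing (zladder x) (zladder y) xy yx).
by move=> xE; move: xy; rewrite xE ltxx.
Qed.

Lemma slt_coord (x y : ZT) : slt (@ptle R J ladder) x y -> exists j, set_val x j < set_val y j.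
Proof.
move=> [xy nE]; apply: not_ptle => yx; apply: nE; apply: val_inj; apply/funext => j.
by apply/le_anti/andP; split; [exact: xy|exact: yx].
Qed.

Lemma zpoint_between (x y : ZT) j r : set_val x j < r -> r < set_val y j ->
  slt (@ptle R J ladder) x (zpoint j r) /\ slt (@ptle R J ladder) (zpoint j r) y.
Proof.
move=> xr ry; have /andP[x0 _] := z01 x j; have /andP[_ y1] := z01 y j.
have r01 : 0 <= r <= 1 by rewrite (le_trans x0 (ltW xr)) (le_trans (ltW ry) y1).
by split; apply: (@coord_slt _ _ j); rewrite zpoint_val.
Qed.

Lemma ladder_lincont : lincont (@ptle R J ladder).
Proof.
have valc j : continuous (fun z : ZT => set_val z j).
  move=> x; apply: (@cont_comp _ _ _ set_val (fun w : cube J R => w j)).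
    exact: val_cont.
  exact: cube_projC.
split.
- by move=> x j.
- by move=> y x z xy yz j; exact: le_trans (xy j) (yz j).
- move=> x y xy yx; apply: val_inj; apply/funext => j.
  by apply/le_anti/andP; split; [exact: xy|exact: yx].
- move=> x y; have [xy|/not_ptle[j /coord_slt[yx _]]] := pselect (ptle x y); first by left.
  by right.
- move=> x; apply: (@closed_forall _ J (fun j => [set y : ZT | set_val x j <= set_val y j])) => j.
  apply: (@preimage_closed _ _ (fun z : ZT => set_val z j) [set r | set_val x j <= r]).
    by move=> v _; exact: valc.
  exact: closed_ge.
- move=> x; apply: (@closed_forall _ J (fun j => [set y : ZT | set_val y j <= set_val x j])) => j.
  apply: (@preimage_closed _ _ (fun z : ZT => set_val z j) [set r | r <= set_val x j]).
    by move=> v _; exact: valc.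
  exact: closed_le.
- exact/sub_compact/ladder_compact.
- move=> x y xy nE; have [j xyj] := slt_coord (conj xy nE).
  have [h1 h2] := midf_lt xyj; have [[h3 h4] [h5 h6]] := @zpoint_between x y j _ h1 h2.

  exists (zpoint j ((set_val x j + set_val y j) / 2)); split=> //.
  by move=> xE; apply: h4.
Qed.

(** The point at which the edges in D are completed and no other one is begun. *)
Definition cut_fun (D : set I) : cube J R := fun k => if pselect (D k.1) then 1 else 0.

Definition initial (D : set I) := forall i i', lt i' i -> D i -> D i'.

Lemma cut_ladder D : initial D -> ladder (cut_fun D).
Proof.
move=> iD; split.
- by move=> k; rewrite /cut_fun; case: pselect => ? /=; rewrite lexx ler01.
- move=> i i' ii'; rewrite /cut_fun /=; case: pselect => [?|nD] /=; first by left.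
  by case: pselect => [h|h] /=; [case: nD; exact: iD ii' h|right].
- move=> i s e; rewrite /cut_fun /=; have /andP[/ltW e0 /ltW e1] := ev01 e.
  by case: pselect => ? /=; split; [left|right|right|left].
Qed.

Definition cut (D : set I) (iD : initial D) : ZT := SigSub (mem_set (cut_ladder iD)).

Lemma cut_in D (iD : initial D) i s : D i -> set_val (cut iD) (i, s) = 1.
Proof.
move=> Di; have -> : set_val (cut iD) (i, s) = cut_fun D (i, s) by [].
by rewrite /cut_fun; case: pselect.
Qed.

Lemma cut_out D (iD : initial D) i s : ~ D i -> set_val (cut iD) (i, s) = 0.
Proof.
move=> Di; have -> : set_val (cut iD) (i, s) = cut_fun D (i, s) by [].
by rewrite /cut_fun; case: pselect.
Qed.

Hypothesis evU : forall p q, 0 <= p -> p < q -> q <= 1 -> ~ countable [set e | p < ev e < q].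

(** Along a path on which a coordinate is not constant, uncountably many of its
    children would run through (0, 1), on disjoint open sets of times. *)
Lemma ladder_no_arc (g : R -> ZT) s t : continuous g -> g s = g t.
Proof.
move=> gc.
have cc j u : {for u, continuous (fun t => set_val (g t) j)}.
  apply: (@cont_comp _ _ _ (fun t => set_val (g t)) (fun w : cube J R => w j)).
    by apply: (@cont_comp _ _ _ g set_val); [exact: gc|exact: val_cont].
  exact: cube_projC.
have key a b i u : set_val (g a) (i, u) < set_val (g b) (i, u) -> False.
  move=> ab; have /andP[a0 _] := z01 (g a) (i, u); have /andP[_ b1] := z01 (g b) (i, u).
  apply: (evU a0 ab b1).
  pose B e : set R := if set_val (g a) (i, u) < ev e < set_val (g b) (i, u)
    then (fun t => set_val (g t) (i, e :: u)) @^-1` `]0, 1[%classic else setT.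
  apply: (@separated_open_countable R L B).
  - move=> e; rewrite /B; case: ifP => _; last exact: openT.
    apply: open_comp; last exact: itv_open.
    by move=> t' _; exact: cc.
  - move=> e; rewrite /B; case: ifP => [/andP[ae eb]|_]; last by exists 0.
    have va := child0 (zladder (g a)) ae; have vb := child1 (zladder (g b)) eb.
    have h : (0 : R) < (2^-1 : R) < (1 : R) by apply/andP; split; lra.
    move: h => /andP[h0 h1].
    have [ab'|/ltW ba'] := leP a b.
      have [||c _ E'] := @ivt R (fun t => set_val (g t) (i, e :: u)) a b 2^-1 ab'.
      + by move=> x _; exact: cc.
      + by rewrite va vb (ltW h0) (ltW h1).
      by exists c; rewrite /= E' in_itv /= h0 h1.
    have [||c _ E'] := @ivt R (fun t => set_val (g t) (i, e :: u)) b a 2^-1 ba'.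
    + by move=> x _; exact: cc.
    + by rewrite va vb (ltW h0) (ltW h1) orbT.
    by exists c; rewrite /= E' in_itv /= h0 h1.
  - move=> e e' /= De De' [t' []]; rewrite /B De De' /= !in_itv /= => h h'; apply: evI.
    by rewrite -(child_mid (zladder (g t')) h) (child_mid (zladder (g t')) h').
apply: val_inj; apply/funext => -[i u].
by have [/key|/key|//] := ltgtP (set_val (g s) (i, u)) (set_val (g t) (i, u)).
Qed.


Hypothesis I0 : exists i : I, True.

Lemma initial0 : initial set0. Proof. by []. Qed.
Lemma initialT : initial setT. Proof. by []. Qed.

Lemma ladder_arcless : arcless ladder.
Proof.
split.
- by move=> v j /ladder01.
- exact: ladder_lincont.
- have -> : (fun=> 0) = cut_fun set0; last exact: cut_ladder initial0.
  by apply/funext => k; rewrite /cut_fun; case: pselect.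
- have -> : (fun=> 1) = cut_fun setT; last exact: cut_ladder initialT.
  by apply/funext => k; rewrite /cut_fun; case: pselect => // -[].
- by have [i _] := I0; exists (i, [::]).
- exact: ladder_no_arc.
Qed.

End Ladder.

(** * One-sided characters of the points of a ladder *)

(** Countable character of P at z from the right, an invariant of the order; the
    left side is obtained by reversing the relation. *)
Definition small_right (T : Type) (le : T -> T -> Prop) (P : set T) (z : T) :=
  exists S : set T, [/\ countable S, forall y, S y -> P y /\ slt le z y
    & forall x, P x -> slt le z x -> exists2 y, S y & le y x].

Definition small_end (T : Type) (le : T -> T -> Prop) (P : set T) :=
  exists S : set T, [/\ countable S, S `<=` P & forall x, P x -> exists2 y, S y & le y x].

Definition countably_coinitial (I : Type) (lt : I -> I -> Prop) (B : set I) :=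
  exists A : set I, [/\ countable A, A `<=` B
    & forall i, B i -> exists2 a, A a & a = i \/ lt a i].

Section Sides.
Variables (R : realType) (I L : Type) (lt : I -> I -> Prop) (ev : L -> R).
Hypothesis Hlt : sorder lt.
Hypothesis evI : injective ev.
Hypothesis ev01 : forall e, 0 < ev e < 1.
Hypothesis evU : forall p q, 0 <= p -> p < q -> q <= 1 -> ~ countable [set e | p < ev e < q].
Hypothesis I0 : exists i : I, True.
Local Notation J := (I * seq L)%type.
Local Notation Z := (ladder lt ev).
Local Notation ZT := (set_type Z).
Local Notation zle := (@ptle R J Z).
Local Notation zlt := (slt zle).
Let HZ : arcless Z := ladder_arcless Hlt evI ev01 evU I0.
Let HL := ladder_lincont Hlt evI ev01.
Local Notation P := (inner HZ).
Local Notation zp := (zpoint Hlt ev01).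

Lemma zbot_cut0 : zbot HZ = cut ev01 (@initial0 I lt).
Proof.
apply: zT_eq => -[i s].
have E : set_val (cut ev01 (@initial0 I lt)) (i, s) = 0 by rewrite cut_out.
exact: esym E.
Qed.

Lemma ztop_cutT : ztop HZ = cut ev01 (@initialT I lt).
Proof.
apply: zT_eq => -[i s].
have E : set_val (cut ev01 (@initialT I lt)) (i, s) = 1 by rewrite cut_in.
exact: esym E.
Qed.

Lemma inner_mid x y z : zlt x y -> zlt y z -> P y.
Proof.
move=> xy yz; apply/innerP; split.
  by apply: (le_lt_trans_lc HL _ xy); exact: zbot_le.
by apply: (lt_le_trans_lc HL yz); exact: ztop_ge.
Qed.

(** A countable supply of intermediate points for the coordinates in C. *)
Definition rat_points (C : set J) : set ZT :=
  [set y | exists j q, C j /\ y = zp j (ratr q)].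

Lemma rat_points_countable C : countable C -> countable (rat_points C).
Proof.
move=> cC.
have cX : countable (C `*` [set: rat]) by apply: countableX => //; exact: countableP.
have cI : countable ((fun jq : J * rat => zp jq.1 (ratr jq.2)) @` (C `*` setT)).
  by apply: sub_countable cX; exact: card_image_le.
apply: sub_countable cI; apply: subset_card_le => _ [j [q [Cj ->]]].
by exists (j, q).
Qed.

Lemma rat_points_between C j x y : C j -> set_val x j < set_val y j ->
  exists2 z, rat_points C z & zlt x z /\ zlt z y.
Proof.
move=> Cj /rat_in_itvoo[q]; rewrite in_itv /= => /andP[xq qy].
exists (zp j (ratr q)); first by exists j, q.
exact: zpoint_between.
Qed.

Lemma small_right_coords z (C : set J) : countable C ->
  (forall y, zlt z y -> exists2 j, C j & set_val z j < set_val y j) ->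
  small_right zle P z.
Proof.
move=> cC Csep; exists (rat_points C `&` [set y | P y /\ zlt z y]); split.
- apply: sub_countable (rat_points_countable cC).
  by apply: subset_card_le => y [].
- by move=> y [].
- move=> x Px zx; have [j Cj zxj] := Csep x zx.
  have [y Cy [zy yx]] := rat_points_between Cj zxj.
  exists y; last by case: yx.
  by split=> //; split=> //; exact: inner_mid zy yx.
Qed.

Lemma small_left_coords z (C : set J) : countable C ->
  (forall y, zlt y z -> exists2 j, C j & set_val y j < set_val z j) ->
  small_right (flip_rel zle) P z.
Proof.
move=> cC Csep; exists (rat_points C `&` [set y | P y /\ zlt y z]); split.
- apply: sub_countable (rat_points_countable cC).
  by apply: subset_card_le => y [].
- by move=> y [_ [Py [yz nE]]]; split=> //; split=> // E; apply: nE.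
- move=> x Px [xz nE]; have xz' : zlt x z by split=> // E; apply: nE.
  have [j Cj zxj] := Csep x xz'.
  have [y Cy [xy yz]] := rat_points_between Cj zxj.
  exists y; last by case: xy.
  by split=> //; split=> //; exact: inner_mid xy yz.
Qed.

(** A point on the edge i is determined by its values at the root and at the
    nodes reached through pauses: the other nodes follow their parents, and the
    other edges are completed or not begun. *)
Lemma agree_edge x y i : Z x -> Z y -> x (i, [::]) < 1 ->
  (forall i', lt i' i -> x (i', [::]) = 1) -> (forall i', lt i' i -> y (i', [::]) = 1) ->
  (forall s, spine2 ev x x i s -> y (i, s) = x (i, s)) -> forall j, y j = x j.
Proof.
move=> Zx Zy x1 bx by_ sp.
have yx s : y (i, s) = x (i, s).
  elim: s => [|e s IH]; first exact: sp.
  have [l|l|E] := ltgtP (x (i, s)) (ev e).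
  - by rewrite (child0 Zx l) (child0 Zy) // IH.
  - by rewrite (child1 Zx l) (child1 Zy) // IH.
  - apply: sp => /=; split=> //; by apply: (spine2_mid ev01 Zx Zx); rewrite E; exact: ev01.
move=> [i' s]; have [l|->|l] := so_total Hlt i' i; last 2 first.
- exact: yx.
- by rewrite (later_empty ev01 s Zx l x1) (later_empty ev01 s Zy l) // yx.
- by rewrite (node_full ev01 s Zx (bx _ l)) (node_full ev01 s Zy (by_ _ l)).
Qed.

Lemma spine_countable (x : cube J R) i : countable [set k : J | k.1 = i /\ spine2 ev x x i k.2].
Proof.
apply/countable_injP; exists (fun k => size k.2) => -[a s] [b t].
rewrite !inE /= => -[-> sp] [-> sp'] sz.
by rewrite (spine2_uniq evI sp sp' sz).
Qed.

Definition on_edge (z : ZT) i :=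
  set_val z (i, [::]) < 1 /\ forall i', lt i' i -> set_val z (i', [::]) = 1.

(** The nodes at which a point of an edge pauses form a single chain, hence are
    countably many, and they detect every larger point. *)
Lemma small_right_edge z i : on_edge z i -> small_right zle P z.
Proof.
move=> [z1 zb]; apply: (small_right_coords (spine_countable (set_val z) i)) => y zy.
apply: contrapT => no; case: zy => zy; apply; apply: zT_eq => j; apply/esym.
apply: (agree_edge (zladder z) (zladder y) z1 zb).
  move=> i' l; apply/eqP; rewrite eq_le; have /andP[_ ->] := z01 y (i', [::]).
  by rewrite -(zb _ l); exact: zy.
move=> s sp; apply/le_anti; rewrite (zy (i, s)) andbT leNgt; apply/negP => l.
by apply: no; exists (i, s).
Qed.

(** If no edge is being traversed, or is about to be, the point is the cut
    between the completed edges and the others. *)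
Lemma off_edge_cut z : (forall i, ~ on_edge z i) ->
  exists D (iD : initial lt D), z = cut ev01 iD /\
    forall i, ~ D i -> exists2 i', ~ D i' & lt i' i.
Proof.
move=> no; pose D := [set i | set_val z (i, [::]) = 1].
have zlt1 i : ~ D i -> set_val z (i, [::]) < 1.
  by move=> nD; have /andP[_ z1] := z01 z (i, [::]); rewrite lt_neqAle z1 andbT; apply/eqP.
have nle i : ~ D i -> exists2 i', ~ D i' & lt i' i.
  move=> nD; apply: contrapT => no'; apply: (no i); split; first exact: zlt1.
  by move=> i' l; apply: contrapT => nD'; apply: no'; exists i'.
have iD : initial lt D.
  move=> i i' l Di; apply: contrapT => nD'.
  have := later_empty ev01 [::] (zladder z) l (zlt1 _ nD').
  by rewrite Di => /eqP; rewrite oner_eq0.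
exists D, iD; split=> //; apply: zT_eq => -[i s].
have [Di|nDi] := pselect (D i).
  by rewrite cut_in // (node_full ev01 s (zladder z) Di).
rewrite cut_out //; have [i' nD' l] := nle i nDi.
exact: (later_empty ev01 s (zladder z) l (zlt1 _ nD')).
Qed.

Lemma cut_lt D D' (iD : initial lt D) (iD' : initial lt D') i : ~ D i -> D' i ->
  zlt (cut ev01 iD) (cut ev01 iD').
Proof.
move=> nD D'i; apply: (coord_slt Hlt evI ev01 (j := (i, [::]))).
by rewrite cut_out // cut_in.
Qed.

Lemma initial_lt i : initial lt [set k | lt k i].
Proof. by move=> a b ba /= ai; exact: (so_trans Hlt ba). Qed.

Lemma initial_le i : initial lt [set k | k = i \/ lt k i].
Proof. by move=> a b ba /= [<-|ai]; right=> //; exact: (so_trans Hlt ba). Qed.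

(** Just after the cut D, the points at which the edge i is begun are coinitial
    when i runs through a coinitial set of the complement of D. *)
Lemma small_right_cutP D (iD : initial lt D) :
  small_right zle P (cut ev01 iD) <-> countably_coinitial lt (~` D).
Proof.
split=> [[S [cS SP Sco]]|[A [cA AD Aco]]]; last first.
  apply: (@small_right_coords _ ((fun a => (a, [::])) @` A)).
    by apply: sub_countable cA; exact: card_image_le.
  move=> y /slt_coord[[i s] zy].
  have [Di|nDi] := pselect (D i).
    have /andP[_ y1] := z01 y (i, s).
    by move: (lt_le_trans zy y1); rewrite cut_in // ltxx.
  have [_ y0] := root_difference ev01 (zladder _) (zladder y) zy.
  have [a Aa ai] := Aco i nDi; exists (a, [::]); first by exists a.
  rewrite cut_out; last exact: AD.
  case: ai => [->//|ai]; have [_ /(_ a i ai)[->//|E] _] := zladder y.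
  by move: y0; rewrite E ltxx.
have [[i0 [nD0 min0]]|nomin] := pselect (exists i0, ~ D i0 /\ forall i, ~ D i -> i0 = i \/ lt i0 i).
  exists [set i0]; split; [exact: countable1|by move=> _ ->|].
  by move=> i /min0 ?; exists i0.
have ch y : exists i, S y -> ~ D i /\ 0 < set_val y (i, [::]).
  have [Sy|nSy] := pselect (S y); last by have [i _] := I0; exists i.
  have [_ /slt_coord[[i s] zy]] := SP y Sy.
  exists i => _; have [_ y0] := root_difference ev01 (zladder _) (zladder y) zy; split=> // Di.
  have /andP[_ y1] := z01 y (i, s).
  by move: (lt_le_trans zy y1); rewrite cut_in // ltxx.
pose c y := sval (cid (ch y)).
exists (c @` S); split.
- by apply: sub_countable cS; exact: card_image_le.
- by move=> _ [y Sy <-]; have [] := svalP (cid (ch y)) Sy.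
move=> i nDi; have [i' nD' l] : exists2 i', ~ D i' & lt i' i.
  apply: contrapT => no; apply: nomin; exists i; split=> // k nDk.
  have [ik|->|ki] := so_total Hlt i k; [by right|by left|].
  by exfalso; apply: no; exists k.
have zp_ : zlt (cut ev01 iD) (cut ev01 (initial_lt (i := i))) by exact: (cut_lt _ _ nD').
have pt : zlt (cut ev01 (initial_lt (i := i))) (cut ev01 (@initialT I lt)).
  by apply: (@cut_lt _ _ _ _ i) => //; exact: so_irr.
have [y Sy yp] := Sco _ (inner_mid zp_ pt) zp_.
exists (c y); first by exists y.
right; have [_ y0] := svalP (cid (ch y)) Sy.
apply: contrapT => nl; move: (lt_le_trans y0 (yp (c y, [::]))).
by rewrite cut_out // ltxx.
Qed.

Lemma small_left_cutP D (iD : initial lt D) :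
  small_right (flip_rel zle) P (cut ev01 iD) <-> countably_coinitial (flip_rel lt) D.
Proof.
split=> [[S [cS SP Sco]]|[A [cA AD Aco]]]; last first.
  apply: (@small_left_coords _ ((fun a => (a, [::])) @` A)).
    by apply: sub_countable cA; exact: card_image_le.
  move=> y /slt_coord[[i s] yz].
  have [Di|nDi] := pselect (D i); last first.
    have /andP[y0 _] := z01 y (i, s).
    by move: (le_lt_trans y0 yz); rewrite cut_out // ltxx.
  have [y1 _] := root_difference ev01 (zladder y) (zladder _) yz.
  have [a Aa ai] := Aco i Di; exists (a, [::]); first by exists a.
  rewrite cut_in; last exact: AD.
  case: ai => [->//|ia]; rewrite (later_empty ev01 [::] (zladder y) ia y1).
  exact: ltr01.
have [[i0 [D0 max0]]|nomax] := pselect (exists i0, D i0 /\ forall i, D i -> i0 = i \/ lt i i0).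
  exists [set i0]; split; [exact: countable1|by move=> _ ->|].
  by move=> i /max0 ?; exists i0.
have ch y : exists i, S y -> D i /\ set_val y (i, [::]) < 1.
  have [Sy|nSy] := pselect (S y); last by have [i _] := I0; exists i.
  have [_ [yz nE]] := SP y Sy.
  have /slt_coord[[i s] yzi] : zlt y (cut ev01 iD) by split=> // E; apply: nE.
  exists i => _; have [y1 _] := root_difference ev01 (zladder y) (zladder _) yzi; split=> //.
  apply: contrapT => nDi; have /andP[y0 _] := z01 y (i, s).
  by move: (le_lt_trans y0 yzi); rewrite cut_out // ltxx.
pose c y := sval (cid (ch y)).
exists (c @` S); split.
- by apply: sub_countable cS; exact: card_image_le.
- by move=> _ [y Sy <-]; have [] := svalP (cid (ch y)) Sy.
move=> i Di; have [i' D' l] : exists2 i', D i' & lt i i'.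
  apply: contrapT => no; apply: nomax; exists i; split=> // k Dk.
  have [ik|->|ki] := so_total Hlt i k; [|by left|by right].
  by exfalso; apply: no; exists k.
have pz : zlt (cut ev01 (initial_le (i := i))) (cut ev01 iD).
  apply: (@cut_lt _ _ _ _ i') => // -[E|l']; apply: (so_irr Hlt (i := i)).
    by move: l; rewrite E.
  exact: (so_trans Hlt l l').
have bp : zlt (cut ev01 (@initial0 I lt)) (cut ev01 (initial_le (i := i))).
  by apply: (@cut_lt _ _ _ _ i) => //; left.
have pz' : slt (flip_rel zle) (cut ev01 iD) (cut ev01 (initial_le (i := i))).
  by case: pz => ? nE; split=> // E; apply: nE.
have [y Sy py] := Sco _ (inner_mid bp pz) pz'.
exists (c y); first by exists y.
right; have [_ y1] := svalP (cid (ch y)) Sy.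
have nle : ~ (c y = i \/ lt (c y) i).
  move=> h; have := py (c y, [::]); rewrite cut_in // => /(lt_le_trans y1).
  by rewrite ltxx.
by have [//|E|l'] := so_total Hlt i (c y); exfalso; apply: nle; [left|right].
Qed.

Lemma small_end_left : countably_coinitial lt [set: I] -> small_end zle P.
Proof.
move=> cI; have : small_right zle P (cut ev01 (@initial0 I lt)).
  by apply/small_right_cutP; rewrite setC0.
rewrite -zbot_cut0 => -[S [cS SP Sco]]; exists S; split=> // [y /SP[]//|x Px].
by apply: Sco => //; have [] := (innerP HZ x).1 Px.
Qed.

Lemma small_end_right : small_end (flip_rel zle) P ->
  countably_coinitial (flip_rel lt) [set: I].
Proof.
move=> [S [cS SP Sco]]; apply/(small_left_cutP (@initialT I lt)).
rewrite -ztop_cutT; exists S; split=> // [y Sy|x Px _]; last exact: Sco.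
split; first exact: SP.
by have [_ [? nE]] := (innerP HZ y).1 (SP _ Sy); split=> // E; apply: nE.
Qed.

Lemma large_right_cut z : P z -> ~ small_right zle P z ->
  exists D (iD : initial lt D), z = cut ev01 iD /\ ~ countably_coinitial lt (~` D).
Proof.
move=> Pz ns; have [D [iD [zE _]]] : exists D (iD : initial lt D), z = cut ev01 iD /\
    forall i, ~ D i -> exists2 i', ~ D i' & lt i' i.
  by apply: off_edge_cut => i /small_right_edge.
by exists D, iD; split=> //; apply/(small_right_cutP iD); rewrite -zE.
Qed.

(** A point on an edge is determined by the edge and by the values at the nodes
    of its chain of pauses, one for each depth; the other points are cuts. *)
Lemma ladder_emb (M : Type) : emb nat M -> emb I M -> emb (nat -> R) M ->
  emb {D : set I | initial lt D /\ forall i, ~ D i -> exists2 i', ~ D i' & lt i' i} M ->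
  emb ZT M.
Proof.
move=> nM IM RM; set C := (X in emb X M) => DM.
apply: (emb_trans (B := (I * (nat -> R) + C)%type)); last first.
  by apply: emb_sum => //; exact: emb_prod_in.
(* The value at the node of depth n of the chain of pauses of z. *)
pose read (z : ZT) i (n : nat) : R :=
  if pselect (exists s, spine2 ev (set_val z) (set_val z) i s /\ size s = n) is left h
  then set_val z (i, sval (cid h)) else 0.
have readE z i s : spine2 ev (set_val z) (set_val z) i s -> read z i (size s) = set_val z (i, s).
  move=> sp; rewrite /read; case: pselect => [h|nh] /=; last by case: nh; exists s.
  have [sp' sz] := svalP (cid h).
  by rewrite (spine2_uniq evI sp' sp sz).
have cutC z : (forall i, ~ on_edge z i) -> exists c : C, exists iD : initial lt (sval c),
    z = cut ev01 iD.
  move=> /off_edge_cut[D [iD [zE h]]].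
  by exists (exist _ D (conj iD h)), iD.
exists (fun z => match pselect (exists i, on_edge z i) with
  | left h => inl (sval (cid h), read z (sval (cid h)))
  | right h => inr (sval (cid (cutC z (fun i e => h (ex_intro _ i e)))))
  end) => x y.
case: pselect => hx; case: pselect => hy // [].
- have [x1 xb] := svalP (cid hx); have [y1 yb] := svalP (cid hy).
  move: x1 xb y1 yb; set i := sval (cid hx); set i' := sval (cid hy).
  move=> x1 xb + + E; rewrite -{}E => y1 yb rE.
  apply: zT_eq; apply: (agree_edge (zladder y) (zladder x) y1 yb xb) => s sp.
  suff : spine2 ev (set_val x) (set_val x) i s by move=> /readE <-; rewrite rE readE.
  elim: s sp => [//|e s IH] /= [ye _ sp].
  have sx := IH sp; suff xe : set_val x (i, s) = ev e by split.
  by rewrite -(readE _ _ _ sx) rE readE.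
- set hx' := cutC x _; set hy' := cutC y _ => E.
  have [iD ->] := svalP (cid hx'); have [iD' ->] := svalP (cid hy').
  apply: zT_eq => -[i s]; move: E iD iD' => -> iD iD'.
  have [Di|nDi] := pselect (sval (sval (cid hy')) i); first by rewrite !cut_in.
  by rewrite !cut_out.
Qed.

End Sides.

(** * Coding bits into a linear order *)

Lemma countable_inj (T U : Type) (f : T -> U) (A : set T) (B : set U) :
  (forall x, A x -> B (f x)) -> (forall x y, A x -> A y -> f x = f y -> x = y) ->
  countable B -> countable A.
Proof.
move=> AB fI; apply: sub_countable.
have /card_eqPle[_ h] : f @` A #= A by apply: inj_card_eq => x y /set_mem Ax /set_mem Ay; exact: fI.
by apply: card_le_trans h _; apply: subset_card_le => _ [x Ax <-]; exact: AB.
Qed.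

Record wellorder (K : Type) (lt : K -> K -> Prop) : Prop := Wellorder {
  wo_sorder : sorder lt;
  wo_min : forall A : set K, A !=set0 -> exists2 m, A m & forall x, A x -> m = x \/ lt m x }.

Lemma wellorder_exists (K : Type) : exists lt : K -> K -> Prop, wellorder lt.
Proof.
have [r wr] := wochoice.well_ordering_principle {classic K}.
pose In (A : set K) : {pred {classic K}} := fun x => `[< A x >].
have InP (A : set K) x : x \in In A <-> A x by split => /asboolP.
have uniq_min (A : set K) : A !=set0 -> exists m, [/\ A m, forall x, A x -> r m x
    & forall y, A y -> (forall x, A x -> r y x) -> m = y].
  move=> [a Aa]; have [|m [[/InP Am lm] um]] := wr (In A); first by exists a; apply/InP.
  exists m; split=> // [x Ax|y Ay ly]; first by apply: lm; apply/InP.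
  by apply: um; split; [apply/InP|move=> x /InP; exact: ly].
have min (A : set K) : A !=set0 -> exists2 m, A m & forall x, A x -> r m x.
  by move=> /uniq_min[m [Am lm _]]; exists m.
have refl x : r x x by have [|m -> h] := min [set x]; [exists x|exact: h].
have tot x y : r x y \/ r y x.
  have [|m [->|->] h] := min [set x; y]; first by exists x; left.
    by left; apply: h; right.
  by right; apply: h; left.
have anti x y : r x y -> r y x -> x = y.
  move=> xy yx; have [|m [_ _ um]] := uniq_min [set x; y]; first by exists x; left.
  rewrite -(um x); [apply: um|by left|by move=> z [->|->]].
    by right.
  by move=> z [->|->].
have trans y x z : r x y -> r y z -> r x z.
  move=> xy yz; have [|m mA h] := min [set t | t = x \/ t = y \/ t = z].
    by exists x; left.
  have hx : r m x by apply: h; left.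
  have hy : r m y by apply: h; right; left.
  have hz : r m z by apply: h; right; right.
  case: mA => [mE|[mE|mE]]; subst m => //.
  - by rewrite (anti _ _ xy hx).
  - have yE := anti _ _ yz hy; rewrite yE in xy; exact: xy.
exists (fun x y => r x y /\ x <> y); split; first split.
- by move=> x [].
- move=> y x z [xy nxy] [yz nyz]; split; first exact: trans yz.
  by move=> xz; apply: nxy; apply: anti => //; rewrite xz.
- move=> x y; have [<-|nE] := pselect (x = y); first by constructor 2.
  have [xy|yx] := tot x y; [by constructor 1|by constructor 3; split=> // E; apply: nE].
- move=> A /min[m Am h]; exists m => // x Ax.
  have [->|nE] := pselect (m = x); [by left|by right; split=> //; exact: h].
Qed.

(** At the least point k moved by g, either g k < k, which g fixes, or k has a
    preimage on the wrong side. *)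
Lemma wellorder_rigid (K : Type) (lt : K -> K -> Prop) (g : K -> K) : wellorder lt ->
  (forall x y, lt x y -> lt (g x) (g y)) -> (forall y, exists x, g x = y) ->
  forall x, g x = x.
Proof.
move=> wo mono surj x; apply: contrapT => nx.
have H := wo_sorder wo.
have [|k nk min] := wo_min wo (A := [set k | g k <> k]); first by exists x.
have below j : lt j k -> g j = j.
  move=> jk; apply: contrapT => /min[E|kj]; first by move: jk; rewrite E; exact: so_irr H _.
  exact: (so_irr H (so_trans H kj jk)).
have [l|//|l] := so_total H (g k) k.
- by have := mono _ _ l; rewrite below //; exact: so_irr H _.
- have [j jE] := surj k; have [jk|E|kj] := so_total H j k.
  + by have := below _ jk; rewrite jE => E; move: jk; rewrite -E; exact: so_irr H _.
  + by apply: nk; rewrite -[in LHS]E jE.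
  + by have := mono _ _ kj; rewrite jE => kk; exact: (so_irr H (so_trans H kk l)).
Qed.

Section Code.
Variables (K : Type) (klt : K -> K -> Prop).
Hypothesis wo : wellorder klt.
Hypothesis Kunc : ~ countable [set: K].
Let HK := wo_sorder wo.

(** The first uncountable ordinal, as an initial segment of K. *)
Definition omega1 := {k : K | countable [set x | klt x k]}.
Definition wlt (v w : omega1) := klt (sval v) (sval w).

Lemma omega1_eq (v w : omega1) : sval v = sval w -> v = w.
Proof. by case: v w => [x p] [y q] /= E; apply: eq_exist. Qed.

Lemma omega1_wellorder : wellorder wlt.
Proof.
split; first split.
- by move=> w; exact: (so_irr HK (i := _)).
- by move=> v u w; exact: (so_trans HK).
- move=> v w; have [l|E|l] := so_total HK (sval v) (sval w).
  + by constructor 1.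
  + by constructor 2; exact: omega1_eq.
  + by constructor 3.
- move=> A [a Aa]; have [|m [w Aw <-] min] := wo_min wo (A := sval @` A).
    by exists (sval a), a.
  exists w => // x Ax; have [|E|l] := min (sval x); first by exists x.
    by left; exact: omega1_eq.
  by right.
Qed.
Let HW := wo_sorder omega1_wellorder.

Lemma omega1_uncountable : ~ countable [set: omega1].
Proof.
move=> cW.
have cS : countable [set k | countable [set x | klt x k]].
  have -> : [set k | countable [set x | klt x k]] = sval @` [set: omega1].
    by apply/seteqP; split=> [k ck|_ [w _ <-]]; [exists (exist _ k ck)|exact: (svalP w)].
  by apply: sub_countable cW; exact: card_image_le.
have [all|/existsNP[k nk]] := pselect (forall k, countable [set x | klt x k]).
  by apply: Kunc; apply: sub_countable cS; apply: subset_card_le => x _; exact: all.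
have [|m nm min] := wo_min wo (A := [set k | ~ countable [set x | klt x k]]).
  by exists k.
apply: nm; apply: sub_countable cS; apply: subset_card_le => x /= xm.
apply: contrapT => /min[E|mx]; first by move: xm; rewrite E; exact: so_irr HK _.
exact: (so_irr HK (so_trans HK mx xm)).
Qed.

Lemma omega1_below (w : omega1) : countable [set v | wlt v w].
Proof.
by apply: (countable_inj (f := sval)) (svalP w) => [v //|u v _ _ /omega1_eq].
Qed.

(** Regularity of the first uncountable ordinal. *)
Lemma omega1_bounded (A : set omega1) : countable A -> exists w, forall a, A a -> wlt a w.
Proof.
move=> cA; apply: contrapT => no; apply: omega1_uncountable.
have : countable (\bigcup_(a in A) ([set v | wlt v a] `|` [set a])).
  apply: bigcup_countable => // a _; rewrite -bigcup2E; apply: bigcup_countable => //.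
  by case=> [|[|n]] _ //=; exact: omega1_below.
apply: sub_countable; apply: subset_card_le => w _.
apply: contrapT => nw; apply: no; exists w => a Aa.
have [//|E|l] := so_total HW a w; exfalso; apply: nw; exists a => //.
- by right; rewrite E.
- by left.
Qed.

Lemma omega1_inh : exists w : omega1, True.
Proof.
apply: contrapT => no; apply: omega1_uncountable.
by rewrite (_ : [set: omega1] = set0) //; apply/seteqP; split=> // w _; apply: no; exists w.
Qed.

Lemma omega1_least : exists omega1_bot : omega1, forall w, omega1_bot = w \/ wlt omega1_bot w.
Proof.
have [w _] := omega1_inh; have [|m _ h] := wo_min omega1_wellorder (A := setT).
  by exists w.
by exists m => x; exact: h.
Qed.

Definition omega1_bot : omega1 := sval (cid omega1_least).

Lemma omega1_bot_le w : omega1_bot = w \/ wlt omega1_bot w.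
Proof. exact: (svalP (cid omega1_least)). Qed.

(** Columns are indexed by K, with [None] for the additional last column. *)
Definition clt (c d : option K) : Prop :=
  match c, d with
  | Some a, Some b => klt a b
  | Some _, None => True
  | None, _ => False
  end.

Lemma clt_wellorder : wellorder clt.
Proof.
split; first split.
- by case=> [a|] //=; exact: so_irr HK _.
- by case=> [b|] [a|] [c|] //=; exact: (so_trans HK).
- move=> [a|] [b|] /=; do ?[by constructor 1|by constructor 2|by constructor 3].
  by have [l|->|l] := so_total HK a b; [constructor 1|constructor 2|constructor 3].
- move=> A [a Aa]; have [[k Ak]|no] := pselect (exists k, A (Some k)).
    have [|m Am min] := wo_min wo (A := [set k | A (Some k)]); first by exists k.
    exists (Some m) => // -[x|] Ax; last by right.
    by have [->|l] := min x Ax; [left|right].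
  exists None; first by case: a Aa => // k Ak; exfalso; apply: no; exists k.
  by move=> [x|] Ax; [exfalso; apply: no; exists x|left].
Qed.
Let HC := wo_sorder clt_wellorder.

Variable S : K -> bool.

Definition item := (option K * bool * omega1)%type.

(** Column k consists of omega1 (or of one item, if the bit S k is off)
    followed by a reversed omega1; the last column is omega1. *)
Definition valid (x : item) : Prop :=
  match x with
  | (Some k, false, w) => S k \/ w = omega1_bot
  | (Some k, true, _) => True
  | (None, b, _) => b = false
  end.

Definition code := {x : item | valid x}.

Definition item_lt (x y : item) : Prop :=
  clt x.1.1 y.1.1 \/ x.1.1 = y.1.1 /\
    match x.1.2, y.1.2 with
    | false, true => True
    | true, false => False
    | false, false => wlt x.2 y.2
    | true, true => wlt y.2 x.2
    end.

Definition code_lt (x y : code) := item_lt (sval x) (sval y).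

Lemma code_eq (x y : code) : sval x = sval y -> x = y.
Proof. by case: x y => [x p] [y q] /= E; apply: eq_exist. Qed.

Lemma item_sorder : sorder item_lt.
Proof.
split.
- move=> [[c b] w] [/= l|[_ /=]]; first exact: (so_irr HC l).
  by case: b; exact: so_irr HW _.
- move=> [[c b] w] [[c' b'] w'] [[c'' b''] w''] [/= l|[/= -> h]] [/= l'|[/= <- h']].
  + by left; exact: (so_trans HC l l').
  + by left.
  + by left.
  + right; split=> //; move: h h'; case: b; case: b'; case: b'' => //= h h'.
      exact: (so_trans HW h' h).
    exact: (so_trans HW h h').
- move=> [[c b] w] [[c' b'] w']; have [l|<-|l] := so_total HC c c'.
  + by constructor 1; left.
  + case: b; case: b'.
    * by have [l|->|l] := so_total HW w w'; [constructor 3|constructor 2|constructor 1] => //; right.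
    * by constructor 3; right.
    * by constructor 1; right.
    * by have [l|->|l] := so_total HW w w'; [constructor 1|constructor 2|constructor 3] => //; right.
  + by constructor 3; left.
Qed.

Lemma code_sorder : sorder code_lt.
Proof.
split.
- by move=> x; exact: so_irr item_sorder _.
- by move=> y x z; exact: (so_trans item_sorder).
- move=> x y; have [l|/code_eq E|l] := so_total item_sorder (sval x) (sval y).
  + by constructor 1.
  + by constructor 2.
  + by constructor 3.
Qed.

Definition to_code (x : item) (v : valid x) : code := exist _ x v.

Lemma code_emb (M : Type) : emb nat M -> emb K M -> emb code M.
Proof.
move=> nM KM; apply: (emb_trans (B := item)).
  by exists sval => x y /code_eq.
have WM : emb omega1 M by apply: emb_trans KM; exists sval => x y /omega1_eq.
apply: emb_prod_in => //; apply: emb_prod_in => //; first exact: emb_option.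
by apply: emb_trans nM; exists nat_of_bool => -[] [].
Qed.

Lemma K_inh : exists k : K, True.
Proof.
by have [w _] := omega1_inh; exists (sval w).
Qed.

Lemma valid_bot k : valid (Some k, false, omega1_bot). Proof. by right. Qed.
Lemma valid_true k w : valid (Some k, true, w). Proof. by []. Qed.
Lemma valid_last w : valid (None, false, w). Proof. by []. Qed.

Lemma code_inh : exists x : code, True.
Proof. by have [k _] := K_inh; exists (to_code (valid_bot k)). Qed.

Lemma code_left_end : countably_coinitial code_lt [set: code].
Proof.
have [k _] := K_inh; have [|m _ min] := wo_min wo (A := setT); first by exists k.
exists [set to_code (valid_bot m)]; split; [by []|by []|].
move=> [[[c b] w] v] _; eexists; first by [].
case: c v => [c|] v; last by right; left.
have [E|l] := min c I; last by right; left.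
case: b v => v; first by right; right; rewrite E.
have [wE|l] := omega1_bot_le w; last by right; right; rewrite E.
by left; apply: code_eq; rewrite /= E wE.
Qed.

(** The common reason why the uncountable characters below are uncountable: a
    countable set of values of f is bounded in omega1. *)
Lemma omega1_cofinal (A : set code) (f : omega1 -> code) :
  countable A -> (forall w, exists2 a, A a & exists2 v, f v = a & w = v \/ wlt w v) ->
  injective f -> False.
Proof.
move=> cA H fI; pose A' := [set v | A (f v)].
have cA' : countable A' by apply: (countable_inj (f := f)) cA => [v //|u v _ _ /fI].
have [w hw] := omega1_bounded cA'.
have [a Aa [v vE wv]] := H w.
have vw : wlt v w by apply: hw; rewrite /A' /= vE.
by case: wv => [E|l]; [move: vw; rewrite E; exact: so_irr HW _|exact: (so_irr HW (so_trans HW vw l))].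
Qed.

Lemma code_right_end : ~ countably_coinitial (flip_rel code_lt) [set: code].
Proof.
move=> [A [cA _ H]].
apply: (@omega1_cofinal A (fun w => to_code (valid_last w)) cA); last first.
  by move=> v w /(congr1 sval) [].
move=> w; have [a Aa h] := H (to_code (valid_last w)) I; exists a => //.
case: h => [->|]; first by exists w => //; left.
case: a {Aa} => [[[c b] v] va] [//|[/= E h]]; subst c.
case: b va h => va h; first by have : true = false := va.
by exists v; [exact: code_eq|right].
Qed.

(** The cut in the middle of the column k. *)
Definition bit_cut (k : K) : set code :=
  [set x | clt (sval x).1.1 (Some k) \/ ((sval x).1.1 = Some k /\ (sval x).1.2 = false)].

Lemma bit_cut_initial k : initial code_lt (bit_cut k).
Proof.
move=> [[[c b] w] v] [[[c' b'] w'] v'] [/= l|[/= E h]] [/= l'|[/= E' b0]].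
- by left => /=; exact: (so_trans HC l l').
- by left => /=; rewrite -E'.
- by left => /=; rewrite E.
- by right => /=; split; [rewrite E|case: b' h {v'} => //; rewrite b0].
Qed.

Lemma bit_cut_right k : ~ countably_coinitial code_lt (~` (bit_cut k)).
Proof.
move=> [A [cA AD H]].
apply: (@omega1_cofinal A (fun w => to_code (valid_true k w)) cA); last first.
  by move=> v w /(congr1 sval) [].
move=> w; have [|a Aa h] := H (to_code (valid_true k w)).
  by move=> [/= l|[]//]; exact: (so_irr HK l).
exists a => //; case: h => [->|]; first by exists w => //; left.
have := AD a Aa; case: a {Aa} => [[[c b] v] va] nD [/= l|[/= E h]].
  by case: nD; left.
case: b va nD h => va nD h; last by case: nD; right.
by exists v; [apply: code_eq; rewrite /= E|right].
Qed.

(** The left half of the column k is a copy of omega1, or has a greatest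
    element. *)
Lemma bit_cut_left k : countably_coinitial (flip_rel code_lt) (bit_cut k) <-> ~~ S k.
Proof.
split=> [[A [cA AD H]]|nS]; last first.
  exists [set to_code (valid_bot k)]; split; [by []|by move=> _ ->; right|].
  move=> [[[c b] w] v] [/= l|[/= E bE]]; eexists; do ?[by []].
    by right; left.
  left; apply: code_eq => /=; subst c b; congr (_, _).
  by case: v => // Sk; move: nS; rewrite Sk.
apply/negP => Sk.
have vf w : valid (Some k, false, w) by left.
apply: (@omega1_cofinal A (fun w => to_code (vf w)) cA); last first.
  by move=> v w /(congr1 sval) [].
move=> w; have [|a Aa h] := H (to_code (vf w)); first by right.
exists a => //; case: h => [->|]; first by exists w => //; left.
have := AD a Aa; case: a {Aa} => [[[c b] v] va] [/= l|[/= E bE]].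
  move=> [/= l'|[/= E' _]]; first by case: (so_irr HC (so_trans HC l l')).
  by case: (so_irr HC (i := c)); rewrite -{1}E' in l *; rewrite -E'.
subst c b; move=> [/= l|[_ /= h]]; first by case: (so_irr HK l).
by exists v; [exact: code_eq|right].
Qed.

(** An initial set whose complement has no least element does not end inside
    the increasing half of a column, which is well-ordered: it is given by a
    column and by the last element of its reversed half to belong to the set, if
    there is one. *)
Definition shape (p : option K * option omega1) : set code :=
  [set x | clt (sval x).1.1 p.1 \/ ((sval x).1.1 = p.1 /\
    ((sval x).1.2 = false \/ exists2 v, p.2 = Some v & v = (sval x).2 \/ wlt v (sval x).2))].

Lemma shapeP (D : set code) : initial code_lt D -> (~` D) !=set0 ->
  (forall x, ~ D x -> exists2 y, ~ D y & code_lt y x) ->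
  exists p, D = shape p /\ exists w v, ~ D (exist valid (p.1, true, w) v).
Proof.
move=> iD [x0 nx0] nomin.
have [|c [[[[c' b'] w'] v'] nD' /= cE] cmin] := wo_min clt_wellorder
    (A := (fun x : code => (sval x).1.1) @` (~` D)).
  by exists (sval x0).1.1, x0.
subst c'.
have colD (x : code) : clt (sval x).1.1 c -> D x.
  move=> l; apply: contrapT => nDx; have [|E|l'] := cmin (sval x).1.1; first by exists x.
    by move: l; rewrite -E; exact: so_irr HC _.
  exact: (so_irr HC (so_trans HC l l')).
have falseD (x : code) : (sval x).1.1 = c -> (sval x).1.2 = false -> D x.
  move=> xc xb; apply: contrapT => nDx.
  have [|w [v nDw] wmin] := wo_min omega1_wellorder
      (A := [set w | exists v, ~ D (exist valid (c, false, w) v)]).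
    exists (sval x).2; case: x xc xb nDx => [[[a b] w] v] /= xc xb; subst a b => nDx.
    by exists v.
  have [[[[a b] u] va] nDy [/= l|[/= E h]]] := nomin _ nDw.
    by apply: nDy; exact: colD.
  case: b va nDy h => // va nDy h; subst a.
  have [|E|l] := wmin u; first by exists va.
    by move: h; rewrite E; exact: so_irr HW _.
  exact: (so_irr HW (so_trans HW h l)).
have b'T : b' = true.
  by case: b' v' nD' => // v' nD'; exfalso; apply: nD'; exact: falseD.
subst b'.
have vt w : valid (c, true, w) by case: c v' {nD' cmin colD falseD}.
have up u w : (w = u \/ wlt w u) -> D (exist _ _ (vt w)) -> D (exist _ _ (vt u)).
  move=> [->//|l] Dw; have [|nDu] := pselect (D (exist _ _ (vt u))); first by [].
  by apply: iD Dw; right.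
have gtc (x : code) : clt c (sval x).1.1 -> ~ D x.
  move=> l Dx; apply: nD'; apply: (iD x) => //; by left.
have veq w v : exist valid (c, true, w) v = exist _ _ (vt w) by exact: code_eq.
have [[w1 Dw1]|no] := pselect (exists w, D (exist _ _ (vt w))).
  have [|m Dm mmin] := wo_min omega1_wellorder (A := [set w | D (exist _ _ (vt w))]).
    by exists w1.
  exists (c, Some m); split; last by exists w', v'.
  apply/seteqP; split=> -[[[a b] u] va] /=.
    move=> Dx; have [l|E|l] := so_total HC a c; [by left| |by case: (gtc (exist valid (a, b, u) va) l)].
    subst a; right; split=> //; case: b va Dx => va Dx; [right|by left].
    by exists m => //; apply: mmin; rewrite /= -(veq u va).
  move=> [/= l|[/= E h]]; first exact: colD.
  subst a; case: h => [E|[v [<-] h]]; first exact: falseD.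
  case: b va => va; last exact: falseD.
  by rewrite veq; apply: up Dm.
exists (c, None); split; last by exists w', v'.
apply/seteqP; split=> -[[[a b] u] va] /=.
  move=> Dx; have [l|E|l] := so_total HC a c; [by left| |by case: (gtc (exist valid (a, b, u) va) l)].
  subst a; right; split=> //; case: b va Dx => va Dx; [|by left].
  by exfalso; apply: no; exists u; rewrite -(veq u va).
move=> [/= l|[/= E [E'|[v] //]]]; first exact: colD.
exact: falseD.
Qed.

(** An initial set which ends inside the reversed half of a column leaves only
    countably many elements of this column above it, which are coinitial; all
    the other cuts are followed by a least element, or by nothing. *)
Lemma large_cut (D : set code) : initial code_lt D -> ~ countably_coinitial code_lt (~` D) ->
  exists k, D = bit_cut k.
Proof.
move=> iD nc.
have ne : (~` D) !=set0.
  apply: contrapT => e; apply: nc; exists set0; split=> // x nDx.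
  by exfalso; apply: e; exists x.
have nomin x : ~ D x -> exists2 y, ~ D y & code_lt y x.
  move=> nDx; apply: contrapT => no; apply: nc; exists [set x]; split.
  - by [].
  - by move=> _ ->.
  - move=> y nDy; exists x => //; have [l|E|l] := so_total code_sorder x y.
    + by right.
    + by left.
    + by exfalso; apply: no; exists y.
have [[c o] [DE [w [v /= nD]]]] := shapeP iD ne nomin.
case: c DE v nD => [k|] DE v nD //.
case: o v nD DE => [m|] v nD DE; last first.
  exists k; rewrite DE; apply/seteqP; split=> x [/= l|[E h]]; do ?[by left].
    by right; split=> //; case: h => // -[].
  by right; split=> //; left.
exfalso; apply: nc.
exists [set x | ~ D x /\ (sval x).1.1 = Some k]; split.
- have fP (x : code) : ~ D x -> (sval x).1.1 = Some k -> (sval x).1.2 = true /\ wlt (sval x).2 m.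
    case: x => [[[a b] u] va] /= nDx ak; subst a.
    case: b va nDx => va nDx; last by exfalso; apply: nDx; rewrite DE; right; split=> //; left.
    split=> //; have [//|E|l] := so_total HW u m; exfalso; apply: nDx; rewrite DE; right;
      split=> //; right; exists m => //; by [left|right].
  apply: (countable_inj (f := fun x => (sval x).2)) (omega1_below m) => [x [nDx xk]|x y].
    by have [] := fP x nDx xk.
  move=> [nDx xk] [nDy yk] E; apply: code_eq.
  have [xb _] := fP x nDx xk; have [yb _] := fP y nDy yk.
  move: E xk yk xb yb; case: (sval x) => [[a b] u]; case: (sval y) => [[a' b'] u'] /=.
  by move=> -> -> -> -> ->.
- by move=> x [].
- move=> x nDx; have [l|E|l] := so_total HC (sval x).1.1 (Some k).
  + by exfalso; apply: nDx; rewrite DE; left.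
  + by exists x => //; left.
  + exists (exist _ _ v); first by split.
    by right; left.
Qed.

(** A shape is given by a column and at most one element of omega1. *)
Lemma cuts_emb (M : Type) : emb nat M -> emb K M ->
  emb {D : set code | initial code_lt D /\ forall x, ~ D x -> exists2 y, ~ D y & code_lt y x} M.
Proof.
move=> nM KM.
have WM : emb omega1 M by apply: emb_trans KM; exists sval => x y /omega1_eq.
apply: (emb_trans (B := option (option K * option omega1))); last first.
  by apply: emb_option => //; apply: emb_prod_in => //; exact: emb_option.
have ch (D : {D : set code | initial code_lt D /\
      forall x, ~ D x -> exists2 y, ~ D y & code_lt y x}) :
    exists o, sval D = if o is Some p then shape p else setT.
  case: D => D [iD nomin] /=; have [ne|e] := pselect ((~` D) !=set0).
    by have [p [DE _]] := shapeP iD ne nomin; exists (Some p).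
  exists None; apply/seteqP; split=> // x _; apply: contrapT => nDx; apply: e; by exists x.
exists (fun D => sval (cid (ch D))) => D D' E.
have : sval D = sval D' by rewrite (svalP (cid (ch D))) E -(svalP (cid (ch D'))).
by case: D D' {E} => [D p] [D' p'] /= E; apply: eq_exist.
Qed.

End Code.

(** * Collapsed squares that code bits *)

Section Transfer.
Variables (T T' : topologicalType) (le : T -> T -> Prop) (le' : T' -> T' -> Prop).
Hypotheses (H : lincont le) (H' : lincont le').
Variables (P : set T) (P' : set T') (phi : T -> T').
Hypothesis phiP : forall x, P x -> P' (phi x).
Hypothesis phi_surj : forall w, P' w -> exists2 x, P x & phi x = w.
Hypothesis mono : forall x y, P x -> P y -> slt le x y -> slt le' (phi x) (phi y).

Lemma mono_reflect x y : P x -> P y -> slt le' (phi x) (phi y) -> slt le x y.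
Proof.
move=> Px Py xy; have [yx|nyx] := pselect (le y x); last exact: not_le_lt nyx.
exfalso; have [E|nE] := pselect (y = x); first by case: xy => _; rewrite E.
by apply: (lt_not_le H' xy); case: (mono Py Px (conj yx nE)).
Qed.

Lemma mono_le x y : P x -> P y -> le x y -> le' (phi x) (phi y).
Proof.
move=> Px Py xy; have [->|nE] := pselect (x = y); first exact: lc_refl H' _.
by case: (mono Px Py (conj xy nE)).
Qed.

Lemma mono_le_reflect x y : P x -> P y -> le' (phi x) (phi y) -> le x y.
Proof.
move=> Px Py xy; apply: contrapT => /(not_le_lt H) yx.
exact: (lt_not_le H' (mono Py Px yx)).
Qed.

Lemma mono_inj x y : P x -> P y -> phi x = phi y -> x = y.
Proof.
move=> Px Py E; apply: (lc_anti H); apply: mono_le_reflect => //; rewrite E; exact: lc_refl H' _.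
Qed.

Lemma small_end_mono : small_end le P -> small_end le' P'.
Proof.
move=> [S [cS SP Sco]]; exists (phi @` S); split.
- by apply: sub_countable cS; exact: card_image_le.
- by move=> _ [y Sy <-]; apply: phiP; exact: SP.
- move=> _ /phi_surj[x Px <-]; have [y Sy yx] := Sco x Px.
  by exists (phi y); [exists y|apply: mono_le => //; exact: SP].
Qed.

Lemma small_right_mono z : P z -> small_right le P z <-> small_right le' P' (phi z).
Proof.
move=> Pz; split=> [[S [cS SP Sco]]|[S [cS SP Sco]]].
- exists (phi @` S); split.
  + by apply: sub_countable cS; exact: card_image_le.
  + by move=> _ [y /SP[Py zy] <-]; split; [exact: phiP|exact: mono].
  + move=> _ /phi_surj[x Px <-] zx; have [y Sy yx] := Sco x Px (mono_reflect Pz Px zx).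
    by exists (phi y); [exists y|apply: mono_le => //; case: (SP y Sy)].
- exists [set y | P y /\ S (phi y)]; split.
  + by apply: (countable_inj (f := phi)) cS => [y []//|x y [Px _] [Py _]]; exact: mono_inj.
  + by move=> y [Py /SP[_ zy]]; split=> //; exact: mono_reflect zy.
  + move=> x Px zx; have [w Sw wx] := Sco (phi x) (phiP Px) (mono Pz Px zx).
    have [y Py yE] := phi_surj (SP w Sw).1; exists y; first by split=> //; rewrite -yE in Sw.
    by apply: mono_le_reflect => //; rewrite yE.
Qed.

End Transfer.

Lemma slt_flip (T : Type) (le : T -> T -> Prop) x y : slt (flip_rel le) x y <-> slt le y x.
Proof. by split=> -[xy nE]; split=> // E; apply: nE. Qed.

(** The choices needed to code subsets of K: a well-order of K, and an
    everywhere uncountable set of at most K reals at which edges pause. *)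
Record frame (R : realType) (K : Type) := Frame {
  fr_lt : K -> K -> Prop;
  fr_wo : wellorder fr_lt;
  fr_unc : ~ countable [set: K];
  fr_L : Type;
  fr_ev : fr_L -> R;
  fr_evI : injective fr_ev;
  fr_ev01 : forall e, 0 < fr_ev e < 1;
  fr_evU : forall p q : R, 0 <= p -> p < q -> q <= 1 -> ~ countable [set e | p < fr_ev e < q];
  fr_emb : emb fr_L K }.

Section Coded.
Variables (R : realType) (K : Type) (fr : frame R K) (S : K -> bool).

Local Notation I := (code (fr_wo fr) (fr_unc fr) S).
Local Notation lt := (@code_lt K (fr_lt fr) (fr_wo fr) (fr_unc fr) S).

Definition coded_line : set (cube (I * seq (fr_L fr)) R) := ladder lt (fr_ev (f := fr)).

Lemma coded_sorder : sorder lt. Proof. exact: code_sorder. Qed.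
Lemma coded_inh : exists i : I, True. Proof. exact: code_inh. Qed.

Definition coded_arcless : arcless coded_line :=
  ladder_arcless coded_sorder (@fr_evI _ _ fr) (@fr_ev01 _ _ fr) (@fr_evU _ _ fr) coded_inh.

Definition coded_sphere : topologicalType := sphere coded_line.

Definition coded_le : set_type coded_line -> set_type coded_line -> Prop :=
  @ptle R (I * seq (fr_L fr)) coded_line.

Local Notation P := (inner coded_arcless).

Definition bit_point (k : K) : set_type coded_line :=
  cut (@fr_ev01 _ _ fr) (@bit_cut_initial K (fr_lt fr) (fr_wo fr) (fr_unc fr) S k).

Let HK := wo_sorder (fr_wo fr).

Lemma bit_point_lt k k' : fr_lt fr k k' -> slt coded_le (bit_point k) (bit_point k').
Proof.
move=> kk'; have Hlt := coded_sorder.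
apply: (@cut_lt _ _ _ _ _ Hlt (@fr_evI _ _ fr) _ _ _ _ _
  (to_code (valid_true (fr_wo fr) (fr_unc fr) S k (omega1_bot (fr_wo fr) (fr_unc fr))))).
  by move=> [/= l|[]//]; exact: (so_irr HK l).
by left.
Qed.

Lemma coded_lincont : lincont coded_le.
Proof. exact: al_lin coded_arcless. Qed.

Lemma bit_point_lt_inv k k' : slt coded_le (bit_point k) (bit_point k') -> fr_lt fr k k'.
Proof.
move=> l; have [//|E|l'] := so_total HK k k'; first by case: l => _; rewrite E.
by case: (lt_not_le coded_lincont l); case: (bit_point_lt l').
Qed.

Lemma bit_point_inj : injective bit_point.
Proof.
move=> k k' E; have [/bit_point_lt[_ /(_ E)]|//|/bit_point_lt[_ /(_ (esym E))]] :=
  so_total HK k k' => //.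
Qed.

Lemma bit_point_inner k : P (bit_point k).
Proof.
have Hlt := coded_sorder.
apply/innerP; rewrite zbot_cut0 ztop_cutT; split.
- apply: (@cut_lt _ _ _ _ _ Hlt (@fr_evI _ _ fr) _ _ _ _ _
    (to_code (valid_bot (fr_wo fr) (fr_unc fr) S k))) => //.
  by right.
- apply: (@cut_lt _ _ _ _ _ Hlt (@fr_evI _ _ fr) _ _ _ _ _
    (to_code (valid_true (fr_wo fr) (fr_unc fr) S k (omega1_bot (fr_wo fr) (fr_unc fr))))) => //.
  by move=> [/= l|[]//]; exact: (so_irr HK l).
Qed.

Lemma bit_point_large k : ~ small_right coded_le P (bit_point k).
Proof. by move=> /small_right_cutP; exact: bit_cut_right. Qed.

Lemma large_bit_point z : P z -> ~ small_right coded_le P z -> exists k, z = bit_point k.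
Proof.
move=> Pz /(large_right_cut Pz)[D [iD [-> /(large_cut iD)[k DE]]]]; exists k.
by subst D; rewrite /bit_point; congr cut; exact: Prop_irrelevance.
Qed.

Lemma bit_point_left k : small_right (flip_rel coded_le) P (bit_point k) <-> ~~ S k.
Proof.
split=> [/small_left_cutP/bit_cut_left//|/(bit_cut_left (fr_wo fr) (fr_unc fr))].
by move=> h; apply/small_left_cutP.
Qed.

Lemma coded_left_end : small_end coded_le P.
Proof. exact/small_end_left/code_left_end. Qed.

Lemma coded_right_end : ~ small_end (flip_rel coded_le) P.
Proof. by move=> /small_end_right; exact: code_right_end. Qed.

End Coded.

(** The points of large right character correspond to each other under the
    bijection phi of the continua; g is the induced map of their indices. *)
Theorem coded_sphere_embedding (R : realType) (K K' : Type) (fr : frame R K)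
    (fr' : frame R K') (S : K -> bool) (S' : K' -> bool)
    (f : coded_sphere fr S -> coded_sphere fr' S') :
  continuous f -> injective f -> exists g : K -> K',
    [/\ forall k k', fr_lt fr k k' -> fr_lt fr' (g k) (g k'),
        forall k', exists k, g k = k' & forall k, S k = S' (g k)].
Proof.
move=> fc fI; have H := coded_lincont fr S; have H' := coded_lincont fr' S'.
have [phi [phiP phi_surj [up|down]]] :=
  @sphere_embedding R _ _ _ _ (coded_arcless fr S) (coded_arcless fr' S') f fc fI; last first.
  exfalso; apply: (@coded_right_end R K' fr' S').
  apply: (small_end_mono (lincont_flip H') phiP phi_surj _ (coded_left_end fr S)).
  by move=> x y Px Py xy; apply/slt_flip; exact: down.
have large z : inner (coded_arcless fr S) z ->
    small_right (@coded_le _ _ fr S) (inner (coded_arcless fr S)) z <->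
    small_right (@coded_le _ _ fr' S') (inner (coded_arcless fr' S')) (phi z).
  by move=> Pz; exact: (small_right_mono H H' phiP phi_surj up Pz).
have left_ z : inner (coded_arcless fr S) z ->
    small_right (flip_rel (@coded_le _ _ fr S)) (inner (coded_arcless fr S)) z <->
    small_right (flip_rel (@coded_le _ _ fr' S')) (inner (coded_arcless fr' S')) (phi z).
  move=> Pz; apply: (small_right_mono (lincont_flip H) (lincont_flip H') phiP phi_surj _ Pz).
  by move=> x y Px Py /slt_flip xy; apply/slt_flip; exact: up.
have img k : exists k', phi (bit_point fr S k) = bit_point fr' S' k'.
  have Pk := bit_point_inner fr S k; apply: large_bit_point; first exact: phiP.
  by move=> /(large _ Pk); exact: bit_point_large.
pose g k := sval (cid (img k)).
have gE k : phi (bit_point fr S k) = bit_point fr' S' (g k) by exact: (svalP (cid (img k))).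
exists g; split.
- move=> k k' kk'; apply: (@bit_point_lt_inv R K' fr' S'); rewrite -!gE.
  by apply: up; [exact: bit_point_inner|exact: bit_point_inner|exact: bit_point_lt].
- move=> k'; have [z Pz zE] := phi_surj _ (bit_point_inner fr' S' k').
  have [|k kE] := large_bit_point Pz.
    by move=> /(large _ Pz); rewrite zE; exact: bit_point_large.
  by exists k; apply: (@bit_point_inj R K' fr' S'); rewrite -gE -kE.
- move=> k; have := left_ _ (bit_point_inner fr S k); rewrite gE.
  move=> [h1 h2]; apply/negb_inj; apply/idP/idP => h.
    by apply/bit_point_left; apply: h1; apply/bit_point_left.
  by apply/bit_point_left; apply: h2; apply/bit_point_left.
Qed.

(** * Reals, existence of frames, and sizes *)

Lemma uncountable_emb (K : Type) : ~ countable [set: K] -> emb nat K.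
Proof. by move=> nc; have [//|/embP] := emb_total nat K. Qed.

Lemma cantor_diagonal : ~ emb (nat -> bool) nat.
Proof.
move=> [f fI].
pose d n := if pselect (exists s, f s = n) is left h then ~~ sval (cid h) n else true.
have : d (f d) = ~~ d (f d).
  rewrite {1}/d; case: pselect => [h|[]]; last by exists d.
  by congr (~~ _); rewrite (fI _ _ (svalP (cid h))).
by case: (d _).
Qed.

Section Ternary.
Variable R : realType.

Definition ternary_sum (s : nat -> bool) (n : nat) : R :=
  \sum_(i < n) (s i)%:R * (2 / 3 ^+ i.+1).

Lemma ternary_sum_le s m n : (m <= n)%N ->
  ternary_sum s m <= ternary_sum s n <= ternary_sum s m + 3 ^- m - 3 ^- n.
Proof.
move=> /subnK <-; elim: (n - m)%N => [|d IH]; first by rewrite add0n addrK lexx.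
rewrite addSn /ternary_sum big_ord_recr /= -!/(ternary_sum _ _).
move: IH; rewrite exprS invfM; move: (3 ^- (d + m)) (invr_gt0 (3 ^+ (d + m) : R)) => u.
rewrite exprn_gt0 // => u0 /andP[l1 l2].
by case: (s _); rewrite ?mul0r ?mul1r; apply/andP; split; lra.
Qed.

(** The point of the ternary Cantor set with digits 2 * s i. *)
Definition ternary (s : nat -> bool) : R := sup (range (ternary_sum s)).

Lemma ternary_sum_sup s : has_sup (range (ternary_sum s)).
Proof.
split; first by exists (ternary_sum s 0), 0%N.
exists 1 => _ [n _ <-]; have /andP[_] := ternary_sum_le s (leq0n n).
rewrite /ternary_sum big_ord0 expr0 invr1 add0r => /le_trans; apply.
by rewrite lerBlDr lerDl invr_ge0 exprn_ge0.
Qed.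

Lemma ternary_bounds s m : ternary_sum s m <= ternary s <= ternary_sum s m + 3 ^- m.
Proof.
apply/andP; split; first by apply: (ub_le_sup (ternary_sum_sup s).2); exists m.
apply: (ge_sup (ternary_sum_sup s).1) => _ [n _ <-].
have := exprn_ge0 m (ler0n R 3); rewrite -invr_ge0 => m0.
have [mn|/ltnW nm] := leqP m n.
  have /andP[_ /le_trans] := ternary_sum_le s mn; apply.
  by rewrite lerBlDr lerDl invr_ge0 exprn_ge0.
have /andP[h _] := ternary_sum_le s nm; apply: (le_trans h); by rewrite lerDl.
Qed.

Lemma ternary01 s : 0 <= ternary s <= 1.
Proof.
by have := ternary_bounds s 0; rewrite /ternary_sum big_ord0 expr0 invr1 add0r.
Qed.

(** At the first difference the digit 2 outweighs all the later digits. *)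
Lemma ternary_lt s t m : (forall i, (i < m)%N -> s i = t i) -> s m = false -> t m = true ->
  ternary s < ternary t.
Proof.
move=> st sm tm.
have /andP[_ hs] := ternary_bounds s m.+1; have /andP[ht _] := ternary_bounds t m.+1.
have E : ternary_sum s m = ternary_sum t m by apply: eq_bigr => i _; rewrite st.
move: hs ht; rewrite /ternary_sum !big_ord_recr /= -!/(ternary_sum _ _) sm tm E mul0r mul1r addr0.
have : 0 < (3 : R) ^- m.+1 by rewrite invr_gt0 exprn_gt0.
move: (3 ^- m.+1) => u u0 hs ht; lra.
Qed.

Lemma ternary_inj : injective ternary.
Proof.
move=> s t E; apply: contrapT => nE.
have ex : exists m, s m != t m.
  apply: contrapT => no; apply: nE; apply/funext => m; apply/eqP/negPn/negP => n.
  by apply: no; exists m.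
have [m ne min] := ex_minnP ex.
have eqm i : (i < m)%N -> s i = t i.
  by move=> im; apply/eqP/negPn/negP => /min; rewrite leqNgt im.
move: ne; case sm: (s m); case tm: (t m) => // _.
- by have := ternary_lt (fun i im => esym (eqm i im)) tm sm; rewrite E ltxx.
- by have := ternary_lt eqm sm tm; rewrite E ltxx.
Qed.

Definition inner_ternary s : R := (ternary s + 1) / 3.

Lemma inner_ternary01 s : 0 < inner_ternary s < 1.
Proof.
rewrite /inner_ternary; move: (ternary s) (ternary01 s) => u /andP[u0 u1].
by apply/andP; split; lra.
Qed.

Lemma inner_ternary_inj : injective inner_ternary.
Proof. by move=> s t E; apply: ternary_inj; move: E; rewrite /inner_ternary; lra. Qed.

Lemma emb_real : emb R (nat -> bool).
Proof.
apply: (emb_trans (B := rat -> bool)).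
  exists (fun x q => (ratr q : R) < x) => x y E.
  have key (u v : R) : u < v -> exists q : rat, (ratr q < u) <> (ratr q < v).
    move=> /rat_in_itvoo[q]; rewrite in_itv /= => /andP[uq qv]; exists q.
    by rewrite qv ltNge (ltW uq).
  by have [/key[q []]|/key[q []]|//] := ltgtP x y; move: E => /(congr1 (@^~ q)) /=.
by apply: emb_precomp; [exists pickle; exact: pcan_inj pickleK|exists true].
Qed.

Lemma emb_real_seq : emb (nat -> R) (nat -> bool).
Proof.
apply: emb_trans (emb_fun _ emb_real) _; apply: emb_trans (emb_curry _ _ _) _.
by apply: emb_precomp; [apply: emb_square; exact: emb_refl|exists true].
Qed.

(** The pauses are obtained by copying one uncountable set of at most K reals
    into all the intervals with rational end points. The set is indexed by K, or
    by all binary sequences if K has more elements than the continuum. *)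
Lemma frame_exists (K : Type) : ~ countable [set: K] -> exists _ : frame R K, True.
Proof.
move=> Kunc; have nK := uncountable_emb Kunc.
have [X [Xunc XK [h hI]]] : exists X : Type,
    [/\ ~ countable [set: X], emb X K & emb X (nat -> bool)].
  have [e|e] := emb_total K (nat -> bool).
    by exists K; split=> //; exact: emb_refl.
  exists (nat -> bool); split=> //; last exact: emb_refl.
  by move=> /embP; exact: cantor_diagonal.
pose copy (a b : rat) x : R := ratr a + (ratr b - ratr a) * inner_ternary (h x).
pose L := {y : R | 0 < y < 1 /\ exists a b x, y = copy a b x}.
have LK : emb L K.
  have [rn rnI] : emb rat K.
    by apply: emb_trans nK; exists pickle; exact: pcan_inj pickleK.
  apply: (emb_trans (B := (rat * rat * X)%type)); last first.
    by do ?[apply: emb_prod_in => //]; exists rn.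
  have ch (y : L) : exists p : rat * rat * X, sval y = copy p.1.1 p.1.2 p.2.
    by have [_ [a [b [x E]]]] := svalP y; exists (a, b, x).
  exists (fun y => sval (cid (ch y))) => y z E.
  have : sval y = sval z by rewrite (svalP (cid (ch y))) E -(svalP (cid (ch z))).
  by case: y z {E} => [y py] [z pz] /= E; exact: eq_exist.
have [lt wo] := wellorder_exists K.
have LI : injective (sval : L -> R).
  by case=> [x px] [y py] /= E; exact: eq_exist.
suff U : forall p q : R, 0 <= p -> p < q -> q <= 1 -> ~ countable [set e : L | p < sval e < q].
  by exists (@Frame R K lt wo Kunc L sval LI (fun e => (svalP e).1) U LK).
move=> p q p0 pq q1 cL; apply: Xunc.
have [a] := rat_in_itvoo pq; rewrite in_itv /= => /andP[pa aq].
have [b] := rat_in_itvoo aq; rewrite in_itv /= => /andP[ab bq].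
have mid x : ratr a < copy a b x < ratr b.
  rewrite /copy; have /andP[u0 u1] := inner_ternary01 (h x).
  have d0 : 0 < (ratr b : R) - ratr a by rewrite subr_gt0.
  rewrite ltrDl mulr_gt0 //= -ltrBrDl -[ltRHS]mulr1 ltr_pM2l //.
have cP x : 0 < copy a b x < 1 /\ exists a' b' x', copy a b x = copy a' b' x'.
  split; last by exists a, b, x.
  have /andP[ax xb] := mid x.
  by rewrite (le_lt_trans p0 (lt_trans pa ax)) (lt_le_trans (lt_trans xb bq) q1).
apply: (countable_inj (f := fun x => exist _ (copy a b x) (cP x) : L)) cL => [x _|x y _ _].
  by have /andP[ax xb] := mid x; rewrite /= (lt_trans pa ax) (lt_trans xb bq).
move=> [] /addrI; have d0 : (ratr b : R) - ratr a != 0 by rewrite gt_eqF // subr_gt0.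
by move=> /(mulfI d0)/inner_ternary_inj/hI.
Qed.

End Ternary.

Lemma emb_nat_cantor : emb nat (nat -> bool).
Proof.
exists (fun n m => n == m) => n m E.
by have := congr1 (@^~ m) E; rewrite /= eqxx => /eqP.
Qed.

Lemma has_size_cardmax (X : topologicalType) (K : cardinal) :
  (forall M : cardinal, emb K M -> emb (nat -> bool) M -> emb X M) ->
  emb K X -> emb (nat -> bool) X -> space_has_size X (cardmax K (nat -> bool)).
Proof.
move=> up KX CX; apply/card_eqPle; split; apply/embP; rewrite /cardmax; case: ifP => le.
- by apply: up; [apply/embP; rewrite le|exact: emb_refl].
- apply: up; first exact: emb_refl.
  by have [//|/embP] := emb_total (nat -> bool) K; rewrite le.
- exact: CX.
- exact: KX.
Qed.

Section Sizes.
Variable R : realType.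

Lemma beads_has_size (k : nat -> nat) (K : cardinal) : emb K nat ->
  space_has_size (beads R k) (cardmax K (nat -> bool)).
Proof.
move=> Kn; have CX : emb (nat -> bool) (beads R k).
  exists (fun s => strand k ord0 (ternary R s)) => s t /(congr1 (coord None)).
  by rewrite !coord_strandN ?ternary01 // => /ternary_inj.
apply: has_size_cardmax => //; last first.
  by apply: emb_trans CX; apply: emb_trans emb_nat_cantor.
move=> M _ CM; have nM := emb_trans emb_nat_cantor CM.
apply: (emb_trans (B := ('I_5 * R)%type)); last first.
  apply: emb_prod_in => //; last exact: emb_trans (emb_real R) CM.
  by apply: emb_trans nM; exists (@nat_of_ord 5); exact: val_inj.
have ch v : exists p : 'I_5 * R, v = strand k p.1 p.2.
  by have [j [x [_ ->]]] := strandP v; exists (j, x).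
exists (fun v => sval (cid (ch v))) => v w E.
by rewrite (svalP (cid (ch v))) E -(svalP (cid (ch w))).
Qed.

Variables (K : cardinal) (fr : frame R K) (S : K -> bool).

Lemma coded_sphere_has_size : space_has_size (coded_sphere fr S) (cardmax K (nat -> bool)).
Proof.
have HZ := coded_arcless fr S.
apply: has_size_cardmax.
- move=> M KM CM; have nM := emb_trans emb_nat_cantor CM.
  apply: (emb_trans (B := (set_type (@coded_line R K fr S) * R)%type)); last first.
    apply: emb_prod_in => //; last exact: emb_trans (emb_real R) CM.
    apply: ladder_emb => //.
    + exact: coded_sorder.
    + exact: fr_evI.
    + exact: fr_ev01.
    + exact: code_emb.
    + exact: emb_trans (emb_real_seq R) CM.
    + exact: cuts_emb.
  exists (fun x => (zco x, tco x)) => x y [Ez Et].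
  by rewrite (zt_co x).2 (zt_co y).2 Ez Et.
- have h01 : (0 : R) < (2^-1 : R) < (1 : R) by apply/andP; split; lra.
  exists (fun k => sph (bit_point fr S k) 2^-1) => k l E; apply: (@bit_point_inj R K fr S).
  have h01' : (0 : R) <= (2^-1 : R) <= (1 : R) by apply/andP; split; lra.
  by have [] := sph_inj (bit_point_inner fr S k) h01 h01' E.
- have [z iz] := inner_exists HZ.
  exists (fun s => sph z (inner_ternary R s)) => s t E; apply: (@inner_ternary_inj R).
  have t01 : 0 <= inner_ternary R t <= 1.
    by have /andP[/ltW -> /ltW ->] := inner_ternary01 R t.
  by have [] := sph_inj iz (inner_ternary01 R s) t01 E.
Qed.

(** Each k contributes an edge of its own, and only one edge is traversed at a
    time. *)
Lemma coded_sphere_has_weight : has_weight (coded_sphere fr S) K.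
Proof.
have nK := uncountable_emb (fr_unc fr).
pose d k := (to_code (valid_bot (fr_wo fr) (fr_unc fr) S k), [::] : seq (fr_L fr)).
apply: (@sphere_has_weight _ _ _ (coded_arcless fr S) K d) => //.
- apply: emb_prod_in => //; first by apply: code_emb => //; exact: emb_refl.
  apply: emb_trans (emb_seq nK); have [f fI] := fr_emb fr.
  by exists (map f); exact: inj_map.
- move=> k; exists (zpoint (coded_sorder fr S) (@fr_ev01 _ _ fr) (d k) 2^-1).
  by rewrite zpoint_val; apply/andP; split; lra.
- move=> z k l /andP[k0 k1] /andP[l0 l1].
  have [_ chain _] := zladder z.
  have [lt|[E]//|lt] := so_total (coded_sorder fr S) (d k).1 (d l).1.
  + by case: (chain _ _ lt) => E; [move: k1|move: l0]; rewrite E ltxx.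
  + by case: (chain _ _ lt) => E; [move: l1|move: k0]; rewrite E ltxx.
Qed.

End Sizes.

(** * The class of coded spaces *)

Lemma choice_ext (T : Type) (P Q : T -> Prop) (p : exists x, P x) (q : exists x, Q x) :
  P = Q -> proj1_sig (ClassicalEpsilon.constructive_indefinite_description P p) =
    proj1_sig (ClassicalEpsilon.constructive_indefinite_description Q q).
Proof. by move=> E; subst Q; rewrite (Prop_irrelevance p q). Qed.

Lemma equipotent_self (K : cardinal) : exists L : cardinal, [set: K] #= [set: L].
Proof. by exists K; exact: card_eqxx. Qed.

(** A canonical type of each cardinality. The choice is made by a predicate on
    types which depends on the cardinality only, so equipotent types have equal
    representatives ([rep_eq]). *)
Definition rep (K : cardinal) : cardinal := proj1_sig
  (ClassicalEpsilon.constructive_indefinite_description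
     (fun L : cardinal => [set: K] #= [set: L] : Prop) (equipotent_self K)).

Lemma repP (K : cardinal) : [set: K] #= [set: rep K].
Proof. by rewrite /rep; case: ClassicalEpsilon.constructive_indefinite_description. Qed.

Lemma rep_eq (K K' : cardinal) : [set: K] #= [set: K'] -> rep K = rep K'.
Proof.
move=> E; apply: choice_ext; apply: FunctionalExtensionality.functional_extensionality => L.
apply/propext; split; first by apply: card_eq_trans; rewrite card_eq_sym.
exact: card_eq_trans.
Qed.

Lemma card_eq_emb (K L : Type) : emb K L -> emb L K -> [set: K] #= [set: L].
Proof. by move=> KL LK; apply/card_eqPle; split; apply/embP. Qed.

Lemma infinite_emb (K : Type) : infinite_set [set: K] -> emb nat K.
Proof. by move=> /infiniteP/embP. Qed.

Lemma equipotent_maps (K L : Type) : [set: K] #= [set: L] ->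
  exists (b : L -> K) (c : K -> L), cancel b c /\ cancel c b.
Proof.
move=> /card_bijP[f [g fK gK]].
pose el (T : Type) (x : T) : [set: T] := SigSub (mem_set (I : [set: T] x)).
have elK T (x : [set: T]) : el T (set_val x) = x by exact: val_inj.
exists (fun y => set_val (g (el _ y))), (fun x => set_val (f (el _ x))).
by split=> x; rewrite elK ?gK ?fK.
Qed.

Section Weights.
Variable X : topologicalType.

Lemma has_weight_unique (K K' : cardinal) : has_weight X K -> has_weight X K' ->
  [set: K] #= [set: K'].
Proof.
have le (L L' : cardinal) : has_weight X L -> has_weight X L' -> [set: L'] #<= [set: L].
  move=> [Linf [B [bB BL]] _] [_ _ /(_ B bB) h].
  apply: (card_le_trans (B := B)); last by case/card_eqPle: BL.
  apply: h; move/infiniteP: Linf => Linf; apply/infiniteP; apply: card_le_trans Linf _.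
  by case/card_eqPle: BL.
by move=> H H'; apply/card_eqPle; split; exact: le.
Qed.

Lemma has_weight_equipotent (K K' : cardinal) : [set: K] #= [set: K'] ->
  has_weight X K -> has_weight X K'.
Proof.
move=> E [Kinf [B [bB BK]] h]; split.
- move/infiniteP: Kinf => Kinf'; apply/infiniteP; apply: card_le_trans Kinf' _.
  by case/card_eqPle: E.
- by exists B; split=> //; exact: card_eq_trans BK E.
- move=> C bC iC; apply: (card_le_trans (B := [set: K])); last exact: h.
  by case/card_eqPle: E.
Qed.

Lemma basis_setU (B C : set (set X)) : basis B -> C `<=` open -> basis (B `|` C).
Proof.
move=> [Bo Bb] Co; split; first by move=> U [/Bo|/Co].
move=> x U /Bb[V [BV Vx] VU]; exists V => //; by split=> //; left.
Qed.

(** A countable basis may be finite; it is made infinite by adding countably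
    many open sets. *)
Lemma countable_basis_weight (K : cardinal) (B : set (set X)) :
  has_weight X K -> basis B -> countable B -> countable [set: K].
Proof.
move=> [Kinf [C [[Co _] CK]] h] bB cB.
have [e eI] : emb nat C.
  apply: emb_trans (infinite_emb Kinf) _; apply/embP.
  apply: (card_le_trans (B := C)); first by case/card_eqPle: CK.
  by have /card_eqPle[] := card_setT C.
pose D := range (fun n => set_val (e n) : set X).
have bD : basis (B `|` D).
  by apply: basis_setU => // _ [n _ <-]; apply: Co; exact: set_valP.
have cD : countable (B `|` D).
  rewrite -bigcup2E; apply: bigcup_countable => // -[|[|n]] _ //=.
  by apply: sub_countable (countableP [set: nat]); exact: card_image_le.
have iD : infinite_set (B `|` D).
  apply: (@sub_infinite_set _ D); first by move=> U DU; right.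
  apply/infiniteP; have /card_eqPle[_ le] : D #= [set: nat].
    by apply: inj_card_eq => m n _ _ /val_inj/eI.
  exact: le.
by apply: sub_countable cD; exact: h.
Qed.

End Weights.

Lemma embeddable_inj (X Y : topologicalType) : embeddable X Y ->
  exists f : X -> Y, continuous f /\ injective f.
Proof.
move=> [A [f [g [fc _ fK _]]]]; exists (fun x => set_val (f x)); split.
  by move=> x; apply: (@cont_comp _ _ _ f set_val); [exact: fc|exact: val_cont].
by move=> x y /val_inj; exact: (can_inj fK).
Qed.

Section Family.
Variable R : realType.

(** The options account for the types that cannot be listed by the natural
    numbers. *)
Definition listing (K : cardinal) (n : nat) : option K :=
  if pselect (exists e : nat -> K, forall k, exists n, e n = k) is left h
  then Some (sval (cid h) n) else None.

Definition listed_bits (K : cardinal) (S : K -> bool) (n : nat) : bool :=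
  if listing K n is Some k then S k else false.

Lemma listed_bits_inj (K : cardinal) (S S' : K -> bool) : emb nat K -> emb K nat ->
  listed_bits S = listed_bits S' -> S = S'.
Proof.
move=> nK Kn E.
have [b [c [bK cK]]] := equipotent_maps (card_eq_emb nK Kn).
have h : exists e : nat -> K, forall k, exists n, e n = k.
  by exists c => k; exists (b k); exact: bK.
apply/funext => k; have [n nE] := svalP (cid h) k; move: E => /(congr1 (@^~ n)).
rewrite /listed_bits /listing; case: pselect => // h'.
by rewrite (Prop_irrelevance h' h) nE.
Qed.

Definition chosen_frame (K : cardinal) (u : ~ countable [set: K]) : frame R K :=
  proj1_sig (ClassicalEpsilon.constructive_indefinite_description _ (frame_exists R u)).

Definition coded_space (K : cardinal) (S : K -> bool) : topologicalType :=
  match pselect (countable [set: K]) with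
  | left _ => beads R (bead_code (listed_bits S))
  | right u => coded_sphere (chosen_frame u) S
  end.

Section OneSpace.
Variables (K : cardinal) (S : K -> bool).
Hypothesis nK : emb nat K.

Lemma coded_space_continuum : [/\ continuum (coded_space S),
  pathwise_connected R (coded_space S) & locally_connected (coded_space S)].
Proof.
rewrite /coded_space; case: pselect => [c|u].
  split; [exact: beads_continuum|exact: beads_pathwise|].
  by apply: beads_locally_connected; exact: bead_code_bounds.
have HZ := coded_arcless (chosen_frame u) S.
by split; [exact: sphere_continuum HZ|exact: sphere_pathwise HZ|exact: sphere_locally_connected HZ].
Qed.

Lemma coded_space_has_weight : has_weight (coded_space S) K.
Proof.
rewrite /coded_space; case: pselect => [c|u]; last exact: coded_sphere_has_weight.
by apply: beads_has_weight => //; exact/embP.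
Qed.

Lemma coded_space_has_size : space_has_size (coded_space S) (cardmax K (nat -> bool)).
Proof.
rewrite /coded_space; case: pselect => [c|u]; last exact: coded_sphere_has_size.
by apply: beads_has_size; exact/embP.
Qed.

End OneSpace.

(** The coordinates of the chain of beads would separate the points of the
    sphere by countably many functions. *)
Lemma coded_sphere_not_in_beads (K : cardinal) (fr : frame R K) (S : K -> bool) k
    (f : coded_sphere fr S -> beads R k) : continuous f -> injective f -> False.
Proof.
move=> fc fI; have HZ := coded_arcless fr S.
have [B [bB Bn]] : exists B : set (set (coded_sphere fr S)), basis B /\ B #<= [set: nat].
  apply: (@separating_basis R _ (option nat) nat (fun o x => coord o (f x))).
  - exact: sphere_compact HZ.
  - move=> o x; apply: (@cont_comp _ _ _ f (coord o)); [exact: fc|exact: coord_cont].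
  - move=> x y xy; apply: contrapT => no; apply: xy; apply: fI; apply: beads_eq => o.
    by apply: contrapT => nE; apply: no; exists o.
  - exact: emb_refl.
  - by apply: emb_option; exact: emb_refl.
by apply: (fr_unc fr); apply: countable_basis_weight (coded_sphere_has_weight fr S) bB _.
Qed.

(** There is more than one knot but only one pole. *)
Lemma beads_not_in_coded_sphere (K : cardinal) (fr : frame R K) (S : K -> bool) s
    (f : beads R (bead_code s) -> coded_sphere fr S) : continuous f -> injective f -> False.
Proof.
move=> fc fI; have HZ := coded_arcless fr S.
have pole n : f (knotp R (bead_code s) n) = pole HZ.
  apply: branch_pole; apply: branch_point_inj fc fI _.
  exact: knotp_branch (bead_code_bounds s) n.
have /fI/(congr1 (coord None)) : f (knotp R (bead_code s) 0) = f (knotp R (bead_code s) 1).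
  by rewrite !pole.
by rewrite !knotp_coord => /knot_inj.
Qed.

Lemma coded_space_equipotent (K K' : cardinal) (S : K -> bool) (S' : K' -> bool)
    (f : coded_space S -> coded_space S') :
  emb nat K -> emb nat K' -> continuous f -> injective f -> [set: K] #= [set: K'].
Proof.
move=> nK nK'; move: f; rewrite /coded_space.
case: pselect => [c|u]; case: pselect => [c'|u'] f fc fI.
- have /embP Kn := c; have /embP Kn' := c'.
  by apply: card_eq_emb; [exact: emb_trans Kn nK'|exact: emb_trans Kn' nK].
- by case: (beads_not_in_coded_sphere fc fI).
- by case: (coded_sphere_not_in_beads fc fI).
- have [g [mono surj _]] := coded_sphere_embedding fc fI.
  apply: card_eq_emb; last exact: emb_surj surj.
  exists g => x y E; have H := wo_sorder (fr_wo (chosen_frame u')).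
  by have [/mono|//|/mono] := so_total (wo_sorder (fr_wo (chosen_frame u))) x y;
    rewrite E => /(so_irr H).
Qed.

Lemma coded_space_inj (K : cardinal) (S S' : K -> bool) (f : coded_space S -> coded_space S') :
  emb nat K -> continuous f -> injective f -> S = S'.
Proof.
move=> nK; move: f; rewrite /coded_space; case: pselect => [c|u] f fc fI.
  apply: listed_bits_inj => //; first exact/embP.
  exact: bead_code_inj fc fI.
have [g [mono surj gS]] := coded_sphere_embedding fc fI.
have gE := wellorder_rigid (fr_wo (chosen_frame u)) mono surj.
by apply/funext => k; rewrite gS gE.
Qed.

Lemma coded_space_eq (K : cardinal) (S S' : K -> bool) : emb nat K ->
  coded_space S = coded_space S' -> S = S'.
Proof.
move=> nK E.
have [f [fc fI]] : exists f : coded_space S -> coded_space S', continuous f /\ injective f.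
  by rewrite -E; exists id; split=> // x.
exact: coded_space_inj fc fI.
Qed.

End Family.

Theorem theorem1 (R : realType) :
  exists P : topologicalType -> Prop,
    [/\ forall X : topologicalType, P X ->
          [/\ continuum X, pathwise_connected R X & locally_connected X],
        pairwise_non_embeddable P
      & forall K : cardinal, infinite_set [set: K] ->
          class_has_card
            (fun X => [/\ P X, has_weight X K
                        & space_has_size X (cardmax K (nat -> bool))])
            (K -> bool)].
Proof.
have nrep (K : cardinal) : infinite_set [set: K] -> emb nat (rep K).
  move=> /infinite_emb nK; apply: emb_trans nK _; apply/embP.
  by case/card_eqPle: (repP K).
exists (fun X => exists K : cardinal, infinite_set [set: K] /\
  exists S : rep K -> bool, X = coded_space R S); split.
- by move=> _ [K [/nrep nK [S ->]]]; exact: coded_space_continuum.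
- move=> _ _ [K [/nrep nK [S ->]]] [K' [/nrep nK' [S' ->]]] nE /embeddable_inj[f [fc fI]].
  apply: nE.
  have E : rep K = rep K'.
    apply: rep_eq; apply: card_eq_trans (repP K) _; rewrite card_eq_sym.
    apply: card_eq_trans (repP K') _; rewrite card_eq_sym.
    exact: coded_space_equipotent fc fI.
  move: (rep K') E nK' S' f fc fI => L E; subst L => _ S' f fc fI.
  by rewrite (coded_space_inj nK fc fI).
- move=> K Kinf; have nK := nrep K Kinf.
  have [b [c [bK cK]]] := equipotent_maps (repP K).
  exists (fun S => coded_space R (S \o b)); split.
    move=> S S' /(coded_space_eq nK) E; apply/funext => k.
    by move: E => /(congr1 (@^~ (c k))) /=; rewrite cK.
  move=> X; split=> [[[K' [Kinf' [S' ->]]] wK _]|[S <-]].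
    have E : rep K' = rep K.
      apply: rep_eq; apply: card_eq_trans (repP K') _.
      exact: has_weight_unique (coded_space_has_weight R S' (nrep K' Kinf')) wK.
    move: (rep K') E S' {wK} => L E; subst L => S'.
    exists (S' \o c); congr coded_space; apply/funext => k /=; by rewrite bK.
  split.
  + by exists K; split=> //; exists (S \o b).
  + apply: has_weight_equipotent (coded_space_has_weight R (S \o b) nK).
    by rewrite card_eq_sym; exact: repP.
  + have := coded_space_has_size R (S \o b); rewrite /space_has_size /cardmax.
    have -> : ([set: rep K] #<= [set: nat -> bool]) = ([set: K] #<= [set: nat -> bool]).
      have /card_eqPle[h1 h2] := repP K.
      by apply/idP/idP; apply: card_le_trans.
    case: ifP => // _ h; apply: card_eq_trans h _; rewrite card_eq_sym; exact: repP.
Qed.
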